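(* Fix $\sigma\in\{1,-1\}$, $a>0$, $e\in\{-1,0,1\}$, a real-valued $H\in C^\infty(\mathbb R^3)$, and $\rho\in C^\infty(\mathbb R)$ with $\operatorname{supp}\rho\subseteq[-1,1]$ and $\int_{\mathbb R}\rho=1$; put $\delta_\varepsilon(x)=\varepsilon^{-1}\rho(x/\varepsilon)$ for $\varepsilon\in I=(0,1]$. Let $M=\{(U,V,Z_2,Z_3,Z_4)\in\mathbb R^5:\ -2UV+Z_2^2+Z_3^2+\sigma Z_4^2=\sigma a^2\}$. Let $\gamma^-:\mathbb R\to M$ be a geodesic of the background metric $g_0$ induced on $M$ by $dZ_2^2+dZ_3^2+\sigma dZ_4^2-2\,dU\,dV$, with $U^-(0)=0$, $\dot U^-(0)>0$ (where $U^-$ is the $U$-component of $\gamma^-$) and $g_0(\dot\gamma^-,\dot\gamma^-)=e$. For $\varepsilon$ small let $\alpha_\varepsilon<0$ be the parameter value closest to $0$ with $U^-(\alpha_\varepsilon)=-\varepsilon$. Consider, for curves $(U,V,Z_2,Z_3,Z_4)$, the system \[ \begin{aligned} \ddot U&=-\Phi_\varepsilon\,\frac{U}{N_\varepsilon},\\ \ddot V-\tfrac12 H\,\delta_\varepsilon'(U)\,\dot U^2-\delta_\varepsilon(U)\,\dot U\sum_{p=2}^4 H_{,p}\dot Z_p&=-\Phi_\varepsilon\,\frac{V+H\,\delta_\varepsilon(U)\,U}{N_\varepsilon},\\ \ddot Z_i-\tfrac12 H_{,i}\,\delta_\varepsilon(U)\,\dot U^2&=-\Phi_\varepsilon\,\frac{Z_i}{N_\varepsilon}\quad(i=2,3),\\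 \ddot Z_4-\tfrac{\sigma}{2} H_{,4}\,\delta_\varepsilon(U)\,\dot U^2&=-\Phi_\varepsilon\,\frac{Z_4}{N_\varepsilon}, \end{aligned} \] with $H,H_{,p}$ evaluated at $(Z_2,Z_3,Z_4)$, $N_\varepsilon=\sigma a^2-U^2H\delta_\varepsilon(U)$, $G_\varepsilon=\delta_\varepsilon(U)\sum_{p=2}^4H_{,p}Z_p+H\delta_\varepsilon'(U)U$, $\Phi_\varepsilon=e+\tfrac12\dot U^2G_\varepsilon-\dot U\frac{d}{dt}(H\delta_\varepsilon(U)U)$. Then the global generalized solution of this system with data $\gamma^-(\alpha_\varepsilon)$, $\dot\gamma^-(\alpha_\varepsilon)$ at $t=\alpha_\varepsilon$ is unique: if $\gamma=[(\gamma_\varepsilon)_\varepsilon]$ and $\tilde\gamma=[(\tilde\gamma_\varepsilon)_\varepsilon]$ in $\mathcal G[\mathbb R,M]$ both solve the system in the generalized sense and both satisfy $\big(\gamma_\varepsilon(\alpha_\varepsilon)-\gamma^-(\alpha_\varepsilon)\big)_\varepsilon$, $\big(\dot\gamma_\varepsilon(\alpha_\varepsilon)-\dot\gamma^-(\alpha_\varepsilon)\big)_\varepsilon$ negligible (and likewise for $\tilde\gamma_\varepsilon$), then $\gamma=\tilde\gamma$ in $\mathcal G[\mathbb R,M]$.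
   Context: Colombeau notions: a net of real numbers $(r_\varepsilon)_\varepsilon$ is negligible if $|r_\varepsilon|=O(\varepsilon^m)$ for every $m$. For an interval $J\subseteq\mathbb R$, a net $(\gamma_\varepsilon)_{\varepsilon\in I}$ of smooth curves $J\to\mathbb R^5$ depending smoothly on $\varepsilon$ is moderate if for every compact $K\subseteq J$ and every $k\ge0$ there is $N$ with $\sup_{K}|\gamma_\varepsilon^{(k)}|=O(\varepsilon^{-N})$; negligible if moderate and $\sup_K|\gamma_\varepsilon|=O(\varepsilon^m)$ for all compact $K$ and all $m$; c-bounded if for every compact $K\subseteq J$ there is a compact $L$ with $\gamma_\varepsilon(K)\subseteq L$ for small $\varepsilon$. $\mathcal G[J,\mathbb R^5]$ is the set of moderate c-bounded nets modulo negligible differences, $\mathcal G[J,M]$ the classes with representatives in $M$. A generalized curve solves the system in the generalized sense if inserting a representative yields a negligible residual net. The system is the geodesic equation (for velocity of squared norm $e$) of the generalized metric on $M$ induced by the generalized metric with representative $dZ_2^2+dZ_3^2+\sigma dZ_4^2-2\,dU\,dV+H(Z_2,Z_3,Z_4)\delta_\varepsilon(U)\,dU^2$ on $\mathbb R^5$. *)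

(* Defs.v *)
From Stdlib Require Import Reals List.
From Coquelicot Require Import Coquelicot.
Open Scope R_scope.

Definition smooth1 (f : R -> R) : Prop := forall (n : nat) (x : R), ex_derive_n f n x.

(* Functions of finitely many variables, encoded as (nat -> R) -> R where only
   the coordinates 0 .. n-1 are used. *)
Definition upd (x : nat -> R) (i : nat) (s : R) : nat -> R :=
  fun j => if Nat.eqb j i then s else x j.

Definition partial (i : nat) (f : (nat -> R) -> R) : (nat -> R) -> R :=
  fun x => Derive (fun s => f (upd x i s)) (x i).

Fixpoint iter_partial (l : list nat) (f : (nat -> R) -> R) : (nat -> R) -> R :=
  match l with
  | nil => f
  | cons i l' => partial i (iter_partial l' f)
  end.

Definition cont_n (n : nat) (g : (nat -> R) -> R) (x : nat -> R) : Prop :=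
  forall eps, 0 < eps -> exists delta, 0 < delta /\
    forall y, (forall i, (i < n)%nat -> Rabs (y i - x i) < delta) ->
              (forall i, (n <= i)%nat -> y i = x i) ->
              Rabs (g y - g x) < eps.

Definition smooth_on (n : nat) (D : (nat -> R) -> Prop) (f : (nat -> R) -> R) : Prop :=
  forall l, List.Forall (fun i => (i < n)%nat) l -> forall x, D x ->
    cont_n n (iter_partial l f) x /\
    forall i, (i < n)%nat -> ex_derive (fun s => iter_partial l f (upd x i s)) (x i).

Definition smooth3 (H : R -> R -> R -> R) : Prop :=
  smooth_on 3 (fun _ => True) (fun x => H (x 0%nat) (x 1%nat) (x 2%nat)).

(* (eps,t) |-> f eps t jointly smooth on {eps > 0} x R (for eps in I=(0,1] this
   is smooth dependence on eps, up to harmless extension beyond eps = 1) *)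
Definition smooth_net_comp (f : R -> R -> R) : Prop :=
  smooth_on 2 (fun x => 0 < x 0%nat) (fun x => f (x 0%nat) (x 1%nat)).

Record R5 := mk5 { cU : R; cV : R; cZ2 : R; cZ3 : R; cZ4 : R }.

Definition nrm5 (p : R5) : R :=
  sqrt (cU p ^ 2 + cV p ^ 2 + cZ2 p ^ 2 + cZ3 p ^ 2 + cZ4 p ^ 2).

Definition sub5 (p q : R5) : R5 :=
  mk5 (cU p - cU q) (cV p - cV q) (cZ2 p - cZ2 q) (cZ3 p - cZ3 q) (cZ4 p - cZ4 q).

Definition dern5 (c : R -> R5) (k : nat) (t : R) : R5 :=
  mk5 (Derive_n (fun s => cU (c s)) k t) (Derive_n (fun s => cV (c s)) k t)
      (Derive_n (fun s => cZ2 (c s)) k t) (Derive_n (fun s => cZ3 (c s)) k t)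
      (Derive_n (fun s => cZ4 (c s)) k t).

Definition smooth_curve (c : R -> R5) : Prop :=
  smooth1 (fun t => cU (c t)) /\ smooth1 (fun t => cV (c t)) /\
  smooth1 (fun t => cZ2 (c t)) /\ smooth1 (fun t => cZ3 (c t)) /\
  smooth1 (fun t => cZ4 (c t)).

Definition eta (sigma : R) (p q : R5) : R :=
  - (cU p * cV q + cV p * cU q) + cZ2 p * cZ2 q + cZ3 p * cZ3 q
  + sigma * cZ4 p * cZ4 q.

Definition inM (sigma a : R) (p : R5) : Prop :=
  -2 * cU p * cV p + cZ2 p ^ 2 + cZ3 p ^ 2 + sigma * cZ4 p ^ 2 = sigma * a ^ 2.

(* Geodesic of the metric g0 induced on M (nondegenerate hypersurface, normal
   vector x at x): the induced Levi-Civita connection is the tangential part of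
   the ambient one, so a smooth curve in M is a g0-geodesic iff its ambient
   acceleration is eta-orthogonal to T_x M = { w | eta(x,w) = 0 }. *)
Definition bg_geodesic (sigma a : R) (g : R -> R5) : Prop :=
  smooth_curve g /\ (forall t, inM sigma a (g t)) /\
  forall t w, eta sigma (g t) w = 0 -> eta sigma (dern5 g 2 t) w = 0.

Definition negligible_R5 (r : R -> R5) : Prop :=
  forall m : nat, exists C eps0, 0 < eps0 /\
    forall eps, 0 < eps < eps0 -> nrm5 (r eps) <= C * eps ^ m.

Definition moderate_net (g : R -> R -> R5) : Prop :=
  forall K, compact K -> forall k : nat, exists (N : nat) C eps0, 0 < eps0 /\
    forall eps, 0 < eps < eps0 -> forall t, K t ->
      nrm5 (dern5 (g eps) k t) <= C * / eps ^ N.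

Definition negligible_net (g : R -> R -> R5) : Prop :=
  moderate_net g /\
  forall K, compact K -> forall m : nat, exists C eps0, 0 < eps0 /\
    forall eps, 0 < eps < eps0 -> forall t, K t -> nrm5 (g eps t) <= C * eps ^ m.

(* c-bounded: images of compacts stay in a fixed compact of R^5 for small eps,
   i.e. (Heine-Borel) stay uniformly bounded *)
Definition c_bounded (g : R -> R -> R5) : Prop :=
  forall K, compact K -> exists C eps0, 0 < eps0 /\
    forall eps, 0 < eps < eps0 -> forall t, K t -> nrm5 (g eps t) <= C.

Definition smooth_net (g : R -> R -> R5) : Prop :=
  smooth_net_comp (fun e t => cU (g e t)) /\ smooth_net_comp (fun e t => cV (g e t)) /\
  smooth_net_comp (fun e t => cZ2 (g e t)) /\ smooth_net_comp (fun e t => cZ3 (g e t)) /\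
  smooth_net_comp (fun e t => cZ4 (g e t)).

Definition rep_GM (sigma a : R) (g : R -> R -> R5) : Prop :=
  smooth_net g /\ moderate_net g /\ c_bounded g /\
  forall eps t, 0 < eps <= 1 -> inM sigma a (g eps t).

Definition delta (rho : R -> R) (eps x : R) : R := / eps * rho (x / eps).
Definition ddelta (rho : R -> R) (eps x : R) : R := Derive (delta rho eps) x.

Definition dH2 (H : R -> R -> R -> R) (z2 z3 z4 : R) : R := Derive (fun s => H s z3 z4) z2.
Definition dH3 (H : R -> R -> R -> R) (z2 z3 z4 : R) : R := Derive (fun s => H z2 s z4) z3.
Definition dH4 (H : R -> R -> R -> R) (z2 z3 z4 : R) : R := Derive (fun s => H z2 z3 s) z4.

Definition residual (sigma a e : R) (H : R -> R -> R -> R) (rho : R -> R)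
    (eps : R) (c : R -> R5) (t : R) : R5 :=
  let U := fun s => cU (c s) in
  let Z2 := fun s => cZ2 (c s) in
  let Z3 := fun s => cZ3 (c s) in
  let Z4 := fun s => cZ4 (c s) in
  let p := c t in
  let d1 := dern5 c 1 t in
  let d2 := dern5 c 2 t in
  let Ud := cU d1 in
  let Hv := H (cZ2 p) (cZ3 p) (cZ4 p) in
  let H2 := dH2 H (cZ2 p) (cZ3 p) (cZ4 p) in
  let H3 := dH3 H (cZ2 p) (cZ3 p) (cZ4 p) in
  let H4 := dH4 H (cZ2 p) (cZ3 p) (cZ4 p) in
  let dl := delta rho eps (cU p) in
  let ddl := ddelta rho eps (cU p) in
  let N := sigma * a ^ 2 - (cU p) ^ 2 * Hv * dl in
  let G := dl * (H2 * cZ2 p + H3 * cZ3 p + H4 * cZ4 p) + Hv * ddl * cU p in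
  let Phi := e + / 2 * Ud ^ 2 * G
             - Ud * Derive (fun s => H (Z2 s) (Z3 s) (Z4 s) * delta rho eps (U s) * U s) t in
  mk5
    (cU d2 + Phi * cU p / N)
    (cV d2 - / 2 * Hv * ddl * Ud ^ 2 - dl * Ud * (H2 * cZ2 d1 + H3 * cZ3 d1 + H4 * cZ4 d1)
       + Phi * (cV p + Hv * dl * cU p) / N)
    (cZ2 d2 - / 2 * H2 * dl * Ud ^ 2 + Phi * cZ2 p / N)
    (cZ3 d2 - / 2 * H3 * dl * Ud ^ 2 + Phi * cZ3 p / N)
    (cZ4 d2 - sigma / 2 * H4 * dl * Ud ^ 2 + Phi * cZ4 p / N).

Definition gen_solution (sigma a e : R) (H : R -> R -> R -> R) (rho : R -> R)
    (g : R -> R -> R5) : Prop :=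
  negligible_net (fun eps t => residual sigma a e H rho eps (g eps) t).

(* Main.v *)
Require Import Defs.
From Stdlib Require Import Reals.
From Coquelicot Require Import Coquelicot.
From Stdlib Require Import Lra Lia List Classical ClassicalEpsilon FunctionalExtensionality.
Open Scope R_scope.

(** Write [x = U / eps], [kappa = e / (sigma a^2)] and [mu = sqrt (eps^2 + U^2)]. Outside the wave
    zone [|U| <= eps] the system is linear; inside, its Lipschitz constants blow up like powers of
    [1 / eps], so a direct Gronwall estimate would give a factor [exp (eps^-k)]. Two Lyapunov
    functions repair this, without counting the (possibly many) crossings of [U = 0].

    First, [U' arctan x] has derivative [U'^2 eps / mu^2] up to a bounded term. Hence the impulsive
    part of the equations has bounded time integral, so, by a bootstrap argument, the velocities of
    [Z] stay bounded and [U'^2 + kappa U^2] is conserved up to [O(eps)]; in particular [U'] is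
    bounded away from 0 near [U = 0].

    Second, [U' arcsinh x] has derivative [U'^2 / mu] up to [O(ln (1/eps))], so that the time
    integral of [1 / mu] is [O(ln (1/eps))]. Two solutions are compared in an energy where the
    difference of the [U]-components has weight [1 / mu], that of [V] and [V'] has weight [eps], and
    all others have weight 1. In this energy the system is Lipschitz with constant [O(1 / mu)], so
    Gronwall's inequality costs only a negative power of [eps], which negligibility absorbs. *)

(** * Comparison principles *)

(** C-boundedness controls positions only, while moderateness allows velocities to grow like powers
    of [1 / eps]. Bounds on velocities are mutually dependent: the impulses felt by [Z] are
    controlled through [U'], and the equation for [U'] contains the velocities of [Z]. The circle
    opens because these enter the equation for [U'] with a factor [eps], so the crude bound
    [eps ^ 2 * y <= 1] on their squares is enough to start a continuity argument. The three kinds of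
    equations are not equally singular. On the right of the [U]-equation the factor [U = eps * x]
    cancels the [1 / eps] in [Phi]; the [Z]-equations keep one power [1 / eps]; the [V]-equation
    contains [eps^-2 rho'(x)], which the weight [eps] lowers to the level of [Z]. Neither [V] nor
    [V'] occurs in the other equations, so the low weight does no harm there. The rate [1 / mu], and
    hence the logarithm, is forced by the weight itself: [1 / mu ^ 2] along a solution has a
    logarithmic derivative of size [|U'| / mu], and the cross term between the differences of [U]
    and of [U'] is of the same order. *)

Lemma is_derive_le_increment (f g df dg : R -> R) (a b : R) :
  a <= b ->
  (forall t, a <= t <= b -> is_derive f t (df t)) ->
  (forall t, a <= t <= b -> is_derive g t (dg t)) ->
  (forall t, a <= t <= b -> df t <= dg t) ->
  f b - f a <= g b - g a.
Proof.
  intros Hab Hf Hg Hle.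
  destruct (MVT_gen (fun t => g t - f t) a b (fun t => dg t - df t)) as [c [Hc E]].
  - intros x Hx. rewrite Rmin_left, Rmax_right in Hx by lra.
    apply (is_derive_minus g f); [apply Hg|apply Hf]; lra.
  - intros x Hx. rewrite Rmin_left, Rmax_right in Hx by lra.
    apply derivable_continuous_pt. exists (dg x - df x).
    apply is_derive_Reals. apply (is_derive_minus g f); [apply Hg|apply Hf]; lra.
  - rewrite Rmin_left, Rmax_right in Hc by lra.
    specialize (Hle c Hc). assert (0 <= (dg c - df c) * (b - a)) by (apply Rmult_le_pos; lra).
    lra.
Qed.

(** The function [y * exp (- Psi)] has a nonpositive derivative. As in the previous lemma, integrals
    are represented by primitives: only the increment of [Psi] enters, so rates as large as
    [1 / eps] are harmless when their primitive stays bounded or logarithmic. *)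
Lemma gronwall (y dy Psi dPsi : R -> R) (b : R) :
  0 <= b ->
  (forall t, 0 <= t <= b -> is_derive y t (dy t)) ->
  (forall t, 0 <= t <= b -> is_derive Psi t (dPsi t)) ->
  (forall t, 0 <= t <= b -> dy t <= dPsi t * y t) ->
  y b <= y 0 * exp (Psi b - Psi 0).
Proof.
  intros Hb Hy HP Hle.
  assert (H : y b * exp (- Psi b) - y 0 * exp (- Psi 0) <= 0 - 0).
  { apply (is_derive_le_increment (fun t => y t * exp (- Psi t)) (fun _ => 0)
             (fun t => dy t * exp (- Psi t) + y t * (- dPsi t * exp (- Psi t)))
             (fun _ => 0) 0 b Hb).
    - intros t Ht. specialize (Hy t Ht). specialize (HP t Ht).
      apply (is_derive_mult y (fun s => exp (- Psi s)) t (dy t) (- dPsi t * exp (- Psi t)));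
        [exact Hy| |intros; apply Rmult_comm].
      apply (is_derive_comp exp (fun s => - Psi s) t (exp (- Psi t)) (- dPsi t)).
      + apply is_derive_exp.
      + apply (is_derive_opp Psi); exact HP.
    - intros t Ht. apply @is_derive_const.
    - intros t Ht. specialize (Hle t Ht). pose proof (exp_pos (- Psi t)).
      replace (dy t * exp (- Psi t) + y t * (- dPsi t * exp (- Psi t)))
        with (- ((dPsi t * y t - dy t) * exp (- Psi t))) by ring.
      assert (0 <= (dPsi t * y t - dy t) * exp (- Psi t)) by (apply Rmult_le_pos; lra).
      lra. }
  replace (Psi b - Psi 0) with (- Psi 0 + Psi b) by ring.
  rewrite exp_plus.
  assert (H1 : y b * exp (- Psi b) <= y 0 * exp (- Psi 0)) by lra.
  apply Rmult_le_compat_r with (r := exp (Psi b)) in H1; [|left; apply exp_pos].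
  rewrite Rmult_assoc, <- exp_plus in H1.
  replace (- Psi b + Psi b) with 0 in H1 by ring. rewrite exp_0 in H1. lra.
Qed.

Lemma continuous_lt_locally (f : R -> R) (x c : R) :
  continuous f x -> f x < c ->
  exists d, 0 < d /\ forall y, Rabs (y - x) < d -> f y < c.
Proof.
  intros Hc Hlt.
  assert (He : 0 < c - f x) by lra.
  apply continuity_pt_filterlim in Hc.
  destruct (Hc (c - f x) He) as [d [Hd H]].
  exists d. split; [exact Hd|]. intros y Hy.
  destruct (Req_dec y x) as [->|Hne]; [lra|].
  assert (Hy' : Rabs (f y - f x) < c - f x).
  { apply H. split; [split; [exact I|congruence]|exact Hy]. }
  apply Rabs_def2 in Hy'. lra.
Qed.

(** Continuity method on the supremum [m] of the times up to which both bounds hold. By continuity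
    the bounds reach [m]; the step makes them strict there, and strict bounds survive slightly
    beyond [m] unless [m = b]. Two functions are treated at once because in the application neither
    bound can be improved without the other. *)
Lemma bootstrap (f g : R -> R) (b : R) :
  0 <= b ->
  (forall t, 0 <= t <= b -> continuous f t) ->
  (forall t, 0 <= t <= b -> continuous g t) ->
  f 0 <= 1 -> g 0 <= 1 ->
  (forall s, 0 <= s <= b -> (forall t, 0 <= t <= s -> f t <= 1 /\ g t <= 1) ->
     f s < 1 /\ g s < 1) ->
  forall t, 0 <= t <= b -> f t < 1 /\ g t < 1.
Proof.
  intros Hb Cf Cg f0 g0 Hstep.
  set (S := fun s => 0 <= s <= b /\ forall t, 0 <= t <= s -> f t <= 1 /\ g t <= 1).
  assert (S0 : S 0).
  { split; [lra|]. intros t Ht. replace t with 0 by lra. auto. }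
  destruct (completeness S) as [m [Hub Hlub]].
  { exists b. intros s [Hs _]. lra. }
  { exists 0. exact S0. }
  assert (Hm : 0 <= m <= b).
  { split; [apply Hub, S0|]. apply Hlub. intros s [Hs _]. lra. }
  assert (Hlt : forall t, 0 <= t < m -> f t <= 1 /\ g t <= 1).
  { intros t Ht. apply NNPP. intro Hn.
    assert (m <= t); [|lra]. apply Hlub. intros s [Hs Hs'].
    destruct (Rle_dec s t) as [|Hst]; [assumption|].
    exfalso. apply Hn, Hs'. lra. }
  assert (Hstrict : forall t, 0 <= t < m -> f t < 1 /\ g t < 1).
  { intros t Ht. apply Hstep; [lra|]. intros u Hu. apply Hlt. lra. }
  assert (closure : forall h, (forall t, 0 <= t <= b -> continuous h t) -> h 0 <= 1 ->
            (forall t, 0 <= t < m -> h t <= 1) -> h m <= 1).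
  { intros h Ch h0 Hh. apply Rnot_lt_le. intro Hgt.
    destruct (Req_dec m 0) as [E|Hne]; [rewrite E in Hgt; lra|].
    destruct (continuous_lt_locally (fun t => - h t) m (-1)) as [d [Hd H]].
    - apply (continuous_opp h). apply Ch. lra.
    - lra.
    - set (t := Rmax 0 (m - d / 2)).
      assert (Ht : 0 <= t < m) by (unfold t; split; [apply Rmax_l|apply Rmax_lub_lt; lra]).
      assert (m - d / 2 <= t) by apply Rmax_r.
      specialize (Hh t Ht). assert (- h t < -1); [|lra].
      apply H. rewrite Rabs_left; lra. }
  assert (Hall : forall t, 0 <= t <= m -> f t <= 1 /\ g t <= 1).
  { intros t Ht. destruct (Req_dec t m) as [->|]; [|apply Hlt; lra].
    split; (apply closure; [assumption|assumption|intros; apply Hlt; assumption]). }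
  assert (Em : m = b).
  { destruct (Req_dec m b) as [|Hne]; [assumption|exfalso].
    destruct (Hstep m Hm Hall) as [Hf Hg].
    destruct (continuous_lt_locally f m 1 (Cf m Hm) Hf) as [d1 [Hd1 H1]].
    destruct (continuous_lt_locally g m 1 (Cg m Hm) Hg) as [d2 [Hd2 H2]].
    set (s := Rmin b (m + Rmin d1 d2 / 2)).
    assert (Hd : 0 < Rmin d1 d2) by (apply Rmin_glb_lt; assumption).
    assert (Hs : m < s) by (apply Rmin_glb_lt; lra).
    assert (Hs1 : s <= b) by apply Rmin_l.
    assert (Hs2 : s <= m + Rmin d1 d2 / 2) by apply Rmin_r.
    pose proof (Rmin_l d1 d2). pose proof (Rmin_r d1 d2).
    assert (s <= m); [|lra]. apply Hub. split; [lra|].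
    intros t Ht. destruct (Rle_dec t m); [apply Hall; lra|].
    split; left; [apply H1|apply H2]; rewrite Rabs_right; lra. }
  intros t Ht. apply Hstep; [assumption|]. intros u Hu. apply Hall. lra.
Qed.

(** * A priori bounds for one solution *)

Lemma Rabs_le_of_sqr_le (x m : R) : 0 <= m -> x ^ 2 <= m ^ 2 -> Rabs x <= m.
Proof.
  intros Hm H. rewrite <- (Rabs_right m) by lra. apply Rsqr_le_abs_0. unfold Rsqr. lra.
Qed.

Lemma exp_le_compat (x y : R) : x <= y -> exp x <= exp y.
Proof.
  intros [H| ->]; [left; apply exp_increasing, H|right; reflexivity].
Qed.

Lemma is_derive_mult_const (k t : R) : is_derive (fun s => k * s) t k.
Proof.
  auto_derive; [exact I|ring].
Qed.

Lemma Rabs_atan_le (x : R) : Rabs (atan x) <= 2.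
Proof.
  pose proof (atan_bound x). pose proof PI_4. apply Rabs_le. lra.
Qed.

Lemma Rabs_mult_le (x y a b : R) : Rabs x <= a -> Rabs y <= b -> Rabs (x * y) <= a * b.
Proof.
  intros. rewrite Rabs_mult. apply Rmult_le_compat; auto using Rabs_pos.
Qed.

Lemma inv_1_plus_sqr_bounds (x : R) : 0 < / (1 + x ^ 2) <= 1.
Proof.
  assert (1 <= 1 + x ^ 2) by (pose proof (pow2_ge_0 x); lra).
  split; [apply Rinv_0_lt_compat; lra|].
  rewrite <- Rinv_1 at 2. apply Rinv_le_contravar; lra.
Qed.

Lemma is_derive_mult_atan (eps : R) (U V : R -> R) (A t : R) :
  0 < eps -> is_derive U t (V t) -> is_derive V t A ->
  is_derive (fun s => V s * atan (U s / eps)) t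
    (V t ^ 2 * (/ (1 + (U t / eps) ^ 2) / eps) + A * atan (U t / eps)).
Proof.
  intros He HU HV.
  replace (V t ^ 2 * (/ (1 + (U t / eps) ^ 2) / eps) + A * atan (U t / eps))
    with (A * atan (U t / eps) + V t * (V t / eps * / (1 + (U t / eps)²))).
  2:{ unfold Rsqr. field. pose proof (pow2_ge_0 (U t)). pose proof (pow2_gt_0 eps). split; [|lra].
      assert (0 < eps ^ 2) by (apply pow2_gt_0; lra). nra. }
  apply (is_derive_mult V (fun s => atan (U s / eps)) t A
           (V t / eps * / (1 + (U t / eps)²))); [exact HV| |intros; apply Rmult_comm].
  apply (is_derive_comp atan (fun s => U s / eps) t (/ (1 + (U t / eps)²)) (V t / eps)).
  - apply is_derive_atan.
  - apply is_derive_ext with (f := fun s => / eps * U s); [intro; apply Rmult_comm|].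
    unfold Rdiv. rewrite Rmult_comm. apply is_derive_scal. exact HU.
Qed.

(* [w2, w3, w4] are the velocities of [Z2, Z3, Z4].
   The weight [/ (1 + (U / eps) ^ 2)] replaces the indicator function of [|U| <= eps]:
   up to [O(eps)], its product with [V ^ 2 / eps] is the derivative of the bounded
   function [V * atan (U / eps)], so its time integral is bounded whatever the number
   of crossings of [U = 0]. *)
Lemma a_priori_bounds (kap c2 K C T : R) :
  0 < c2 -> 0 <= K -> 0 <= C -> 0 <= T ->
  exists eps1 B, 0 < eps1 /\ 0 <= B /\
  forall eps, 0 < eps < eps1 ->
  forall U V A w2 w3 w4 a2 a3 a4 : R -> R,
  (forall t, 0 <= t <= T ->
     is_derive U t (V t) /\ is_derive V t (A t) /\ is_derive w2 t (a2 t) /\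
     is_derive w3 t (a3 t) /\ is_derive w4 t (a4 t) /\ Rabs (U t) <= K) ->
  (forall t, 0 <= t <= T ->
     let q := / (1 + (U t / eps) ^ 2) in
     let Y := 1 + Rabs (w2 t) + Rabs (w3 t) + Rabs (w4 t) in
     let X := C * (1 + V t ^ 2 * (q / eps) + q * Rabs (V t) * Y) in
     Rabs (A t + kap * U t) <= C * (q * (V t ^ 2 + eps * Rabs (V t) * Y + eps ^ 2) + eps) /\
     Rabs (a2 t) <= X /\ Rabs (a3 t) <= X /\ Rabs (a4 t) <= X) ->
  Rabs (V 0 ^ 2 + kap * U 0 ^ 2 - c2) <= c2 / 8 ->
  Rabs (w2 0) <= K -> Rabs (w3 0) <= K -> Rabs (w4 0) <= K ->
  forall t, 0 <= t <= T ->
    Rabs (V t) <= B /\ Rabs (A t) <= B /\ Rabs (w2 t) <= B /\ Rabs (w3 t) <= B /\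
    Rabs (w4 t) <= B /\ Rabs (V t ^ 2 + kap * U t ^ 2 - c2) <= c2 / 4.
Proof.
  intros Hc2 HK HC HT.
  (* Constants in order of dependence, all free of [eps]: [M] bounds [V], [A0] bounds [A], [By] is
     the Gronwall bound for [y], and [eps * A2] bounds the drift of the energy [E]. *)
  set (M := 1 + 2 * c2 + Rabs kap * K ^ 2).
  set (A0 := Rabs kap * K + C * (M ^ 2 + 4 * M + 2)).
  set (By := (1 + 3 * K ^ 2) * exp (8 * C * ((1 + M + 2 * A0) * T + 4 * M))).
  set (A2 := 2 * M * C * (4 * M + (2 * A0 + 4 * M * By + 2) * T)).
  assert (HkK : 0 <= Rabs kap * K ^ 2) by (apply Rmult_le_pos; [apply Rabs_pos|apply pow2_ge_0]).
  assert (HM : 1 <= M) by (unfold M; lra).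
  assert (HA0 : 0 <= A0).
  { unfold A0. apply Rplus_le_le_0_compat; apply Rmult_le_pos; try apply Rabs_pos; try assumption. nra. }
  assert (HBy : 1 <= By).
  { unfold By. replace 1 with (1 * 1) at 1 by ring. pose proof (pow2_ge_0 K).
    apply Rmult_le_compat; try lra. rewrite <- exp_0 at 1.
    apply exp_le_compat. apply Rmult_le_pos; [lra|].
    assert (0 <= (1 + M + 2 * A0) * T) by (apply Rmult_le_pos; lra). lra. }
  assert (HA2 : 0 <= A2).
  { unfold A2. apply Rmult_le_pos; [nra|].
    assert (0 <= (2 * A0 + 4 * M * By + 2) * T) by (apply Rmult_le_pos; nra). lra. }
  (* The second entry makes [eps ^ 2 * y < 1] follow from [y <= By]. The third keeps the drift of
     [E] below [c2 / 16]; with the initial error [c2 / 8] this stays strictly under [c2 / 4]. These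
     are the two strict conclusions of the bootstrap. *)
  set (eps1 := Rmin 1 (Rmin (/ (By + 1)) (c2 / (16 * (A2 + 1))))).
  assert (He1 : 0 < eps1).
  { unfold eps1. repeat apply Rmin_glb_lt; try lra.
    - apply Rinv_0_lt_compat; lra.
    - apply Rdiv_lt_0_compat; lra. }
  exists eps1, (M + A0 + By). split; [exact He1|]. split; [lra|].
  intros eps [He Hlt] U V A w2 w3 w4 a2 a3 a4 Hder Hode HE0 H20 H30 H40.
  assert (Hle1 : eps < 1) by (eapply Rlt_le_trans; [exact Hlt|apply Rmin_l]).
  assert (Hle2 : eps < / (By + 1)).
  { eapply Rlt_le_trans; [exact Hlt|]. eapply Rle_trans; [apply Rmin_r|apply Rmin_l]. }
  assert (Hle3 : eps < c2 / (16 * (A2 + 1))).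
  { eapply Rlt_le_trans; [exact Hlt|]. eapply Rle_trans; [apply Rmin_r|apply Rmin_r]. }
  set (q := fun t => / (1 + (U t / eps) ^ 2)).
  set (Y := fun t => 1 + Rabs (w2 t) + Rabs (w3 t) + Rabs (w4 t)).
  (* A differentiable substitute for [Y], comparable through [Y ^ 2 <= 4 * y]. *)
  set (y := fun t => 1 + w2 t ^ 2 + w3 t ^ 2 + w4 t ^ 2).
  set (dy := fun t => 2 * w2 t * a2 t + 2 * w3 t * a3 t + 2 * w4 t * a4 t).
  set (E := fun t => V t ^ 2 + kap * U t ^ 2).
  set (dE := fun t => 2 * V t * (A t + kap * U t)).
  set (th := fun t => V t * atan (U t / eps)).
  set (dth := fun t => V t ^ 2 * (q t / eps) + A t * atan (U t / eps)).
  assert (Dy : forall t, 0 <= t <= T -> is_derive y t (dy t)).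
  { intros t Ht. destruct (Hder t Ht) as (_ & _ & D2 & D3 & D4 & _).
    unfold y, dy.
    auto_derive; [repeat split; eexists; eassumption|].
    rewrite (is_derive_unique (fun x : R => w2 x) _ _ D2), (is_derive_unique (fun x : R => w3 x) _ _ D3),
      (is_derive_unique (fun x : R => w4 x) _ _ D4).
    ring. }
  assert (DE : forall t, 0 <= t <= T -> is_derive E t (dE t)).
  { intros t Ht. destruct (Hder t Ht) as (D1 & D2 & _).
    unfold E, dE.
    auto_derive; [repeat split; eexists; eassumption|].
    rewrite (is_derive_unique (fun x : R => U x) _ _ D1), (is_derive_unique (fun x : R => V x) _ _ D2). ring. }
  assert (Dth : forall t, 0 <= t <= T -> is_derive th t (dth t)).
  { intros t Ht. destruct (Hder t Ht) as (D1 & D2 & _).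
    apply is_derive_mult_atan; assumption. }
  assert (Hyw : forall t, Rabs (w2 t) <= y t /\ Rabs (w3 t) <= y t /\ Rabs (w4 t) <= y t
                  /\ Y t ^ 2 <= 4 * y t /\ 1 <= Y t).
  { intro t. unfold y, Y.
    rewrite <- (pow2_abs (w2 t)), <- (pow2_abs (w3 t)), <- (pow2_abs (w4 t)).
    pose proof (Rabs_pos (w2 t)). pose proof (Rabs_pos (w3 t)). pose proof (Rabs_pos (w4 t)).
    set (u := Rabs (w2 t)) in *. set (v := Rabs (w3 t)) in *. set (z := Rabs (w4 t)) in *.
    pose proof (pow2_ge_0 (u - 1)). pose proof (pow2_ge_0 (v - 1)). pose proof (pow2_ge_0 (z - 1)).
    pose proof (pow2_ge_0 (u - v)). pose proof (pow2_ge_0 (u - z)). pose proof (pow2_ge_0 (v - z)).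
    repeat split; nra. }
  assert (Hq : forall t, 0 < q t <= 1) by (intro; apply inv_1_plus_sqr_bounds).
  (* Pointwise consequences of the two bootstrap assumptions. The second gives only [eps * Y <= 4],
     which suffices because [Y] enters the bound on [A] multiplied by [eps]. Then [dth] differs from
     [V ^ 2 * (q / eps)] by at most [2 * A0], since the arctangent is bounded by 2. *)
  assert (Hpt : forall t, 0 <= t <= T -> Rabs (E t - c2) <= c2 / 4 -> eps ^ 2 * y t <= 1 ->
     Rabs (V t) <= M /\ Rabs (A t) <= A0 /\ Rabs (th t) <= 2 * M /\
     V t ^ 2 * (q t / eps) <= dth t + 2 * A0 /\ 0 <= V t ^ 2 * (q t / eps)).
  { intros t Ht HE Hy.
    destruct (Hder t Ht) as (_ & _ & _ & _ & _ & HU).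
    destruct (Hode t Ht) as (HA & _). fold (q t) in HA. fold (Y t) in HA.
    specialize (Hq t). destruct (Hyw t) as (W2 & W3 & W4 & WY & WY1).
    assert (HV : Rabs (V t) <= M).
    { apply Rabs_le_of_sqr_le; [lra|]. unfold E in HE. apply Rabs_le_between in HE.
      assert (Rabs (kap * U t ^ 2) <= Rabs kap * K ^ 2).
      { apply Rabs_mult_le; [lra|]. rewrite <- RPow_abs.
        apply pow_incr. split; [apply Rabs_pos|lra]. }
      apply Rabs_le_between in H. assert (V t ^ 2 <= M) by (unfold M; lra). nra. }
    assert (HeY : eps * Y t <= 4).
    { assert ((eps * Y t) ^ 2 <= 4 ^ 2) by (rewrite Rpow_mult_distr; nra).
      apply Rabs_le_of_sqr_le in H; [|lra]. apply Rabs_le_between in H. lra. }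
    assert (HAA : Rabs (A t) <= A0).
    { replace (A t) with ((A t + kap * U t) - kap * U t) by ring.
      eapply Rle_trans; [apply Rabs_triang|]. rewrite Rabs_Ropp.
      assert (Rabs (kap * U t) <= Rabs kap * K) by (apply Rabs_mult_le; lra).
      assert (C * (q t * (V t ^ 2 + eps * Rabs (V t) * Y t + eps ^ 2) + eps)
              <= C * (M ^ 2 + 4 * M + 2)).
      { apply Rmult_le_compat_l; [assumption|].
        pose proof (Rabs_pos (V t)).
        assert (V t ^ 2 <= M ^ 2) by (rewrite <- pow2_abs; apply pow_incr; lra).
        assert (eps * Rabs (V t) * Y t <= 4 * M).
        { replace (eps * Rabs (V t) * Y t) with ((eps * Y t) * Rabs (V t)) by ring.
          apply Rmult_le_compat; nra. }
        assert (0 <= eps * Rabs (V t) * Y t) by (repeat apply Rmult_le_pos; lra).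
        assert (eps ^ 2 <= 1) by nra.
        pose proof (pow2_ge_0 (V t)). pose proof (pow2_ge_0 eps).
        assert (q t * (V t ^ 2 + eps * Rabs (V t) * Y t + eps ^ 2) <= 1 * (M ^ 2 + 4 * M + 1)).
        { apply Rmult_le_compat; lra. }
        lra. }
      unfold A0. lra. }
    assert (HAa : Rabs (A t * atan (U t / eps)) <= A0 * 2).
    { apply Rabs_mult_le; [assumption|apply Rabs_atan_le]. }
    apply Rabs_le_between in HAa.
    assert (Rabs (th t) <= M * 2) by (apply Rabs_mult_le; [assumption|apply Rabs_atan_le]).
    assert (0 <= V t ^ 2 * (q t / eps)).
    { apply Rmult_le_pos; [apply pow2_ge_0|]. left. apply Rdiv_lt_0_compat; lra. }
    unfold dth. repeat split; try assumption; lra. }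
  assert (Hstep : forall s, 0 <= s <= T ->
     (forall t, 0 <= t <= s -> Rabs (E t - c2) <= c2 / 4 /\ eps ^ 2 * y t <= 1) ->
     y s <= By /\ Rabs (E s - E 0) <= eps * A2).
  { intros s Hs Hall.
    assert (Hys : forall r, 0 <= r <= s -> y r <= By).
    { intros r Hr.
      (* The factor 8 is 2 from differentiating squares times 4 from [Y ^ 2 <= 4 * y]. The summand
         [M] covers [q * |V|], and [2 * A0] covers the arctangent term of [dth]. As [|th| <= 2 * M],
         the increment of [Psi] does not see [eps]. *)
      set (Psi := fun t => 8 * C * ((1 + M + 2 * A0) * t + th t)).
      set (dPsi := fun t => 8 * C * ((1 + M + 2 * A0) + dth t)).
      assert (G : y r <= y 0 * exp (Psi r - Psi 0)).
      { apply gronwall with (dy := dy) (dPsi := dPsi); [lra| | |].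
        - intros; apply Dy; lra.
        - intros t Ht. unfold Psi, dPsi. apply is_derive_scal.
          apply (is_derive_plus (fun t => (1 + M + 2 * A0) * t) th).
          + apply is_derive_mult_const.
          + apply Dth; lra.
        - intros t Ht. destruct (Hall t) as [HE Hy]; [lra|].
          destruct (Hpt t) as (HV & HA & Hth & Hqv & Hqv0); [lra|assumption|assumption|].
          destruct (Hode t) as (_ & X2 & X3 & X4); [lra|].
          cbv zeta in X2, X3, X4. fold (q t) in X2, X3, X4. fold (Y t) in X2, X3, X4.
          destruct (Hyw t) as (_ & _ & _ & WY & WY1).
          specialize (Hq t).
          set (X := C * (1 + V t ^ 2 * (q t / eps) + q t * Rabs (V t) * Y t)) in *.
          assert (HX : X <= C * ((1 + (dth t + 2 * A0) + M) * Y t)).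
          { unfold X. apply Rmult_le_compat_l; [assumption|].
            assert (q t * Rabs (V t) <= 1 * M) by (apply Rmult_le_compat; try lra; apply Rabs_pos).
            assert (q t * Rabs (V t) * Y t <= M * Y t) by (apply Rmult_le_compat_r; lra).
            nra. }
          assert (HdY : dy t <= 2 * (Y t * X)).
          { unfold dy.
            assert (P : forall w aa, Rabs aa <= X -> 2 * w * aa <= 2 * Rabs w * X).
            { intros w aa Haa. replace (2 * w * aa) with (2 * (w * aa)) by ring.
              assert (Rabs (w * aa) <= Rabs w * X) by (apply Rabs_mult_le; lra).
              apply Rabs_le_between in H. lra. }
            pose proof (P (w2 t) _ X2). pose proof (P (w3 t) _ X3). pose proof (P (w4 t) _ X4).
            assert (0 <= X) by (eapply Rle_trans; [apply Rabs_pos|exact X2]).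
            replace (Y t * X) with (X + Rabs (w2 t) * X + Rabs (w3 t) * X + Rabs (w4 t) * X)
              by (unfold Y; ring). lra. }
          eapply Rle_trans; [exact HdY|].
          assert (Y t * X <= Y t * (C * ((1 + (dth t + 2 * A0) + M) * Y t)))
            by (apply Rmult_le_compat_l; lra).
          replace (Y t * (C * ((1 + (dth t + 2 * A0) + M) * Y t)))
            with (C * (1 + (dth t + 2 * A0) + M) * Y t ^ 2) in H by ring.
          assert (C * (1 + (dth t + 2 * A0) + M) * Y t ^ 2
                  <= C * (1 + (dth t + 2 * A0) + M) * (4 * y t)).
          { apply Rmult_le_compat_l; [apply Rmult_le_pos; lra|assumption]. }
          unfold dPsi. lra. }
      eapply Rle_trans; [exact G|]. unfold By.
      apply Rmult_le_compat; [unfold y; nra|left; apply exp_pos| |].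
      - unfold y. assert (forall w, Rabs w <= K -> w ^ 2 <= K ^ 2).
        { intros w Hw. rewrite <- pow2_abs. apply pow_incr. split; [apply Rabs_pos|assumption]. }
        pose proof (H _ H20). pose proof (H _ H30). pose proof (H _ H40). lra.
      - apply exp_le_compat. unfold Psi.
        destruct (Hall r Hr) as [X1 X2]. destruct (Hall 0) as [X3 X4]; [lra|].
        destruct (Hpt r) as (_ & _ & Hr1 & _); [lra|assumption|assumption|].
        destruct (Hpt 0) as (_ & _ & H01 & _); [lra|assumption|assumption|].
        apply Rabs_le_between in Hr1. apply Rabs_le_between in H01.
        assert ((1 + M + 2 * A0) * r <= (1 + M + 2 * A0) * T) by (apply Rmult_le_compat_l; lra).
        rewrite <- Rmult_minus_distr_l. apply Rmult_le_compat_l; lra. }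
    split; [apply Hys; lra|].
    (* [F] dominates the variation of [E]: writing [q * V ^ 2 = eps * (V ^ 2 * (q / eps))] gives the
       bound on [A + kap * U] a common factor [eps], and what remains has the bounded primitive [th]
       plus a linear term. Here [y <= By], just proved, replaces the crude bound on [Y]. *)
    set (F := fun t => eps * (2 * M * C) * (th t + (2 * A0 + 4 * M * By + 2) * t)).
    set (dF := fun t => eps * (2 * M * C) * (dth t + (2 * A0 + 4 * M * By + 2))).
    assert (DF : forall t, 0 <= t <= s -> is_derive F t (dF t)).
    { intros t Ht. unfold F, dF. apply is_derive_scal.
      apply (is_derive_plus th (fun t => (2 * A0 + 4 * M * By + 2) * t)).
      - apply Dth; lra.
      - apply is_derive_mult_const. }
    assert (HdE : forall t, 0 <= t <= s -> Rabs (dE t) <= dF t).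
    { intros t Ht. destruct (Hall t) as [HE Hy]; [lra|].
      destruct (Hpt t) as (HV & HA & Hth & Hqv & Hqv0); [lra|assumption|assumption|].
      destruct (Hode t) as (X1 & _); [lra|]. cbv zeta in X1. fold (q t) in X1. fold (Y t) in X1.
      destruct (Hyw t) as (_ & _ & _ & WY & WY1). specialize (Hq t). specialize (Hys t Ht).
      assert (HY : Y t <= 4 * By) by nra.
      unfold dE, dF. rewrite Rabs_mult.
      assert (Rabs (2 * V t) <= 2 * M) by (rewrite Rabs_mult, Rabs_right; lra).
      replace (eps * (2 * M * C) * (dth t + (2 * A0 + 4 * M * By + 2)))
        with (2 * M * (C * (eps * (dth t + (2 * A0 + 4 * M * By + 2))))) by ring.
      apply Rmult_le_compat; try apply Rabs_pos; [assumption|].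
      eapply Rle_trans; [exact X1|]. apply Rmult_le_compat_l; [assumption|].
      assert (Z1 : q t * V t ^ 2 = eps * (V t ^ 2 * (q t / eps))) by (field; lra).
      assert (Z2 : q t * (Rabs (V t) * Y t) <= 1 * (M * (4 * By))).
      { apply Rmult_le_compat; try lra.
        - apply Rmult_le_pos; [apply Rabs_pos|lra].
        - apply Rmult_le_compat; try lra. apply Rabs_pos. }
      assert (Z3 : q t * eps ^ 2 <= eps * 1).
      { replace (q t * eps ^ 2) with (eps * (q t * eps)) by ring.
        apply Rmult_le_compat_l; [lra|]. nra. }
      replace (q t * (V t ^ 2 + eps * Rabs (V t) * Y t + eps ^ 2) + eps)
        with (q t * V t ^ 2 + eps * (q t * (Rabs (V t) * Y t)) + q t * eps ^ 2 + eps) by ring.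
      rewrite Z1.
      assert (eps * (V t ^ 2 * (q t / eps)) <= eps * (dth t + 2 * A0))
        by (apply Rmult_le_compat_l; lra).
      assert (eps * (q t * (Rabs (V t) * Y t)) <= eps * (1 * (M * (4 * By))))
        by (apply Rmult_le_compat_l; lra).
      lra. }
    assert (HF : F s - F 0 <= eps * A2).
    { unfold F, A2.
      destruct (Hall s) as [X1 X2]; [lra|]. destruct (Hall 0) as [X3 X4]; [lra|].
      destruct (Hpt s) as (_ & _ & Hr1 & _); [lra|assumption|assumption|].
      destruct (Hpt 0) as (_ & _ & H01 & _); [lra|assumption|assumption|].
      apply Rabs_le_between in Hr1. apply Rabs_le_between in H01.
      assert ((2 * A0 + 4 * M * By + 2) * s <= (2 * A0 + 4 * M * By + 2) * T)
        by (apply Rmult_le_compat_l; nra).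
      rewrite <- Rmult_minus_distr_l, !Rmult_assoc. apply Rmult_le_compat_l; [lra|].
      apply Rmult_le_compat_l; [lra|]. apply Rmult_le_compat_l; [lra|].
      apply Rmult_le_compat_l; lra. }
    assert (E s - E 0 <= F s - F 0).
    { apply (is_derive_le_increment E F dE dF); [lra| |assumption|].
      - intros; apply DE; lra.
      - intros t Ht. pose proof (HdE t Ht) as HH. apply Rabs_le_between in HH. lra. }
    assert (- E s - - E 0 <= F s - F 0).
    { apply (is_derive_le_increment (fun t => - E t) F (fun t => - dE t) dF); [lra| |assumption|].
      - intros; apply (is_derive_opp E); apply DE; lra.
      - intros t Ht. pose proof (HdE t Ht) as HH. apply Rabs_le_between in HH. lra. }
    apply Rabs_le. lra. }
  assert (Hy0 : forall s, y s <= By -> eps ^ 2 * y s < 1).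
  { intros s Hs.
    assert (1 <= y s) by (unfold y; pose proof (pow2_ge_0 (w2 s)); pose proof (pow2_ge_0 (w3 s));
                          pose proof (pow2_ge_0 (w4 s)); lra).
    assert (eps * (By + 1) < 1).
    { apply Rmult_lt_compat_r with (r := By + 1) in Hle2; [|lra].
      rewrite Rinv_l in Hle2; lra. }
    assert (eps ^ 2 * y s <= eps * (By + 1)).
    { replace (eps ^ 2 * y s) with (eps * (eps * y s)) by ring.
      apply Rmult_le_compat_l; nra. }
    lra. }
  assert (HEs : forall s, Rabs (E s - E 0) <= eps * A2 -> Rabs (E s - c2) < c2 / 4).
  { intros s Hs.
    assert (eps * A2 <= c2 / 16).
    { apply Rmult_lt_compat_r with (r := 16 * (A2 + 1)) in Hle3; [|lra].
      replace (c2 / (16 * (A2 + 1)) * (16 * (A2 + 1))) with c2 in Hle3 by (field; lra). nra. }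
    replace (E s - c2) with ((E s - E 0) + (E 0 - c2)) by ring.
    eapply Rle_lt_trans; [apply Rabs_triang|]. fold (E 0) in HE0. lra. }
  assert (Hboot : forall t, 0 <= t <= T -> 4 / c2 * Rabs (E t - c2) < 1 /\ eps ^ 2 * y t < 1).
  { assert (Hsc : forall z, 4 / c2 * z <= 1 -> z <= c2 / 4).
    { intros z Hz. replace z with (c2 / 4 * (4 / c2 * z)) by (field; lra). nra. }
    assert (Hsc' : forall z, z < c2 / 4 -> 4 / c2 * z < 1).
    { intros z Hz. replace 1 with (4 / c2 * (c2 / 4)) by (field; lra).
      apply Rmult_lt_compat_l; [apply Rdiv_lt_0_compat; lra|assumption]. }
    apply (bootstrap (fun t => 4 / c2 * Rabs (E t - c2)) (fun t => eps ^ 2 * y t) T HT).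
    - intros t Ht. apply (continuous_scal_r (4 / c2) (fun t => Rabs (E t - c2))).
      apply (continuous_comp (fun t => E t - c2) Rabs).
      + apply (continuous_minus E (fun _ => c2)); [|apply continuous_const].
        apply ex_derive_continuous. exists (dE t). apply DE, Ht.
      + apply continuous_Rabs.
    - intros t Ht. apply (continuous_scal_r (eps ^ 2) y).
      apply (ex_derive_continuous y). exists (dy t). apply Dy, Ht.
    - left. apply Hsc'. fold (E 0) in HE0. lra.
    - left. apply Hy0. unfold By. pose proof (exp_pos 0).
      replace (y 0) with (y 0 * exp 0) by (rewrite exp_0; ring).
      apply Rmult_le_compat; [unfold y; nra|lra| |].
      + unfold y. assert (forall w, Rabs w <= K -> w ^ 2 <= K ^ 2).
        { intros w Hw. rewrite <- pow2_abs. apply pow_incr. split; [apply Rabs_pos|assumption]. }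
        pose proof (H0 _ H20). pose proof (H0 _ H30). pose proof (H0 _ H40). lra.
      + apply exp_le_compat. apply Rmult_le_pos; [lra|].
        assert (0 <= (1 + M + 2 * A0) * T) by (apply Rmult_le_pos; lra). lra.
    - intros s Hs Hall. destruct (Hstep s Hs) as [P1 P2].
      + intros t Ht. destruct (Hall t Ht) as [Q1 Q2]. split; [apply Hsc|]; assumption.
      + split; [apply Hsc', HEs|apply Hy0]; assumption. }
  assert (Hboot' : forall t, 0 <= t <= T -> Rabs (E t - c2) <= c2 / 4 /\ eps ^ 2 * y t <= 1).
  { intros t Ht. destruct (Hboot t Ht) as [P1 P2]. split; [|lra].
    replace (Rabs (E t - c2)) with (c2 / 4 * (4 / c2 * Rabs (E t - c2))) by (field; lra). nra. }
  intros t Ht. destruct (Hboot' t Ht) as [P1 P2].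
  destruct (Hpt t Ht P1 P2) as (HV & HA & _).
  destruct (Hstep t Ht) as [HY _]; [intros; apply Hboot'; lra|].
  destruct (Hyw t) as (W2 & W3 & W4 & _).
  repeat split; try lra. exact P1.
Qed.

(** * Time integral of the inverse distance to the wave *)

(** With [s = sqrt (x ^ 2 + 1)], the numbers [x + s] and [s - x] are reciprocal and both at most
    [1 + 2 * |x|]; the first handles the upper bound and the second the lower one. *)
Lemma Rabs_arcsinh_le (x : R) : Rabs (arcsinh x) <= ln (1 + 2 * Rabs x).
Proof.
  unfold arcsinh. set (s := sqrt (x ^ 2 + 1)).
  pose proof (Rabs_pos x) as Hx.
  assert (Hs2 : s * s = x ^ 2 + 1) by (apply sqrt_sqrt; nra).
  assert (Hs0 : 0 <= s) by apply sqrt_pos.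
  assert (Hs1 : Rabs x < s).
  { apply Rsqr_incrst_0; try assumption. rewrite <- Rsqr_abs. unfold Rsqr. nra. }
  assert (Hs3 : s <= 1 + Rabs x).
  { apply Rsqr_incr_0_var; [|lra]. unfold Rsqr. rewrite Hs2, <- (pow2_abs x). nra. }
  apply Rabs_def2 in Hs1.
  pose proof (RRle_abs x). pose proof (RRle_abs (- x)) as Hn. rewrite Rabs_Ropp in Hn.
  assert (Hpos : 0 < x + s) by lra.
  apply Rabs_le. split.
  - rewrite <- ln_Rinv by lra. apply ln_le; [apply Rinv_0_lt_compat; lra|].
    apply Rmult_le_reg_r with (1 + 2 * Rabs x); [lra|]. rewrite Rinv_l by lra.
    apply Rle_trans with ((x + s) * (s - x)); [right; nra|].
    apply Rmult_le_compat_l; lra.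
  - apply ln_le; lra.
Qed.

Lemma sqrt_sqr_plus_sqr_pos (eps u : R) : 0 < eps -> 0 < sqrt (eps ^ 2 + u ^ 2).
Proof.
  intros. apply sqrt_lt_R0. pose proof (pow2_ge_0 u). assert (0 < eps ^ 2) by (apply pow2_gt_0; lra). lra.
Qed.

Lemma ln_inv_nonneg (eps : R) : 0 < eps < 1 -> 0 <= ln (/ eps).
Proof.
  intros. rewrite <- ln_1. apply ln_le; [lra|]. rewrite <- Rinv_1.
  apply Rinv_le_contravar; lra.
Qed.

Lemma is_derive_arcsinh_scaled (eps : R) (U : R -> R) (V t : R) :
  0 < eps -> is_derive U t V ->
  is_derive (fun s => arcsinh (U s / eps)) t (V * / sqrt (eps ^ 2 + U t ^ 2)).
Proof.
  intros He HU.
  replace (V * / sqrt (eps ^ 2 + U t ^ 2)) with (V / eps * / sqrt ((U t / eps) ^ 2 + 1)).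
  - apply (is_derive_comp arcsinh (fun s => U s / eps) t (/ sqrt ((U t / eps) ^ 2 + 1)) (V / eps)).
    + apply is_derive_Reals. apply derivable_pt_lim_arcsinh.
    + apply is_derive_ext with (f := fun s => / eps * U s); [intro; apply Rmult_comm|].
      unfold Rdiv. rewrite Rmult_comm. apply is_derive_scal. exact HU.
  - replace (eps ^ 2 + U t ^ 2) with (eps ^ 2 * ((U t / eps) ^ 2 + 1)) by (field; lra).
    assert (0 < (U t / eps) ^ 2 + 1) by (pose proof (pow2_ge_0 (U t / eps)); lra).
    rewrite sqrt_mult by (try apply pow2_ge_0; lra).
    replace (eps ^ 2) with (Rsqr eps) by (unfold Rsqr; ring). rewrite sqrt_Rsqr by lra.
    field. split; [|lra]. apply Rgt_not_eq, sqrt_lt_R0. lra.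
Qed.

(* [V * arcsinh (U / eps)] has derivative [V ^ 2 / sqrt (eps ^ 2 + U ^ 2)] up to
   [O(ln (1 / eps))], and [V] is bounded away from [0] where [U] is small. *)
Lemma inv_distance_primitive (kap c2 K B T : R) :
  0 < c2 -> 0 <= K -> 0 <= B -> 0 <= T ->
  exists C, 0 <= C /\ forall eps, 0 < eps < 1 -> forall U V A : R -> R,
  (forall t, 0 <= t <= T ->
     is_derive U t (V t) /\ is_derive V t (A t) /\ Rabs (U t) <= K /\
     Rabs (V t) <= B /\ Rabs (A t) <= B /\ c2 / 2 <= V t ^ 2 + kap * U t ^ 2) ->
  exists Lam dLam : R -> R, forall t, 0 <= t <= T ->
    is_derive Lam t (dLam t) /\ / sqrt (eps ^ 2 + U t ^ 2) <= dLam t /\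
    Rabs (Lam t) <= C * (1 + ln (/ eps)).
Proof.
  intros Hc2 HK HB HT.
  assert (Hl : 0 <= ln (1 + 2 * K)) by (rewrite <- ln_1; apply ln_le; lra).
  set (C5 := 1 + ln (1 + 2 * K)).
  set (k := Rabs kap). assert (Hk : 0 <= k) by apply Rabs_pos.
  assert (HBC : 0 <= B * C5) by (apply Rmult_le_pos; unfold C5; lra).
  assert (HkK : 0 <= k * K) by (apply Rmult_le_pos; lra).
  set (C := 2 / c2 * (B * C5 + (B * C5 + k * K) * T)).
  assert (H2c : 0 < 2 / c2) by (apply Rdiv_lt_0_compat; lra).
  exists C. split.
  { unfold C. apply Rmult_le_pos; [lra|].
    assert (0 <= (B * C5 + k * K) * T) by (apply Rmult_le_pos; lra). lra. }
  intros eps He U V A H.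
  pose proof (ln_inv_nonneg eps He) as Hln. set (l := 1 + ln (/ eps)).
  assert (Hl1 : 1 <= l) by (unfold l; lra).
  set (as_ := fun t => arcsinh (U t / eps)).
  (* The linear term pays for two losses: [A * arcsinh (U / eps)], at most [B * C5 * l], and the
     term [kap * U ^ 2 / mu] by which [V ^ 2 / mu] may miss [(c2 / 2) / mu], at most [k * K] because
     [U ^ 2 / mu <= |U|]. The factor [2 / c2] normalises the remaining [(c2 / 2) / mu]. *)
  exists (fun t => 2 / c2 * (V t * as_ t + (B * C5 * l + k * K) * t)).
  exists (fun t => 2 / c2 * (A t * as_ t + V t * (V t * / sqrt (eps ^ 2 + U t ^ 2)) + (B * C5 * l + k * K))).
  intros t Ht. destruct (H t Ht) as (DU & DV & HU & HV & HA & HE).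
  assert (Has : Rabs (as_ t) <= C5 * l).
  { unfold as_. eapply Rle_trans; [apply Rabs_arcsinh_le|].
    apply Rle_trans with (ln ((1 + 2 * K) * / eps)).
    - apply ln_le.
      + pose proof (Rabs_pos (U t / eps)). lra.
      + unfold Rdiv. rewrite Rabs_mult, (Rabs_right (/ eps)) by (left; apply Rinv_0_lt_compat; lra).
        rewrite Rmult_plus_distr_r.
        assert (1 <= / eps) by (rewrite <- Rinv_1; apply Rinv_le_contravar; lra).
        assert (Rabs (U t) * / eps <= K * / eps) by (apply Rmult_le_compat_r; lra). lra.
    - rewrite ln_mult by (try apply Rinv_0_lt_compat; lra). unfold C5, l. nra. }
  assert (Hmu := sqrt_sqr_plus_sqr_pos eps (U t) (proj1 He)).
  set (mu := sqrt (eps ^ 2 + U t ^ 2)) in *.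
  split; [|split].
  - apply is_derive_scal.
    apply (is_derive_plus (fun t => V t * as_ t) (fun t => (B * C5 * l + k * K) * t)).
    + apply (is_derive_mult V as_ t (A t) (V t * / mu)); [exact DV| |intros; apply Rmult_comm].
      apply is_derive_arcsinh_scaled; [lra|exact DU].
    + apply is_derive_mult_const.
  - assert (P1 : Rabs (A t * as_ t) <= B * (C5 * l)) by (apply Rabs_mult_le; assumption).
    apply Rabs_le_between in P1.
    assert (Hmu2 : U t ^ 2 * / mu <= K).
    { assert (Rabs (U t) <= mu).
      { unfold mu. rewrite <- sqrt_Rsqr_abs. apply sqrt_le_1_alt. unfold Rsqr.
        pose proof (pow2_ge_0 eps). lra. }
      apply Rmult_le_reg_r with mu; [assumption|]. rewrite Rmult_assoc, Rinv_l by lra.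
      rewrite <- pow2_abs. pose proof (Rabs_pos (U t)).
      apply Rle_trans with (Rabs (U t) * mu); [nra|]. apply Rmult_le_compat_r; lra. }
    assert (Hi : 0 < / mu) by (apply Rinv_0_lt_compat; assumption).
    assert (P2 : kap * U t ^ 2 <= k * U t ^ 2).
    { apply Rmult_le_compat_r; [apply pow2_ge_0|]. apply RRle_abs. }
    assert (P3 : k * (U t ^ 2 * / mu) <= k * K) by (apply Rmult_le_compat_l; lra).
    assert (P4 : c2 / 2 * / mu <= (V t ^ 2 + k * U t ^ 2) * / mu) by (apply Rmult_le_compat_r; lra).
    replace (/ mu) with (2 / c2 * (c2 / 2 * / mu)) at 1 by (field; lra).
    apply Rmult_le_compat_l; lra.
  - rewrite Rabs_mult, (Rabs_right (2 / c2)) by lra.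
    unfold C. rewrite (Rmult_assoc (2 / c2)). apply Rmult_le_compat_l; [lra|].
    eapply Rle_trans; [apply Rabs_triang|].
    assert (P1 : Rabs (V t * as_ t) <= B * (C5 * l)) by (apply Rabs_mult_le; assumption).
    assert (P2 : Rabs ((B * C5 * l + k * K) * t) <= ((B * C5 + k * K) * l) * T).
    { assert (0 <= B * C5 * l) by (apply Rmult_le_pos; lra).
      apply Rabs_mult_le; [|rewrite Rabs_right; lra].
      rewrite Rabs_right by lra. nra. }
    fold l. lra.
Qed.

(** * Smooth functions of three variables *)

Definition vec3 (a b c : R) : nat -> R :=
  fun j => match j with 0%nat => a | 1%nat => b | 2%nat => c | _ => 0 end.

(** For the empty list and the one-element lists this is convertible to [H], [dH2 H], [dH3 H] and
    [dH4 H], so results on all iterated partials apply to these four without rewriting. *)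
Definition iter3 (l : list nat) (H : R -> R -> R -> R) (a b c : R) : R :=
  iter_partial l (fun x => H (x 0%nat) (x 1%nat) (x 2%nat)) (vec3 a b c).

Definition box_bounded (f : R -> R -> R -> R) : Prop :=
  forall K, exists C, 0 <= C /\ forall a b c,
    Rabs a <= K -> Rabs b <= K -> Rabs c <= K -> Rabs (f a b c) <= C.

Definition box_lipschitz (f : R -> R -> R -> R) : Prop :=
  forall K, exists C, 0 <= C /\ forall a b c a' b' c',
    Rabs a <= K -> Rabs b <= K -> Rabs c <= K ->
    Rabs a' <= K -> Rabs b' <= K -> Rabs c' <= K ->
    Rabs (f a b c - f a' b' c') <= C * (Rabs (a - a') + Rabs (b - b') + Rabs (c - c')).

Definition has_partials (f f2 f3 f4 : R -> R -> R -> R) : Prop :=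
  forall a b c,
    is_derive (fun s => f s b c) a (f2 a b c) /\
    is_derive (fun s => f a s c) b (f3 a b c) /\
    is_derive (fun s => f a b s) c (f4 a b c).

Lemma iter3_has_partials (H : R -> R -> R -> R) (l : list nat) :
  smooth3 H -> List.Forall (fun i => (i < 3)%nat) l ->
  has_partials (iter3 l H) (iter3 (0%nat :: l) H) (iter3 (1%nat :: l) H) (iter3 (2%nat :: l) H).
Proof.
  intros HH Hl a b c.
  destruct (HH l Hl (vec3 a b c) I) as [_ Hd].
  set (F := fun x : nat -> R => H (x 0%nat) (x 1%nat) (x 2%nat)) in *.
  assert (U0 : forall s, upd (vec3 a b c) 0 s = vec3 s b c).
  { intro s. apply functional_extensionality. intros [|[|[|j]]]; reflexivity. }
  assert (U1 : forall s, upd (vec3 a b c) 1 s = vec3 a s c).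
  { intro s. apply functional_extensionality. intros [|[|[|j]]]; reflexivity. }
  assert (U2 : forall s, upd (vec3 a b c) 2 s = vec3 a b s).
  { intro s. apply functional_extensionality. intros [|[|[|j]]]; reflexivity. }
  split; [|split].
  - apply is_derive_ext with (f := fun s => iter_partial l F (upd (vec3 a b c) 0 s));
      [intro; unfold iter3; now rewrite U0|].
    apply Derive_correct, Hd. lia.
  - apply is_derive_ext with (f := fun s => iter_partial l F (upd (vec3 a b c) 1 s));
      [intro; unfold iter3; now rewrite U1|].
    apply Derive_correct, Hd. lia.
  - apply is_derive_ext with (f := fun s => iter_partial l F (upd (vec3 a b c) 2 s));
      [intro; unfold iter3; now rewrite U2|].
    apply Derive_correct, Hd. lia.
Qed.

(** Compactness of the cube: joint continuity gives each point a radius within which the function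
    varies by less than 1, and finitely many such neighbourhoods cover the cube. *)
Lemma iter3_box_bounded (H : R -> R -> R -> R) (l : list nat) :
  smooth3 H -> List.Forall (fun i => (i < 3)%nat) l -> box_bounded (iter3 l H).
Proof.
  intros HH Hl K.
  assert (Hc : forall x : Compactness.Tn 3 R, exists d : posreal, forall a b c,
             Rabs (a - fst x) < d -> Rabs (b - fst (snd x)) < d -> Rabs (c - fst (snd (snd x))) < d ->
             Rabs (iter3 l H a b c - iter3 l H (fst x) (fst (snd x)) (fst (snd (snd x)))) < 1).
  { intros (a0 & b0 & c0 & u). cbn [fst snd].
    destruct (HH l Hl (vec3 a0 b0 c0) I) as [Hc _].
    destruct (Hc 1 Rlt_0_1) as [d [Hd Hc']].
    exists (mkposreal d Hd). intros a b c Ha Hb Hc''. apply (Hc' (vec3 a b c)).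
    - intros [|[|[|i]]] Hi; try assumption. lia.
    - intros [|[|[|i]]] Hi; try lia. reflexivity. }
  set (delta := fun x => proj1_sig (constructive_indefinite_description _ (Hc x))).
  assert (Hdelta := fun x => proj2_sig (constructive_indefinite_description _ (Hc x))).
  (* The finite cover is available only in doubly negated form, hence the detour through a
     contradiction. *)
  apply NNPP. intro Hn.
  apply (compactness_list 3 (- K, (- K, (- K, tt))) (K, (K, (K, tt))) delta).
  intros [lst Hlst]. apply Hn.
  set (val := fun x : Compactness.Tn 3 R => Rabs (iter3 l H (fst x) (fst (snd x)) (fst (snd (snd x))))).
  assert (Hmax : exists C, 0 <= C /\ forall x, In x lst -> val x <= C).
  { clear. induction lst as [|x lst [C [HC IH]]].
    - exists 0. split; [lra|]. intros x [].
    - exists (Rmax C (val x)). split; [eapply Rle_trans; [exact HC|apply Rmax_l]|].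
      intros y [->|Hy]; [apply Rmax_r|]. eapply Rle_trans; [apply IH, Hy|apply Rmax_l]. }
  destruct Hmax as [C [HC Hmax]].
  exists (C + 1). split; [lra|]. intros a b c Ha Hb Hc0.
  apply Rabs_le_between in Ha. apply Rabs_le_between in Hb. apply Rabs_le_between in Hc0.
  destruct (Hlst (a, (b, (c, tt)))) as (x & Hin & _ & Hcl).
  { cbn. repeat split; lra. }
  specialize (Hdelta x a b c). specialize (Hmax x Hin). unfold val in Hmax.
  fold (delta x) in Hdelta.
  destruct x as (a0 & b0 & c0 & u). cbn in Hcl, Hmax, Hdelta.
  destruct Hcl as (H1 & H2 & H3 & _). specialize (Hdelta H1 H2 H3).
  replace (iter3 l H a b c) with ((iter3 l H a b c - iter3 l H a0 b0 c0) + iter3 l H a0 b0 c0) by ring.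
  eapply Rle_trans; [apply Rabs_triang|]. lra.
Qed.

Lemma lipschitz_of_derive_bound (f df : R -> R) (K C x y : R) :
  (forall s, Rabs s <= K -> is_derive f s (df s)) ->
  (forall s, Rabs s <= K -> Rabs (df s) <= C) ->
  Rabs x <= K -> Rabs y <= K -> Rabs (f x - f y) <= C * Rabs (x - y).
Proof.
  intros Hd Hb Hx Hy.
  assert (Hin : forall s, Rmin y x <= s <= Rmax y x -> Rabs s <= K).
  { intros s [H1 H2]. apply Rabs_le_between in Hx. apply Rabs_le_between in Hy.
    apply Rabs_le. split.
    - eapply Rle_trans; [|exact H1]. apply Rmin_glb; lra.
    - eapply Rle_trans; [exact H2|]. apply Rmax_lub; lra. }
  destruct (MVT_gen f y x df) as [c [Hc E]].
  - intros s Hs. apply Hd, Hin. lra.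
  - intros s Hs. apply derivable_continuous_pt. exists (df s). apply is_derive_Reals, Hd, Hin. lra.
  - rewrite E, Rabs_mult. apply Rmult_le_compat_r; [apply Rabs_pos|]. apply Hb, Hin, Hc.
Qed.

(** One coordinate is moved at a time; a cube contains all intermediate points. *)
Lemma box_lipschitz_of_partials (f f2 f3 f4 : R -> R -> R -> R) :
  has_partials f f2 f3 f4 -> box_bounded f2 -> box_bounded f3 -> box_bounded f4 ->
  box_lipschitz f.
Proof.
  intros Hp B2 B3 B4 K.
  destruct (B2 K) as [C2 [P2 Q2]]. destruct (B3 K) as [C3 [P3 Q3]]. destruct (B4 K) as [C4 [P4 Q4]].
  exists (C2 + C3 + C4). split; [lra|]. intros a b c a' b' c' Ha Hb Hc Ha' Hb' Hc'.
  assert (L2 : Rabs (f a b c - f a' b c) <= C2 * Rabs (a - a')).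
  { apply (lipschitz_of_derive_bound (fun s => f s b c) (fun s => f2 s b c) K); try assumption.
    - intros; apply Hp.
    - intros; apply Q2; assumption. }
  assert (L3 : Rabs (f a' b c - f a' b' c) <= C3 * Rabs (b - b')).
  { apply (lipschitz_of_derive_bound (fun s => f a' s c) (fun s => f3 a' s c) K); try assumption.
    - intros; apply Hp.
    - intros; apply Q3; assumption. }
  assert (L4 : Rabs (f a' b' c - f a' b' c') <= C4 * Rabs (c - c')).
  { apply (lipschitz_of_derive_bound (fun s => f a' b' s) (fun s => f4 a' b' s) K); try assumption.
    - intros; apply Hp.
    - intros; apply Q4; assumption. }
  replace (f a b c - f a' b' c') with
    ((f a b c - f a' b c) + (f a' b c - f a' b' c) + (f a' b' c - f a' b' c')) by ring.
  pose proof (Rabs_pos (a - a')). pose proof (Rabs_pos (b - b')). pose proof (Rabs_pos (c - c')).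
  eapply Rle_trans; [apply Rabs_triang|].
  eapply Rle_trans; [apply Rplus_le_compat_r, Rabs_triang|]. nra.
Qed.

Lemma iter3_box_lipschitz (H : R -> R -> R -> R) (l : list nat) :
  smooth3 H -> List.Forall (fun i => (i < 3)%nat) l -> box_lipschitz (iter3 l H).
Proof.
  intros HH Hl. eapply box_lipschitz_of_partials; [apply iter3_has_partials; assumption|..];
    apply iter3_box_bounded; try assumption; constructor; try assumption; lia.
Qed.

(** On each of three axis-parallel segments the mean value theorem yields a partial derivative at an
    intermediate point. Its Lipschitz bound allows moving it to the base point at a cost
    proportional to the total displacement, and the increment supplies the second such factor. *)
Lemma taylor1_box (f f2 f3 f4 : R -> R -> R -> R) :
  has_partials f f2 f3 f4 -> box_lipschitz f2 -> box_lipschitz f3 -> box_lipschitz f4 ->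
  forall K, exists C, 0 <= C /\ forall a b c a' b' c',
    Rabs a <= K -> Rabs b <= K -> Rabs c <= K ->
    Rabs a' <= K -> Rabs b' <= K -> Rabs c' <= K ->
    Rabs (f a b c - f a' b' c' - (f2 a' b' c' * (a - a') + f3 a' b' c' * (b - b') + f4 a' b' c' * (c - c')))
    <= C * (Rabs (a - a') + Rabs (b - b') + Rabs (c - c')) ^ 2.
Proof.
  intros Hp L2 L3 L4 K.
  destruct (L2 K) as [C2 [P2 Q2]]. destruct (L3 K) as [C3 [P3 Q3]]. destruct (L4 K) as [C4 [P4 Q4]].
  exists (C2 + C3 + C4). split; [lra|]. intros a b c a' b' c' Ha Hb Hc Ha' Hb' Hc'.
  assert (Seg : forall (g dg : R -> R) x x' m B,
     (forall s, is_derive g s (dg s)) -> Rabs x <= K -> Rabs x' <= K ->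
     (forall s, Rabs s <= K -> Rabs (s - x') <= Rabs (x - x') -> Rabs (dg s - m) <= B) ->
     Rabs (g x - g x' - m * (x - x')) <= B * Rabs (x - x')).
  { clear. intros g dg x x' m B Hd Hx Hx' HB.
    destruct (MVT_gen g x' x dg) as [s [Hs E]].
    - intros; apply Hd.
    - intros u _. apply derivable_continuous_pt. exists (dg u). apply is_derive_Reals, Hd.
    - rewrite E. replace (dg s * (x - x') - m * (x - x')) with ((dg s - m) * (x - x')) by ring.
      rewrite Rabs_mult. apply Rmult_le_compat_r; [apply Rabs_pos|].
      apply Rabs_le_between in Hx. apply Rabs_le_between in Hx'.
      apply HB; revert Hs; unfold Rmin, Rmax, Rabs; repeat destruct Rle_dec; repeat destruct Rcase_abs; lra. }
  set (S := Rabs (a - a') + Rabs (b - b') + Rabs (c - c')).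
  pose proof (Rabs_pos (a - a')). pose proof (Rabs_pos (b - b')). pose proof (Rabs_pos (c - c')).
  assert (E2 : Rabs (f a b c - f a' b c - f2 a' b' c' * (a - a')) <= C2 * S * Rabs (a - a')).
  { apply (Seg (fun s => f s b c) (fun s => f2 s b c)); try assumption; [intro; apply Hp|].
    intros s Hs Hs'. eapply Rle_trans; [apply Q2; assumption|].
    apply Rmult_le_compat_l; [assumption|]. unfold S. lra. }
  assert (E3 : Rabs (f a' b c - f a' b' c - f3 a' b' c' * (b - b')) <= C3 * S * Rabs (b - b')).
  { apply (Seg (fun s => f a' s c) (fun s => f3 a' s c)); try assumption; [intro; apply Hp|].
    intros s Hs Hs'. eapply Rle_trans; [apply Q3; assumption|].
    apply Rmult_le_compat_l; [assumption|]. unfold S. rewrite Rminus_diag, Rabs_R0. lra. }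
  assert (E4 : Rabs (f a' b' c - f a' b' c' - f4 a' b' c' * (c - c')) <= C4 * S * Rabs (c - c')).
  { apply (Seg (fun s => f a' b' s) (fun s => f4 a' b' s)); try assumption; [intro; apply Hp|].
    intros s Hs Hs'. eapply Rle_trans; [apply Q4; assumption|].
    apply Rmult_le_compat_l; [assumption|]. unfold S. rewrite !Rminus_diag, Rabs_R0. lra. }
  assert (HS : 0 <= S) by (unfold S; lra).
  assert (M2 : C2 * S * Rabs (a - a') <= C2 * S * S).
  { apply Rmult_le_compat_l; [apply Rmult_le_pos; lra|unfold S; lra]. }
  assert (M3 : C3 * S * Rabs (b - b') <= C3 * S * S).
  { apply Rmult_le_compat_l; [apply Rmult_le_pos; lra|unfold S; lra]. }
  assert (M4 : C4 * S * Rabs (c - c') <= C4 * S * S).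
  { apply Rmult_le_compat_l; [apply Rmult_le_pos; lra|unfold S; lra]. }
  apply Rabs_le_between in E2. apply Rabs_le_between in E3. apply Rabs_le_between in E4.
  apply Rabs_le. lra.
Qed.

Lemma is_derive_local_lipschitz (z : R -> R) (t w : R) :
  is_derive z t w -> exists d, 0 < d /\ forall h, Rabs h < d ->
    Rabs (z (t + h) - z t) <= (Rabs w + 1) * Rabs h.
Proof.
  intros Hz. apply is_derive_Reals in Hz. destruct (Hz 1 Rlt_0_1) as [d Hd].
  exists d. split; [apply cond_pos|]. intros h Hh.
  destruct (Req_dec h 0) as [->|Hne].
  - rewrite Rplus_0_r, Rminus_diag, Rabs_R0. lra.
  - specialize (Hd h Hne Hh).
    replace (z (t + h) - z t) with (((z (t + h) - z t) / h - w) * h + w * h) by (field; assumption).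
    eapply Rle_trans; [apply Rabs_triang|]. rewrite !Rabs_mult.
    pose proof (Rabs_pos h). nra.
Qed.

(** Chain rule, needed for [d/dt H(Z)]. The composite is its linearisation along the curve plus a
    remainder [rem]; differentiable curves are locally Lipschitz at [t], so the Taylor bound makes
    [rem] of order [h ^ 2] and its derivative 0. *)
Lemma is_derive_comp3 (f f2 f3 f4 : R -> R -> R -> R) (x y z : R -> R) (t x' y' z' : R) :
  has_partials f f2 f3 f4 -> box_lipschitz f2 -> box_lipschitz f3 -> box_lipschitz f4 ->
  is_derive x t x' -> is_derive y t y' -> is_derive z t z' ->
  is_derive (fun s => f (x s) (y s) (z s)) t
    (f2 (x t) (y t) (z t) * x' + f3 (x t) (y t) (z t) * y' + f4 (x t) (y t) (z t) * z').
Proof.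
  intros Hp L2 L3 L4 Hx Hy Hz.
  set (m2 := f2 (x t) (y t) (z t)). set (m3 := f3 (x t) (y t) (z t)). set (m4 := f4 (x t) (y t) (z t)).
  set (lin := fun s => m2 * (x s - x t) + m3 * (y s - y t) + m4 * (z s - z t)).
  set (rem := fun s => f (x s) (y s) (z s) - f (x t) (y t) (z t) - lin s).
  assert (Hlin : is_derive lin t (m2 * x' + m3 * y' + m4 * z')).
  { assert (Hm : forall m (u : R -> R) u', is_derive u t u' -> is_derive (fun s => m * (u s - u t)) t (m * u')).
    { intros m u u' Hu. apply is_derive_scal.
      replace u' with (u' - 0) by ring.
      apply (is_derive_minus u (fun _ => u t) t u' 0 Hu). apply @is_derive_const. }
    apply (is_derive_plus (fun s => m2 * (x s - x t) + m3 * (y s - y t)) (fun s => m4 * (z s - z t))).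
    - apply (is_derive_plus (fun s => m2 * (x s - x t)) (fun s => m3 * (y s - y t))); apply Hm; assumption.
    - apply Hm; assumption. }
  assert (Hrem : is_derive rem t 0).
  { destruct (is_derive_local_lipschitz _ _ _ Hx) as [dx [Hdx Bx]].
    destruct (is_derive_local_lipschitz _ _ _ Hy) as [dy [Hdy By]].
    destruct (is_derive_local_lipschitz _ _ _ Hz) as [dz [Hdz Bz]].
    (* The sum of the three local Lipschitz constants [|x'| + 1], [|y'| + 1], [|z'| + 1]. For
       [|h| < 1] the curve stays within [W] of its value at [t], hence in the box of size [K]. *)
    set (W := Rabs x' + Rabs y' + Rabs z' + 3).
    set (K := Rabs (x t) + Rabs (y t) + Rabs (z t) + W).
    pose proof (Rabs_pos x'). pose proof (Rabs_pos y'). pose proof (Rabs_pos z').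
    pose proof (Rabs_pos (x t)). pose proof (Rabs_pos (y t)). pose proof (Rabs_pos (z t)).
    destruct (taylor1_box f f2 f3 f4 Hp L2 L3 L4 K) as [C [HC HT]].
    apply is_derive_Reals. intros eps Heps.
    set (d := Rmin (Rmin 1 (eps / (C * W ^ 2 + 1))) (Rmin dx (Rmin dy dz))).
    assert (HCW : 0 <= C * W ^ 2) by (apply Rmult_le_pos; [assumption|apply pow2_ge_0]).
    assert (Hd : 0 < d).
    { unfold d. repeat apply Rmin_glb_lt; try assumption; [lra|]. apply Rdiv_lt_0_compat; lra. }
    exists (mkposreal d Hd). intros h Hne Hh. cbn [pos] in Hh.
    assert (Hh1 : Rabs h < 1).
    { eapply Rlt_le_trans; [exact Hh|]. eapply Rle_trans; [apply Rmin_l|apply Rmin_l]. }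
    assert (Hh2 : Rabs h < eps / (C * W ^ 2 + 1)).
    { eapply Rlt_le_trans; [exact Hh|]. eapply Rle_trans; [apply Rmin_l|apply Rmin_r]. }
    assert (Hh3 : Rabs h < dx).
    { eapply Rlt_le_trans; [exact Hh|]. eapply Rle_trans; [apply Rmin_r|apply Rmin_l]. }
    assert (Hh4 : Rabs h < dy).
    { eapply Rlt_le_trans; [exact Hh|]. eapply Rle_trans; [apply Rmin_r|].
      eapply Rle_trans; [apply Rmin_r|apply Rmin_l]. }
    assert (Hh5 : Rabs h < dz).
    { eapply Rlt_le_trans; [exact Hh|]. eapply Rle_trans; [apply Rmin_r|].
      eapply Rle_trans; [apply Rmin_r|apply Rmin_r]. }
    specialize (Bx h Hh3). specialize (By h Hh4). specialize (Bz h Hh5).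
    assert (Hhp : 0 < Rabs h) by (apply Rabs_pos_lt; assumption).
    assert (Bd : forall u v : R, Rabs (u - v) <= W * Rabs h -> Rabs u <= Rabs v + W).
    { intros u v Huv. replace u with ((u - v) + v) by ring.
      eapply Rle_trans; [apply Rabs_triang|].
      assert (W * Rabs h <= W * 1) by (apply Rmult_le_compat_l; unfold W; lra). lra. }
    assert (Rabs (x (t + h) - x t) <= W * Rabs h).
    { eapply Rle_trans; [exact Bx|]. apply Rmult_le_compat_r; unfold W; lra. }
    assert (Rabs (y (t + h) - y t) <= W * Rabs h).
    { eapply Rle_trans; [exact By|]. apply Rmult_le_compat_r; unfold W; lra. }
    assert (Rabs (z (t + h) - z t) <= W * Rabs h).
    { eapply Rle_trans; [exact Bz|]. apply Rmult_le_compat_r; unfold W; lra. }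
    assert (Hr0 : rem t = 0) by (unfold rem, lin; ring).
    assert (HR : Rabs (rem (t + h)) <= C * (W * Rabs h) ^ 2).
    { eapply Rle_trans; [apply HT; unfold K|].
      - apply Rle_trans with (Rabs (x t) + W); [apply Bd; assumption|lra].
      - apply Rle_trans with (Rabs (y t) + W); [apply Bd; assumption|lra].
      - apply Rle_trans with (Rabs (z t) + W); [apply Bd; assumption|lra].
      - unfold W; lra.
      - unfold W; lra.
      - unfold W; lra.
      - apply Rmult_le_compat_l; [assumption|]. apply pow_incr. split.
        + pose proof (Rabs_pos (x (t + h) - x t)). pose proof (Rabs_pos (y (t + h) - y t)).
          pose proof (Rabs_pos (z (t + h) - z t)). lra.
        + unfold W. lra. }
    rewrite Hr0. replace ((rem (t + h) - 0) / h - 0) with (rem (t + h) / h) by (field; assumption).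
    unfold Rdiv. rewrite Rabs_mult, Rabs_inv by assumption.
    apply Rmult_lt_reg_r with (Rabs h); [assumption|]. rewrite Rmult_assoc, Rinv_l by lra.
    rewrite Rmult_1_r. eapply Rle_lt_trans; [exact HR|].
    apply Rmult_lt_compat_r with (r := C * W ^ 2 + 1) in Hh2; [|lra].
    replace (eps / (C * W ^ 2 + 1) * (C * W ^ 2 + 1)) with eps in Hh2 by (field; lra).
    replace (C * (W * Rabs h) ^ 2) with ((Rabs h * (C * W ^ 2)) * Rabs h) by ring.
    apply Rmult_lt_compat_r; [assumption|]. lra. }
  replace (m2 * x' + m3 * y' + m4 * z') with (0 + (m2 * x' + m3 * y' + m4 * z') + 0) by ring.
  apply is_derive_ext with (f := fun s => rem s + lin s + f (x t) (y t) (z t)).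
  { intro s. unfold rem. now ring_simplify. }
  apply (is_derive_plus (fun s => rem s + lin s) (fun _ => f (x t) (y t) (z t))).
  - apply (is_derive_plus rem lin); assumption.
  - apply @is_derive_const.
Qed.

(** * Growth of the acceleration *)

(** A class containing [rho] and [Derive rho] and stable under multiplication by the variable. In
    the rescaled equations the wave profile appears only through products of powers of [x] with
    these two functions. *)
Definition cutoff (f : R -> R) : Prop :=
  (forall x, 1 < Rabs x -> f x = 0) /\
  exists C, 0 <= C /\ (forall x, Rabs (f x) <= C) /\
    forall x y, Rabs (f x - f y) <= C * Rabs (x - y).

(** In the product rule for differences the unbounded factor can be evaluated at whichever point
    lies in [[-1,1]]; if neither does, both values vanish. *)
Lemma cutoff_mult_id (f : R -> R) : cutoff f -> cutoff (fun x => x * f x).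
Proof.
  intros [H0 [C [HC [Hb Hl]]]]. split.
  { intros x Hx. rewrite H0 by assumption. ring. }
  exists (2 * C). split; [lra|]. split.
  - intro x. destruct (Rlt_dec 1 (Rabs x)).
    + rewrite H0 by assumption. rewrite Rmult_0_r, Rabs_R0. lra.
    + apply Rle_trans with (1 * C); [apply Rabs_mult_le; [lra|apply Hb]|lra].
  - assert (P : forall x y, Rabs x <= 1 -> Rabs (x * f x - y * f y) <= 2 * C * Rabs (x - y)).
    { intros x y Hx.
      replace (x * f x - y * f y) with (x * (f x - f y) + f y * (x - y)) by ring.
      eapply Rle_trans; [apply Rabs_triang|].
      assert (Rabs (x * (f x - f y)) <= 1 * (C * Rabs (x - y))) by (apply Rabs_mult_le; [lra|apply Hl]).
      assert (Rabs (f y * (x - y)) <= C * Rabs (x - y)) by (apply Rabs_mult_le; [apply Hb|lra]).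
      lra. }
    intros x y. destruct (Rle_dec (Rabs x) 1); [apply P; assumption|].
    destruct (Rle_dec (Rabs y) 1).
    + rewrite Rabs_minus_sym, (Rabs_minus_sym x y). apply P; assumption.
    + rewrite (H0 x), (H0 y) by lra. rewrite !Rmult_0_r, Rminus_diag, Rabs_R0.
      apply Rmult_le_pos; [lra|apply Rabs_pos].
Qed.

Lemma Derive_zero_outside (f : R -> R) :
  (forall x, 1 < Rabs x -> f x = 0) -> forall x, 1 < Rabs x -> Derive f x = 0.
Proof.
  intros H0 x Hx. rewrite <- (Derive_const 0 x). apply Derive_ext_loc.
  assert (Hd : 0 < Rabs x - 1) by lra.
  exists (mkposreal _ Hd). intros y Hy. apply H0.
  change (Rabs (y - x) < Rabs x - 1) in Hy. rewrite Rabs_minus_sym in Hy.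
  pose proof (Rabs_triang_inv x y). lra.
Qed.

Lemma cutoff_of_C1 (f : R -> R) :
  (forall x, ex_derive f x) -> (forall x, continuous (Derive f) x) ->
  (forall x, 1 < Rabs x -> f x = 0) -> cutoff f.
Proof.
  intros Hd Hc H0. split; [assumption|].
  destruct (bounded_continuity (Derive f) (-1) 1) as [M HM].
  { intros x _. apply Hc. }
  assert (HM0 : 0 <= M) by (eapply Rle_trans; [apply (norm_ge_0 (Derive f 0))|left; apply HM; lra]).
  assert (Hb : forall x, Rabs (Derive f x) <= M).
  { intro x. destruct (Rlt_dec 1 (Rabs x)).
    - rewrite Derive_zero_outside by assumption. rewrite Rabs_R0. assumption.
    - left. apply HM. apply Rabs_le_between. lra. }
  assert (Hl : forall x y, Rabs (f x - f y) <= M * Rabs (x - y)).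
  { intros x y.
    apply (lipschitz_of_derive_bound f (Derive f) (Rmax (Rabs x) (Rabs y))).
    - intros; apply Derive_correct, Hd.
    - intros; apply Hb.
    - apply Rmax_l.
    - apply Rmax_r. }
  (* The bound on [f] comes from its Lipschitz constant and [f 2 = 0]: points of [[-1,1]] are within
     3 of the point 2. *)
  exists (3 * M). split; [lra|]. split.
  - intro x. destruct (Rlt_dec 1 (Rabs x)).
    + rewrite H0 by assumption. rewrite Rabs_R0. lra.
    + replace (f x) with (f x - f 2).
      * eapply Rle_trans; [apply Hl|]. rewrite (Rmult_comm 3). apply Rmult_le_compat_l; [assumption|].
        assert (Rabs x <= 1) by lra. apply Rabs_le_between in H. apply Rabs_le. lra.
      * rewrite (H0 2); [ring|]. rewrite Rabs_right; lra.
  - intros x y. eapply Rle_trans; [apply Hl|]. pose proof (Rabs_pos (x - y)). nra.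
Qed.

Lemma smooth1_Derive (f : R -> R) : smooth1 f -> smooth1 (Derive f).
Proof.
  intros Hf n x.
  destruct n as [|n]; [exact I|].
  cbn. apply ex_derive_ext with (f := Derive_n f (S n)); [|exact (Hf (S (S n)) x)].
  intro s. clear -Hf. revert s. induction n as [|n IH]; intro s; [reflexivity|].
  cbn in *. now apply Derive_ext.
Qed.

Lemma smooth1_ex_derive (f : R -> R) (x : R) : smooth1 f -> ex_derive f x.
Proof. intros Hf. exact (Hf 1%nat x). Qed.

Lemma smooth1_continuous (f : R -> R) (x : R) : smooth1 f -> continuous f x.
Proof. intros Hf. apply (ex_derive_continuous f), smooth1_ex_derive, Hf. Qed.

Lemma smooth1_cutoff (f : R -> R) :
  smooth1 f -> (forall x, 1 < Rabs x -> f x = 0) -> cutoff f.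
Proof.
  intros Hf H0. apply cutoff_of_C1; [| |assumption].
  - intro; apply smooth1_ex_derive, Hf.
  - intro; apply smooth1_continuous, smooth1_Derive, Hf.
Qed.

(** On [[-1,1]] one has [1 <= 2 / (1 + x ^ 2)]. This trades the support condition for the smooth
    weight produced by differentiating the arctangent. *)
Lemma cutoff_decay (f : R -> R) :
  cutoff f -> exists C, 0 <= C /\ forall x, Rabs (f x) <= C * / (1 + x ^ 2).
Proof.
  intros [H0 [C [HC [Hb _]]]]. exists (2 * C). split; [lra|]. intro x.
  pose proof (inv_1_plus_sqr_bounds x) as Hq.
  destruct (Rlt_dec 1 (Rabs x)).
  - rewrite H0 by assumption. rewrite Rabs_R0. apply Rmult_le_pos; lra.
  - eapply Rle_trans; [apply Hb|].
    assert (1 <= 2 * / (1 + x ^ 2)).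
    { apply Rmult_le_reg_r with (1 + x ^ 2); [pose proof (pow2_ge_0 x); lra|].
      rewrite Rmult_assoc, Rinv_l by (pose proof (pow2_ge_0 x); lra).
      rewrite <- pow2_abs. pose proof (Rabs_pos x). nra. }
    nra.
Qed.

(** A nonzero difference forces at least one of the points into [[-1,1]], but not a known one;
    therefore the weights are added. *)
Lemma cutoff_lipschitz_decay (f : R -> R) :
  cutoff f -> exists C, 0 <= C /\ forall x y,
    Rabs (f x - f y) <= C * Rabs (x - y) * (/ (1 + x ^ 2) + / (1 + y ^ 2)).
Proof.
  intros [H0 [C [HC [_ Hl]]]]. exists (2 * C). split; [lra|]. intros x y.
  pose proof (inv_1_plus_sqr_bounds x) as Hqx. pose proof (inv_1_plus_sqr_bounds y) as Hqy.
  pose proof (Rabs_pos (x - y)) as Hxy.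
  assert (HCx : 0 <= C * Rabs (x - y)) by (apply Rmult_le_pos; assumption).
  assert (P : forall z, Rabs z <= 1 -> 1 <= 2 * / (1 + z ^ 2)).
  { intros z Hz. apply Rmult_le_reg_r with (1 + z ^ 2); [pose proof (pow2_ge_0 z); lra|].
    rewrite Rmult_assoc, Rinv_l by (pose proof (pow2_ge_0 z); lra).
    rewrite <- pow2_abs. pose proof (Rabs_pos z). nra. }
  destruct (Rle_dec (Rabs x) 1) as [Hx|Hx].
  - specialize (P x Hx). eapply Rle_trans; [apply Hl|]. nra.
  - destruct (Rle_dec (Rabs y) 1) as [Hy|Hy].
    + specialize (P y Hy). eapply Rle_trans; [apply Hl|]. nra.
    + rewrite (H0 x), (H0 y) by lra. rewrite Rminus_diag, Rabs_R0. nra.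
Qed.

(** * The right-hand side in rescaled form *)

Definition evalZ (H : R -> R -> R -> R) (p : R5) : R := H (cZ2 p) (cZ3 p) (cZ4 p).

(** With the velocity for [w] this is the time derivative of [H] along the curve; with [w = p] it is
    the sum of the [H_{,p} Z_p] in [G_eps]. *)
Definition dHdot (H : R -> R -> R -> R) (p w : R5) : R :=
  evalZ (dH2 H) p * cZ2 w + evalZ (dH3 H) p * cZ3 w + evalZ (dH4 H) p * cZ4 w.

(** This is [N_eps] after the substitution [U = eps * x]: since [U ^ 2 * delta_eps(U) = eps * x ^ 2
    * rho x], it visibly differs from [sigma * a ^ 2] by [O(eps)]. *)
Definition normN (sigma a : R) (H : R -> R -> R -> R) (rho : R -> R) (eps : R) (p : R5) : R :=
  let x := cU p / eps in sigma * a ^ 2 - eps * (x * (x * rho x)) * evalZ H p.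

(* [Phi_eps] with the time derivative of [H delta_eps(U) U] carried out; [p] and [v] are
   position and velocity. *)
Definition Phi (e : R) (H : R -> R -> R -> R) (rho : R -> R) (eps : R) (p v : R5) : R :=
  let x := cU p / eps in
  e + / eps * (cU v ^ 2 * (/ 2 * rho x * dHdot H p p
                           - evalZ H p * (/ 2 * (x * Derive rho x) + rho x)))
    - cU v * (x * rho x) * dHdot H p v.

(** The system solved for the second derivatives. The velocity of [V] does not occur in it, which is
    why [in_vbox] and [gap] below are silent about [cV v]. *)
Definition acc (sigma a e : R) (H : R -> R -> R -> R) (rho : R -> R) (eps : R) (p v : R5) : R5 :=
  let x := cU p / eps in
  let F := Phi e H rho eps p v * / normN sigma a H rho eps p in
  mk5
    (- (F * cU p))
    (/ 2 * evalZ H p * (/ eps * (/ eps * Derive rho x)) * cU v ^ 2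
       + / eps * rho x * cU v * dHdot H p v - F * (cV p + evalZ H p * (x * rho x)))
    (/ 2 * evalZ (dH2 H) p * (/ eps * rho x) * cU v ^ 2 - F * cZ2 p)
    (/ 2 * evalZ (dH3 H) p * (/ eps * rho x) * cU v ^ 2 - F * cZ3 p)
    (sigma / 2 * evalZ (dH4 H) p * (/ eps * rho x) * cU v ^ 2 - F * cZ4 p).

Definition in_box (K : R) (p : R5) : Prop :=
  Rabs (cU p) <= K /\ Rabs (cV p) <= K /\ Rabs (cZ2 p) <= K /\ Rabs (cZ3 p) <= K /\ Rabs (cZ4 p) <= K.

(* All that is needed of [H] and [rho]. *)
Definition regular_profile (H : R -> R -> R -> R) (rho : R -> R) : Prop :=
  (box_bounded H /\ box_bounded (dH2 H) /\ box_bounded (dH3 H) /\ box_bounded (dH4 H)) /\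
  (box_lipschitz H /\ box_lipschitz (dH2 H) /\ box_lipschitz (dH3 H) /\ box_lipschitz (dH4 H)) /\
  cutoff rho /\ cutoff (Derive rho).

Lemma smooth_regular_profile (H : R -> R -> R -> R) (rho : R -> R) :
  smooth3 H -> smooth1 rho -> (forall x, 1 < Rabs x -> rho x = 0) -> regular_profile H rho.
Proof.
  intros HH Hrho Hsupp. split; [|split; [|split]].
  - split; [apply (iter3_box_bounded H nil HH); constructor|].
    split; [apply (iter3_box_bounded H (0%nat :: nil) HH); repeat constructor|].
    split; [apply (iter3_box_bounded H (1%nat :: nil) HH); repeat constructor|].
    apply (iter3_box_bounded H (2%nat :: nil) HH); repeat constructor.
  - split; [apply (iter3_box_lipschitz H nil HH); constructor|].
    split; [apply (iter3_box_lipschitz H (0%nat :: nil) HH); repeat constructor|].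
    split; [apply (iter3_box_lipschitz H (1%nat :: nil) HH); repeat constructor|].
    apply (iter3_box_lipschitz H (2%nat :: nil) HH); repeat constructor.
  - apply smooth1_cutoff; assumption.
  - apply smooth1_cutoff; [apply smooth1_Derive, Hrho|].
    intros x Hx. apply Derive_zero_outside; assumption.
Qed.

Lemma normN_lower_bound (sigma a : R) (H : R -> R -> R -> R) (rho : R -> R) (K : R) :
  sigma = 1 \/ sigma = -1 -> 0 < a -> regular_profile H rho ->
  exists eps1, 0 < eps1 /\ forall eps p, 0 < eps < eps1 -> in_box K p ->
    a ^ 2 / 2 <= Rabs (normN sigma a H rho eps p).
Proof.
  intros Hs Ha ((BH & _) & _ & Hr & _).
  destruct (BH K) as [C1 [HC1 B1]].
  destruct (cutoff_mult_id _ (cutoff_mult_id _ Hr)) as [_ [C2 [HC2 [B2 _]]]].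
  assert (H12 : 0 <= C2 * C1) by (apply Rmult_le_pos; assumption).
  assert (Ha2 : 0 < a ^ 2) by (apply pow2_gt_0; lra).
  exists (a ^ 2 / 2 / (C2 * C1 + 1)). split; [apply Rdiv_lt_0_compat; lra|].
  intros eps p He (_ & _ & P2 & P3 & P4). unfold normN. cbv zeta. set (x := cU p / eps).
  assert (E : Rabs (eps * (x * (x * rho x)) * evalZ H p) <= a ^ 2 / 2).
  { rewrite Rmult_assoc, Rabs_mult, Rabs_right by lra.
    assert (Rabs (x * (x * rho x) * evalZ H p) <= C2 * C1).
    { apply Rabs_mult_le; [apply B2|apply B1; assumption]. }
    destruct He as [He1 He2]. apply Rmult_lt_compat_r with (r := C2 * C1 + 1) in He2; [|lra].
    replace (a ^ 2 / 2 / (C2 * C1 + 1) * (C2 * C1 + 1)) with (a ^ 2 / 2) in He2 by (field; lra).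
    pose proof (Rabs_pos (x * (x * rho x) * evalZ H p)). nra. }
  assert (Es : Rabs (sigma * a ^ 2) = a ^ 2).
  { rewrite Rabs_mult, (Rabs_right (a ^ 2)) by lra. destruct Hs as [-> | ->].
    - rewrite Rabs_R1. ring.
    - rewrite Rabs_left; lra. }
  pose proof (Rabs_triang_inv (sigma * a ^ 2) (eps * (x * (x * rho x)) * evalZ H p)). lra.
Qed.

(** One constant serves all [eps], positions and velocities in [P]. Hiding it behind an existential
    lets estimates be assembled along the syntax of the formulas. *)
Definition bigO (P : R -> R5 -> R5 -> Prop) (w f : R -> R5 -> R5 -> R) : Prop :=
  exists C, 0 <= C /\ forall eps p v, P eps p v -> Rabs (f eps p v) <= C * w eps p v.

Lemma bigO_weaken P (w1 w2 f : R -> R5 -> R5 -> R) :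
  bigO P w1 f -> (forall eps p v, P eps p v -> w1 eps p v <= w2 eps p v) -> bigO P w2 f.
Proof.
  intros [C [HC Hf]] Hw. exists C. split; [assumption|]. intros eps p v Hp.
  eapply Rle_trans; [apply Hf, Hp|]. apply Rmult_le_compat_l; [assumption|apply Hw, Hp].
Qed.

Lemma bigO_mult P (w1 w2 f g : R -> R5 -> R5 -> R) :
  bigO P w1 f -> bigO P w2 g ->
  bigO P (fun eps p v => w1 eps p v * w2 eps p v) (fun eps p v => f eps p v * g eps p v).
Proof.
  intros [C [HC Hf]] [D [HD Hg]]. exists (C * D). split; [apply Rmult_le_pos; assumption|].
  intros eps p v Hp.
  replace (C * D * (w1 eps p v * w2 eps p v)) with ((C * w1 eps p v) * (D * w2 eps p v)) by ring.
  apply Rabs_mult_le; auto.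
Qed.

Lemma bigO_plus P (w f g : R -> R5 -> R5 -> R) :
  bigO P w f -> bigO P w g -> bigO P w (fun eps p v => f eps p v + g eps p v).
Proof.
  intros [C [HC Hf]] [D [HD Hg]]. exists (C + D). split; [lra|].
  intros eps p v Hp. specialize (Hf eps p v Hp). specialize (Hg eps p v Hp).
  eapply Rle_trans; [apply Rabs_triang|]. lra.
Qed.

Lemma bigO_opp P (w f : R -> R5 -> R5 -> R) :
  bigO P w f -> bigO P w (fun eps p v => - f eps p v).
Proof.
  intros [C [HC Hf]]. exists C. split; [assumption|]. intros. rewrite Rabs_Ropp. auto.
Qed.

Lemma bigO_minus P (w f g : R -> R5 -> R5 -> R) :
  bigO P w f -> bigO P w g -> bigO P w (fun eps p v => f eps p v - g eps p v).
Proof. intros Hf Hg. apply bigO_plus; [assumption|now apply bigO_opp]. Qed.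

Lemma bigO_mult_bounded P (w f g : R -> R5 -> R5 -> R) :
  bigO P (fun _ _ _ => 1) f -> bigO P w g -> bigO P w (fun eps p v => f eps p v * g eps p v).
Proof.
  intros Hf Hg. eapply bigO_weaken; [apply (bigO_mult P _ _ _ _ Hf Hg)|]. intros. cbv beta. lra.
Qed.

Lemma bigO_mult_bounded_r P (w f g : R -> R5 -> R5 -> R) :
  bigO P w f -> bigO P (fun _ _ _ => 1) g -> bigO P w (fun eps p v => f eps p v * g eps p v).
Proof.
  intros Hf Hg. eapply bigO_weaken; [apply (bigO_mult P _ _ _ _ Hf Hg)|]. intros. cbv beta. lra.
Qed.

Lemma bigO_const P (c : R) : bigO P (fun _ _ _ => 1) (fun _ _ _ => c).
Proof. exists (Rabs c). split; [apply Rabs_pos|]. intros. lra. Qed.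

Lemma bigO_self P (f : R -> R5 -> R5 -> R) : bigO P (fun eps p v => Rabs (f eps p v)) f.
Proof. exists 1. split; [lra|]. intros. lra. Qed.

(** Together with [speedZ] below, these are the quantities [q] and [Y] of [a_priori_bounds]. *)
Definition zone_weight (eps : R) (p : R5) : R := / (1 + (cU p / eps) ^ 2).

Definition speedZ (v : R5) : R := 1 + Rabs (cZ2 v) + Rabs (cZ3 v) + Rabs (cZ4 v).

Lemma bigO_cutoff P (f : R -> R) :
  cutoff f -> bigO P (fun eps p _ => zone_weight eps p) (fun eps p _ => f (cU p / eps)).
Proof.
  intros Hf. destruct (cutoff_decay f Hf) as [C [HC Hb]]. exists C. split; [assumption|].
  intros. apply Hb.
Qed.

Lemma bigO_evalZ P K (f : R -> R -> R -> R) :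
  box_bounded f -> (forall eps p v, P eps p v -> in_box K p) ->
  bigO P (fun _ _ _ => 1) (fun _ p _ => evalZ f p).
Proof.
  intros Hf HP. destruct (Hf K) as [C [HC Hb]]. exists C. split; [assumption|].
  intros eps p v Hp. destruct (HP eps p v Hp) as (_ & _ & H2 & H3 & H4).
  rewrite Rmult_1_r. apply Hb; assumption.
Qed.

(** Off the wave zone [U'' = - kap * U] with [kap = e / (sigma * a ^ 2)], so every term of the
    deviation carries the zone weight. In the [U]-component the factor [U = eps * x] also removes
    the [1 / eps] of [Phi], a gain of one power of [eps] over the [Z]-components. *)
Lemma acc_growth (sigma a e : R) (H : R -> R -> R -> R) (rho : R -> R) (K : R) :
  sigma = 1 \/ sigma = -1 -> 0 < a -> regular_profile H rho -> 0 <= K ->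
  exists eps1 C, 0 < eps1 /\ 0 <= C /\ forall eps p v, 0 < eps < eps1 -> in_box K p ->
    let q := zone_weight eps p in
    let Y := speedZ v in
    let A := acc sigma a e H rho eps p v in
    let X := C * (1 + cU v ^ 2 * (q / eps) + q * Rabs (cU v) * Y) in
    Rabs (cU A + e / (sigma * a ^ 2) * cU p)
      <= C * (q * (cU v ^ 2 + eps * Rabs (cU v) * Y + eps ^ 2)) /\
    Rabs (cZ2 A) <= X /\ Rabs (cZ3 A) <= X /\ Rabs (cZ4 A) <= X.
Proof.
  intros Hs Ha Hreg HK.
  destruct (normN_lower_bound sigma a H rho K Hs Ha Hreg) as [eps1 [He1 HN]].
  destruct Hreg as ((BH & B2 & B3 & B4) & _ & Hr & Hr').
  set (P := fun (eps : R) (p v : R5) => 0 < eps < eps1 /\ in_box K p).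
  assert (Ha2 : 0 < a ^ 2) by (apply pow2_gt_0; lra).
  assert (Hs0 : sigma <> 0) by (destruct Hs; lra).
  assert (HP : forall eps p v, P eps p v -> in_box K p) by (intros eps p v [_ Hp]; exact Hp).
  assert (Hq : forall eps p, 0 < zone_weight eps p <= 1) by (intros; apply inv_1_plus_sqr_bounds).
  assert (HY : forall v, 1 <= speedZ v).
  { intro v. unfold speedZ. pose proof (Rabs_pos (cZ2 v)). pose proof (Rabs_pos (cZ3 v)).
    pose proof (Rabs_pos (cZ4 v)). lra. }
  pose proof (bigO_evalZ P K H BH HP) as OH.
  pose proof (bigO_evalZ P K _ B2 HP) as O2. pose proof (bigO_evalZ P K _ B3 HP) as O3.
  pose proof (bigO_evalZ P K _ B4 HP) as O4.
  assert (OZ2 : bigO P (fun _ _ _ => 1) (fun _ p _ => cZ2 p)).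
  { exists K. split; [assumption|]. intros eps p v [_ Hp]. rewrite Rmult_1_r. apply Hp. }
  assert (OZ3 : bigO P (fun _ _ _ => 1) (fun _ p _ => cZ3 p)).
  { exists K. split; [assumption|]. intros eps p v [_ Hp]. rewrite Rmult_1_r. apply Hp. }
  assert (OZ4 : bigO P (fun _ _ _ => 1) (fun _ p _ => cZ4 p)).
  { exists K. split; [assumption|]. intros eps p v [_ Hp]. rewrite Rmult_1_r. apply Hp. }
  assert (ON : bigO P (fun _ _ _ => 1) (fun eps p _ => / normN sigma a H rho eps p)).
  { exists (/ (a ^ 2 / 2)). split; [left; apply Rinv_0_lt_compat; lra|].
    intros eps p v [He Hp]. specialize (HN eps p He Hp). rewrite Rabs_inv, Rmult_1_r.
    apply Rinv_le_contravar; lra. }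
  assert (OS : bigO P (fun _ _ _ => 1) (fun _ p _ => dHdot H p p)).
  { unfold dHdot. repeat apply bigO_plus; apply bigO_mult_bounded; assumption. }
  assert (Ow : bigO P (fun _ _ v => speedZ v) (fun _ p v => dHdot H p v)).
  { assert (W2 : bigO P (fun _ _ v => speedZ v) (fun _ _ v => cZ2 v)).
    { eapply bigO_weaken; [apply bigO_self|]. intros. unfold speedZ. pose proof (Rabs_pos (cZ3 v)).
      pose proof (Rabs_pos (cZ4 v)). lra. }
    assert (W3 : bigO P (fun _ _ v => speedZ v) (fun _ _ v => cZ3 v)).
    { eapply bigO_weaken; [apply bigO_self|]. intros. unfold speedZ. pose proof (Rabs_pos (cZ2 v)).
      pose proof (Rabs_pos (cZ4 v)). lra. }
    assert (W4 : bigO P (fun _ _ v => speedZ v) (fun _ _ v => cZ4 v)).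
    { eapply bigO_weaken; [apply bigO_self|]. intros. unfold speedZ. pose proof (Rabs_pos (cZ2 v)).
      pose proof (Rabs_pos (cZ3 v)). lra. }
    unfold dHdot. repeat apply bigO_plus; apply bigO_mult_bounded; assumption. }
  assert (OV2 : bigO P (fun _ _ v => cU v ^ 2) (fun _ _ v => cU v ^ 2)).
  { exists 1. split; [lra|]. intros. rewrite Rabs_right; [lra|]. apply Rle_ge, pow2_ge_0. }
  assert (OV : bigO P (fun _ _ v => Rabs (cU v)) (fun _ _ v => cU v)) by apply bigO_self.
  assert (Oe : bigO P (fun eps _ _ => eps) (fun eps _ _ => eps)).
  { exists 1. split; [lra|]. intros eps p v [He _]. rewrite Rabs_right; lra. }
  assert (Oie : bigO P (fun eps _ _ => / eps) (fun eps _ _ => / eps)).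
  { exists 1. split; [lra|]. intros eps p v [He _].
    assert (0 < / eps) by (apply Rinv_0_lt_compat; lra). rewrite Rabs_right; lra. }
  pose proof (bigO_cutoff P _ Hr) as R0.
  pose proof (bigO_cutoff P _ (cutoff_mult_id _ Hr)) as R1.
  pose proof (bigO_cutoff P _ (cutoff_mult_id _ (cutoff_mult_id _ Hr))) as R2.
  pose proof (bigO_cutoff P _ (cutoff_mult_id _ (cutoff_mult_id _ (cutoff_mult_id _ Hr)))) as R3.
  pose proof (bigO_cutoff P _ (cutoff_mult_id _ Hr')) as R1'.
  pose proof (bigO_cutoff P _ (cutoff_mult_id _ (cutoff_mult_id _ Hr'))) as R2'.
  cbv beta in R1, R2, R3, R1', R2'.
  assert (OF : bigO P (fun eps p v => 1 + cU v ^ 2 * (zone_weight eps p / eps) + zone_weight eps p * Rabs (cU v) * speedZ v)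
                 (fun eps p v => Phi e H rho eps p v)).
  { unfold Phi. cbv zeta. apply bigO_minus; [apply bigO_plus|].
    - eapply bigO_weaken; [apply bigO_const|]. intros eps p v [He _]. cbv beta.
      specialize (Hq eps p). specialize (HY v). pose proof (pow2_ge_0 (cU v)).
      assert (0 < zone_weight eps p / eps) by (apply Rdiv_lt_0_compat; lra).
      assert (0 <= zone_weight eps p * Rabs (cU v) * speedZ v).
      { repeat apply Rmult_le_pos; try lra. apply Rabs_pos. }
      assert (0 <= cU v ^ 2 * (zone_weight eps p / eps)) by (apply Rmult_le_pos; lra). lra.
    - eapply bigO_weaken.
      + apply (bigO_mult P (fun eps _ _ => / eps) (fun eps p v => cU v ^ 2 * zone_weight eps p)); [exact Oie|].
        apply (bigO_mult P (fun _ _ v => cU v ^ 2) (fun eps p v => zone_weight eps p)); [exact OV2|].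
        apply bigO_minus.
        * apply bigO_mult_bounded_r; [|exact OS]. apply bigO_mult_bounded; [apply bigO_const|exact R0].
        * apply bigO_mult_bounded; [exact OH|]. apply bigO_plus; [|exact R0].
          apply bigO_mult_bounded; [apply bigO_const|exact R1'].
      + intros eps p v [He _]. cbv beta. specialize (Hq eps p). specialize (HY v).
        assert (0 <= zone_weight eps p * Rabs (cU v) * speedZ v).
        { repeat apply Rmult_le_pos; try lra. apply Rabs_pos. }
        replace (/ eps * (cU v ^ 2 * zone_weight eps p)) with (cU v ^ 2 * (zone_weight eps p / eps)) by (field; lra). lra.
    - eapply bigO_weaken.
      + apply (bigO_mult P (fun eps p v => Rabs (cU v) * zone_weight eps p) (fun _ _ v => speedZ v)); [|exact Ow].
        apply (bigO_mult P (fun _ _ v => Rabs (cU v)) (fun eps p _ => zone_weight eps p)); [exact OV|exact R1].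
      + intros eps p v [He _]. cbv beta. specialize (Hq eps p). pose proof (pow2_ge_0 (cU v)).
        assert (0 < zone_weight eps p / eps) by (apply Rdiv_lt_0_compat; lra).
        assert (0 <= cU v ^ 2 * (zone_weight eps p / eps)) by (apply Rmult_le_pos; lra). lra. }
  assert (Oh : forall c f (z : R5 -> R), bigO P (fun _ _ _ => 1) (fun _ p _ => evalZ f p) ->
     bigO P (fun _ _ _ => 1) (fun _ p _ => z p) ->
     bigO P (fun eps p v => 1 + cU v ^ 2 * (zone_weight eps p / eps) + zone_weight eps p * Rabs (cU v) * speedZ v)
       (fun eps p v => c * evalZ f p * (/ eps * rho (cU p / eps)) * cU v ^ 2
            - Phi e H rho eps p v * / normN sigma a H rho eps p * z p)).
  { intros c f z Of Oz. apply bigO_minus.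
    - eapply bigO_weaken.
      + apply (bigO_mult P (fun eps p v => / eps * zone_weight eps p) (fun _ _ v => cU v ^ 2)); [|exact OV2].
        apply bigO_mult_bounded.
        * apply bigO_mult_bounded; [apply bigO_const|exact Of].
        * apply (bigO_mult P (fun eps _ _ => / eps) (fun eps p v => zone_weight eps p)); [exact Oie|exact R0].
      + intros eps p v [He _]. cbv beta. specialize (Hq eps p). specialize (HY v).
        assert (0 <= zone_weight eps p * Rabs (cU v) * speedZ v).
        { repeat apply Rmult_le_pos; try lra. apply Rabs_pos. }
        replace (/ eps * zone_weight eps p * cU v ^ 2) with (cU v ^ 2 * (zone_weight eps p / eps)) by (field; lra). lra.
    - apply bigO_mult_bounded_r; [|exact Oz]. apply bigO_mult_bounded_r; [exact OF|exact ON]. }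
  (* An expanded form of [cU A + kap * U]. The last summand, of order [eps ^ 2], is the effect of
     replacing [1 / N] by [1 / (sigma * a ^ 2)] in the term [e * U / N]. *)
  assert (OU : bigO P (fun eps p v => zone_weight eps p * (cU v ^ 2 + eps * Rabs (cU v) * speedZ v + eps ^ 2))
     (fun eps p v => let x := cU p / eps in
        - (cU v ^ 2 * (/ 2 * (x * rho x) * dHdot H p p
             - evalZ H p * (/ 2 * (x * (x * Derive rho x)) + x * rho x)) * / normN sigma a H rho eps p
           - eps * (cU v * (x * (x * rho x)) * dHdot H p v * / normN sigma a H rho eps p)
           + eps * eps * (e / (sigma * a ^ 2) * (x * (x * (x * rho x))) * evalZ H p * / normN sigma a H rho eps p)))).
  { apply bigO_opp. apply bigO_plus; [apply bigO_minus|].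
    - eapply bigO_weaken.
      + apply bigO_mult_bounded_r; [|exact ON].
        apply (bigO_mult P (fun _ _ v => cU v ^ 2) (fun eps p v => zone_weight eps p)); [exact OV2|].
        apply bigO_minus.
        * apply bigO_mult_bounded_r; [|exact OS]. apply bigO_mult_bounded; [apply bigO_const|exact R1].
        * apply bigO_mult_bounded; [exact OH|]. apply bigO_plus; [|exact R1].
          apply bigO_mult_bounded; [apply bigO_const|exact R2'].
      + intros eps p v [He _]. cbv beta. specialize (Hq eps p). specialize (HY v).
        assert (0 <= eps * Rabs (cU v) * speedZ v).
        { repeat apply Rmult_le_pos; try lra. apply Rabs_pos. }
        rewrite Rmult_comm. apply Rmult_le_compat_l; [lra|]. pose proof (pow2_ge_0 eps). lra.
    - eapply bigO_weaken.
      + apply (bigO_mult P (fun eps _ _ => eps) (fun eps p v => Rabs (cU v) * zone_weight eps p * speedZ v)); [exact Oe|].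
        apply bigO_mult_bounded_r; [|exact ON].
        apply (bigO_mult P (fun eps p v => Rabs (cU v) * zone_weight eps p) (fun _ _ v => speedZ v)); [|exact Ow].
        apply (bigO_mult P (fun _ _ v => Rabs (cU v)) (fun eps p _ => zone_weight eps p)); [exact OV|exact R2].
      + intros eps p v [He _]. cbv beta. specialize (Hq eps p).
        replace (eps * (Rabs (cU v) * zone_weight eps p * speedZ v)) with (zone_weight eps p * (eps * Rabs (cU v) * speedZ v)) by ring.
        apply Rmult_le_compat_l; [lra|]. pose proof (pow2_ge_0 eps). pose proof (pow2_ge_0 (cU v)). lra.
    - eapply bigO_weaken.
      + apply (bigO_mult P (fun eps _ _ => eps * eps) (fun eps p v => zone_weight eps p)).
        * apply (bigO_mult P (fun eps _ _ => eps) (fun eps _ _ => eps)); exact Oe.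
        * apply bigO_mult_bounded_r; [|exact ON]. apply bigO_mult_bounded_r; [|exact OH].
          apply bigO_mult_bounded; [apply bigO_const|exact R3].
      + intros eps p v [He _]. cbv beta. specialize (Hq eps p). specialize (HY v).
        assert (0 <= eps * Rabs (cU v) * speedZ v).
        { repeat apply Rmult_le_pos; try lra. apply Rabs_pos. }
        pose proof (pow2_ge_0 (cU v)).
        replace (eps * eps * zone_weight eps p) with (zone_weight eps p * eps ^ 2) by ring.
        apply Rmult_le_compat_l; lra. }
  destruct OU as [C1 [HC1 E1]].
  destruct (Oh (/ 2) (dH2 H) cZ2 O2 OZ2) as [C2 [HC2 E2]].
  destruct (Oh (/ 2) (dH3 H) cZ3 O3 OZ3) as [C3 [HC3 E3]].
  destruct (Oh (sigma / 2) (dH4 H) cZ4 O4 OZ4) as [C4 [HC4 E4]].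
  exists eps1, (C1 + C2 + C3 + C4). split; [assumption|]. split; [lra|].
  intros eps p v He Hp. cbv zeta.
  assert (Hpv : P eps p v) by (split; assumption).
  specialize (E1 eps p v Hpv). specialize (E2 eps p v Hpv).
  specialize (E3 eps p v Hpv). specialize (E4 eps p v Hpv). specialize (HN eps p He Hp).
  specialize (Hq eps p). specialize (HY v).
  assert (W0 : 0 <= zone_weight eps p * Rabs (cU v) * speedZ v).
  { repeat apply Rmult_le_pos; try lra. apply Rabs_pos. }
  assert (W1 : 0 <= cU v ^ 2 * (zone_weight eps p / eps)).
  { apply Rmult_le_pos; [apply pow2_ge_0|]. left. apply Rdiv_lt_0_compat; lra. }
  assert (W2 : 0 <= zone_weight eps p * (cU v ^ 2 + eps * Rabs (cU v) * speedZ v + eps ^ 2)).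
  { apply Rmult_le_pos; [lra|]. pose proof (pow2_ge_0 eps). pose proof (pow2_ge_0 (cU v)).
    assert (0 <= eps * Rabs (cU v) * speedZ v).
    { repeat apply Rmult_le_pos; try lra. apply Rabs_pos. } lra. }
  set (X := 1 + cU v ^ 2 * (zone_weight eps p / eps) + zone_weight eps p * Rabs (cU v) * speedZ v) in *.
  assert (HX : 0 <= X) by (unfold X; lra).
  split; [|split; [|split]].
  - match type of E1 with Rabs ?A <= _ => set (A1 := A) in * end.
    replace (cU (acc sigma a e H rho eps p v) + e / (sigma * a ^ 2) * cU p) with A1.
    + eapply Rle_trans; [exact E1|]. apply Rmult_le_compat_r; lra.
    + assert (HN0 : normN sigma a H rho eps p <> 0).
      { intro Z. rewrite Z, Rabs_R0 in HN. lra. }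
      unfold A1, acc, Phi. cbn [cU]. cbv zeta.
      assert (HNe : normN sigma a H rho eps p
         = sigma * a ^ 2 - eps * (cU p / eps * (cU p / eps * rho (cU p / eps))) * evalZ H p) by reflexivity.
      set (N := normN sigma a H rho eps p) in *.
      set (x := cU p / eps) in *. replace (cU p) with (eps * x) by (unfold x; field; lra).
      (* The definition of [N] read backwards; eliminating [x ^ 2 * rho x] by it reduces the
         identity to a rational one in [N]. *)
      assert (HX3 : eps * (x * (x * rho x)) * evalZ H p = sigma * a ^ 2 - N) by lra.
      replace (e / (sigma * a ^ 2) * (x * (x * (x * rho x))) * evalZ H p * / N)
        with (e / (sigma * a ^ 2) * x * ((eps * (x * (x * rho x)) * evalZ H p) * / eps) * / N) by (field; lra).
      rewrite HX3. field. lra.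
  - eapply Rle_trans; [exact E2|]. apply Rmult_le_compat_r; lra.
  - eapply Rle_trans; [exact E3|]. apply Rmult_le_compat_r; lra.
  - eapply Rle_trans; [exact E4|]. apply Rmult_le_compat_r; lra.
Qed.

(** * Lipschitz estimate for the acceleration *)

Definition invdist (eps : R) (p : R5) : R := / sqrt (eps ^ 2 + cU p ^ 2).

Definition invdist2 (eps : R) (p p' : R5) : R := invdist eps p + invdist eps p'.

(* The weight on [U - U'] is of order [1 / eps] inside the wave zone and [1] outside; with it
   the acceleration is Lipschitz with constant [O(invdist2)], whose time integral is only
   [O(ln (1 / eps))]. *)
Definition gap (eps : R) (p v p' v' : R5) : R :=
  invdist2 eps p p' * Rabs (cU p - cU p') + Rabs (cU v - cU v')
  + (Rabs (cZ2 p - cZ2 p') + Rabs (cZ3 p - cZ3 p') + Rabs (cZ4 p - cZ4 p'))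
  + (Rabs (cZ2 v - cZ2 v') + Rabs (cZ3 v - cZ3 v') + Rabs (cZ4 v - cZ4 v'))
  + eps * Rabs (cV p - cV p').

Definition in_vbox (K : R) (v : R5) : Prop :=
  Rabs (cU v) <= K /\ Rabs (cZ2 v) <= K /\ Rabs (cZ3 v) <= K /\ Rabs (cZ4 v) <= K.

Definition admissible (eps1 K eps : R) (p v : R5) : Prop :=
  0 < eps < eps1 /\ in_box K p /\ in_vbox K v.

Definition unit_weight (_ : R) (_ _ : R5) : R := 1.

(** Size and variation are recorded together because the product rule needs both. Two weights are
    used: [unit_weight] for regular factors, and [invdist2] for singular ones, of size [1 / mu]. *)
Definition lip (P : R -> R5 -> R5 -> Prop) (w : R -> R5 -> R5 -> R) (f : R -> R5 -> R5 -> R) : Prop :=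
  exists C, 0 <= C /\ forall eps p v p' v', P eps p v -> P eps p' v' ->
    Rabs (f eps p v) <= C * w eps p p' /\ Rabs (f eps p' v') <= C * w eps p p' /\
    Rabs (f eps p v - f eps p' v') <= C * (w eps p p' * gap eps p v p' v').

Lemma lip_ext P w (f g : R -> R5 -> R5 -> R) :
  lip P w f -> (forall eps p v, P eps p v -> g eps p v = f eps p v) -> lip P w g.
Proof.
  intros [C [HC H]] E. exists C. split; [assumption|]. intros eps p v p' v' Hp Hp'.
  rewrite (E _ _ _ Hp), (E _ _ _ Hp'). auto.
Qed.

Lemma lip_plus P w (f g : R -> R5 -> R5 -> R) :
  lip P w f -> lip P w g -> lip P w (fun eps p v => f eps p v + g eps p v).
Proof.
  intros [C [HC Hf]] [D [HD Hg]]. exists (C + D). split; [lra|].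
  intros eps p v p' v' Hp Hp'.
  destruct (Hf eps p v p' v' Hp Hp') as (F1 & F2 & F3).
  destruct (Hg eps p v p' v' Hp Hp') as (G1 & G2 & G3).
  split; [|split].
  - eapply Rle_trans; [apply Rabs_triang|]. lra.
  - eapply Rle_trans; [apply Rabs_triang|]. lra.
  - replace (f eps p v + g eps p v - (f eps p' v' + g eps p' v'))
      with ((f eps p v - f eps p' v') + (g eps p v - g eps p' v')) by ring.
    eapply Rle_trans; [apply Rabs_triang|]. lra.
Qed.

Lemma lip_opp P w (f : R -> R5 -> R5 -> R) : lip P w f -> lip P w (fun eps p v => - f eps p v).
Proof.
  intros [C [HC Hf]]. exists C. split; [assumption|]. intros eps p v p' v' Hp Hp'.
  destruct (Hf eps p v p' v' Hp Hp') as (F1 & F2 & F3).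
  rewrite !Rabs_Ropp. repeat split; try assumption.
  replace (- f eps p v - - f eps p' v') with (- (f eps p v - f eps p' v')) by ring.
  now rewrite Rabs_Ropp.
Qed.

Lemma lip_minus P w (f g : R -> R5 -> R5 -> R) :
  lip P w f -> lip P w g -> lip P w (fun eps p v => f eps p v - g eps p v).
Proof. intros Hf Hg. apply lip_plus; [assumption|now apply lip_opp]. Qed.

(** One factor must be regular: two singular ones would produce [1 / mu ^ 2], whose time integral is
    not logarithmic. The right-hand sides, with the [V]-equation multiplied by [eps], factor
    accordingly. *)
Lemma lip_mult P w (f g : R -> R5 -> R5 -> R) :
  lip P unit_weight f -> lip P w g -> lip P w (fun eps p v => f eps p v * g eps p v).
Proof.
  intros [C [HC Hf]] [D [HD Hg]].
  assert (HCD : 0 <= C * D) by (apply Rmult_le_pos; assumption).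
  exists (2 * (C * D)). split; [lra|].
  intros eps p v p' v' Hp Hp'.
  destruct (Hf eps p v p' v' Hp Hp') as (F1 & F2 & F3).
  destruct (Hg eps p v p' v' Hp Hp') as (G1 & G2 & G3).
  unfold unit_weight in F1, F2, F3. rewrite Rmult_1_r in F1, F2. rewrite Rmult_1_l in F3.
  set (W := w eps p p') in *. set (Dst := gap eps p v p' v') in *.
  assert (B : forall u z, Rabs u <= C -> Rabs z <= D * W -> Rabs (u * z) <= 2 * (C * D) * W).
  { intros u z Hu Hz.
    assert (Rabs (u * z) <= C * (D * W)) by (apply Rabs_mult_le; assumption).
    pose proof (Rabs_pos (u * z)). nra. }
  split; [apply B; assumption|]. split; [apply B; assumption|].
  replace (f eps p v * g eps p v - f eps p' v' * g eps p' v')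
    with (f eps p v * (g eps p v - g eps p' v') + (f eps p v - f eps p' v') * g eps p' v') by ring.
  eapply Rle_trans; [apply Rabs_triang|].
  assert (Rabs (f eps p v * (g eps p v - g eps p' v')) <= C * (D * (W * Dst))) by (apply Rabs_mult_le; assumption).
  assert (Rabs ((f eps p v - f eps p' v') * g eps p' v') <= (C * Dst) * (D * W)) by (apply Rabs_mult_le; assumption).
  lra.
Qed.

Lemma lip_mult_r P w (f g : R -> R5 -> R5 -> R) :
  lip P w f -> lip P unit_weight g -> lip P w (fun eps p v => f eps p v * g eps p v).
Proof.
  intros Hf Hg. eapply lip_ext; [apply (lip_mult P w g f Hg Hf)|]. intros. apply Rmult_comm.
Qed.

Lemma invdist_pos (eps : R) (p : R5) : 0 < eps -> 0 < invdist eps p.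
Proof. intros. apply Rinv_0_lt_compat, sqrt_sqr_plus_sqr_pos. assumption. Qed.

Lemma gap_nonneg (eps : R) (p v p' v' : R5) : 0 < eps -> 0 <= gap eps p v p' v'.
Proof.
  intros He. unfold gap, invdist2. pose proof (invdist_pos eps p He). pose proof (invdist_pos eps p' He).
  repeat apply Rplus_le_le_0_compat; try apply Rabs_pos; apply Rmult_le_pos; try apply Rabs_pos; lra.
Qed.

Lemma lip_const eps1 K (c : R) : lip (admissible eps1 K) unit_weight (fun _ _ _ => c).
Proof.
  exists (Rabs c). split; [apply Rabs_pos|]. intros eps p v p' v' [He _] _. unfold unit_weight.
  rewrite Rminus_diag, Rabs_R0. pose proof (gap_nonneg eps p v p' v' (proj1 He)).
  repeat split; try lra. apply Rmult_le_pos; [apply Rabs_pos|lra].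
Qed.

Lemma lip_of_gap eps1 K (f : R -> R5 -> R5 -> R) (C D : R) :
  0 <= C -> 0 <= D ->
  (forall eps p v, admissible eps1 K eps p v -> Rabs (f eps p v) <= C) ->
  (forall eps p v p' v', admissible eps1 K eps p v -> admissible eps1 K eps p' v' ->
     Rabs (f eps p v - f eps p' v') <= D * gap eps p v p' v') ->
  lip (admissible eps1 K) unit_weight f.
Proof.
  intros HC HD Hb Hl. exists (C + D). split; [lra|]. intros eps p v p' v' Hp Hp'.
  pose proof (Hb _ _ _ Hp). pose proof (Hb _ _ _ Hp'). pose proof (Hl _ _ _ _ _ Hp Hp').
  destruct Hp as [He _]. pose proof (gap_nonneg eps p v p' v' (proj1 He)). unfold unit_weight.
  repeat split; try lra. nra.
Qed.

Lemma gap_components (eps : R) (p v p' v' : R5) : 0 < eps ->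
  let g := gap eps p v p' v' in
  invdist2 eps p p' * Rabs (cU p - cU p') <= g /\ Rabs (cU v - cU v') <= g /\
  Rabs (cZ2 p - cZ2 p') + Rabs (cZ3 p - cZ3 p') + Rabs (cZ4 p - cZ4 p') <= g /\
  Rabs (cZ2 v - cZ2 v') + Rabs (cZ3 v - cZ3 v') + Rabs (cZ4 v - cZ4 v') <= g /\
  eps * Rabs (cV p - cV p') <= g.
Proof.
  intros He g. unfold g, gap.
  assert (0 <= invdist2 eps p p' * Rabs (cU p - cU p')).
  { apply Rmult_le_pos; [|apply Rabs_pos]. unfold invdist2.
    pose proof (invdist_pos eps p He). pose proof (invdist_pos eps p' He). lra. }
  assert (0 <= eps * Rabs (cV p - cV p')) by (apply Rmult_le_pos; [lra|apply Rabs_pos]).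
  pose proof (Rabs_pos (cU v - cU v')).
  pose proof (Rabs_pos (cZ2 p - cZ2 p')). pose proof (Rabs_pos (cZ3 p - cZ3 p')).
  pose proof (Rabs_pos (cZ4 p - cZ4 p')). pose proof (Rabs_pos (cZ2 v - cZ2 v')).
  pose proof (Rabs_pos (cZ3 v - cZ3 v')). pose proof (Rabs_pos (cZ4 v - cZ4 v')).
  repeat split; lra.
Qed.

Lemma lip_Z eps1 K : 0 <= K ->
  let P := admissible eps1 K in
  (lip P unit_weight (fun _ p _ => cZ2 p) /\ lip P unit_weight (fun _ p _ => cZ3 p) /\
   lip P unit_weight (fun _ p _ => cZ4 p)) /\
  (lip P unit_weight (fun _ _ v => cZ2 v) /\ lip P unit_weight (fun _ _ v => cZ3 v) /\
   lip P unit_weight (fun _ _ v => cZ4 v)) /\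
  lip P unit_weight (fun _ _ v => cU v).
Proof.
  intros HK P.
  repeat split; apply lip_of_gap with (C := K) (D := 1); try lra;
    try (intros eps p v (_ & (? & ? & ? & ? & ?) & (? & ? & ? & ?)); assumption);
    intros eps p v p' v' [[He _] _] _;
    destruct (gap_components eps p v p' v' He) as (_ & G1 & G2 & G3 & _);
    pose proof (Rabs_pos (cZ2 p - cZ2 p')); pose proof (Rabs_pos (cZ3 p - cZ3 p'));
    pose proof (Rabs_pos (cZ4 p - cZ4 p')); pose proof (Rabs_pos (cZ2 v - cZ2 v'));
    pose proof (Rabs_pos (cZ3 v - cZ3 v')); pose proof (Rabs_pos (cZ4 v - cZ4 v')); lra.
Qed.

Lemma lip_eps_V eps1 K : 0 <= K -> eps1 <= 1 ->
  lip (admissible eps1 K) unit_weight (fun eps p _ => eps * cV p).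
Proof.
  intros HK He1. apply lip_of_gap with (C := K) (D := 1); try lra.
  - intros eps p v (He & (_ & Hp & _) & _). rewrite Rabs_mult, Rabs_right by lra.
    pose proof (Rabs_pos (cV p)). nra.
  - intros eps p v p' v' [[He _] _] _.
    destruct (gap_components eps p v p' v' He) as (_ & _ & _ & _ & G).
    rewrite <- Rmult_minus_distr_l, Rabs_mult, (Rabs_right eps) by lra. lra.
Qed.

Lemma lip_eps eps1 K : eps1 <= 1 ->
  lip (admissible eps1 K) unit_weight (fun eps _ _ => eps).
Proof.
  intros He1. apply lip_of_gap with (C := 1) (D := 1); try lra.
  - intros eps p v (He & _). rewrite Rabs_right; lra.
  - intros eps p v p' v' [[He _] _] _. pose proof (gap_nonneg eps p v p' v' He).
    rewrite Rminus_diag, Rabs_R0. lra.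
Qed.

Lemma invdist_lower_bound (eps K : R) (p : R5) :
  0 < eps <= 1 -> Rabs (cU p) <= K -> / (1 + K) <= invdist eps p.
Proof.
  intros He Hp. pose proof (Rabs_pos (cU p)). unfold invdist.
  apply Rinv_le_contravar; [apply sqrt_sqr_plus_sqr_pos; lra|].
  rewrite <- (sqrt_Rsqr (1 + K)) by lra. apply sqrt_le_1_alt. unfold Rsqr.
  rewrite <- (pow2_abs (cU p)). nra.
Qed.

Lemma lip_U eps1 K : 0 <= K -> eps1 <= 1 -> lip (admissible eps1 K) unit_weight (fun _ p _ => cU p).
Proof.
  intros HK He1. apply lip_of_gap with (C := K) (D := 1 + K); try lra.
  - intros eps p v (_ & Hp & _). apply Hp.
  - intros eps p v p' v' (He & (HU & _) & _) _.
    destruct (gap_components eps p v p' v' (proj1 He)) as (G & _).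
    assert (Hl : / (1 + K) <= invdist eps p) by (apply invdist_lower_bound; [lra|assumption]).
    pose proof (invdist_pos eps p' (proj1 He)) as Hpos.
    assert (H1 : (1 + K) * / (1 + K) <= (1 + K) * invdist eps p) by (apply Rmult_le_compat_l; lra).
    rewrite Rinv_r in H1 by lra.
    apply Rle_trans with ((1 + K) * (invdist2 eps p p' * Rabs (cU p - cU p')));
      [|apply Rmult_le_compat_l; lra].
    rewrite <- Rmult_assoc. rewrite <- (Rmult_1_l (Rabs (cU p - cU p'))) at 1.
    apply Rmult_le_compat_r; [apply Rabs_pos|]. unfold invdist2. nra.
Qed.

(** On a bounded region [mu <= 1 + K], so regular terms may be counted among the singular ones. *)
Lemma lip_unit_weight eps1 K (f : R -> R5 -> R5 -> R) : 0 <= K -> eps1 <= 1 ->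
  lip (admissible eps1 K) unit_weight f -> lip (admissible eps1 K) invdist2 f.
Proof.
  intros HK He1 [C [HC H]]. exists (C * (1 + K)). split; [apply Rmult_le_pos; lra|].
  intros eps p v p' v' Hp Hp'. destruct (H _ _ _ _ _ Hp Hp') as (F1 & F2 & F3).
  destruct Hp as (He & (HU & _) & _). unfold unit_weight in *.
  pose proof (invdist_lower_bound eps K p ltac:(lra) HU) as Hl.
  pose proof (invdist_pos eps p' (proj1 He)). pose proof (gap_nonneg eps p v p' v' (proj1 He)).
  assert (L : 1 <= (1 + K) * invdist2 eps p p').
  { assert ((1 + K) * / (1 + K) <= (1 + K) * invdist eps p) by (apply Rmult_le_compat_l; lra).
    rewrite Rinv_r in H2 by lra. unfold invdist2. nra. }
  assert (C * 1 <= C * ((1 + K) * invdist2 eps p p')) by (apply Rmult_le_compat_l; lra).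
  repeat split; try lra.
  eapply Rle_trans; [exact F3|].
  replace (C * (1 + K) * (invdist2 eps p p' * gap eps p v p' v'))
    with ((C * ((1 + K) * invdist2 eps p p')) * gap eps p v p' v') by ring.
  rewrite <- Rmult_assoc. apply Rmult_le_compat_r; lra.
Qed.

Lemma lip_evalZ eps1 K (f : R -> R -> R -> R) :
  box_bounded f -> box_lipschitz f -> lip (admissible eps1 K) unit_weight (fun _ p _ => evalZ f p).
Proof.
  intros Hb Hl. destruct (Hb K) as [C [HC Bd]]. destruct (Hl K) as [D [HD Ld]].
  apply lip_of_gap with (C := C) (D := D); try assumption.
  - intros eps p v (_ & (_ & _ & H2 & H3 & H4) & _). apply Bd; assumption.
  - intros eps p v p' v' Hp Hp'.
    pose proof Hp as (_ & (_ & _ & H2 & H3 & H4) & _). pose proof Hp' as (_ & (_ & _ & H2' & H3' & H4') & _).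
    eapply Rle_trans; [apply Ld; assumption|]. apply Rmult_le_compat_l; [assumption|].
    apply (gap_components eps p v p' v' (proj1 (proj1 Hp))).
Qed.

Lemma lip_inv eps1 K (f : R -> R5 -> R5 -> R) (m : R) : 0 < m ->
  lip (admissible eps1 K) unit_weight f ->
  (forall eps p v, admissible eps1 K eps p v -> m <= Rabs (f eps p v)) ->
  lip (admissible eps1 K) unit_weight (fun eps p v => / f eps p v).
Proof.
  intros Hm [C [HC H]] Hlow.
  assert (Hmi : 0 < / m) by (apply Rinv_0_lt_compat; assumption).
  assert (Hin : forall eps p v, admissible eps1 K eps p v -> Rabs (/ f eps p v) <= / m).
  { intros eps p v Hp. rewrite Rabs_inv. apply Rinv_le_contravar; auto. }
  apply lip_of_gap with (C := / m) (D := C * (/ m * / m)); [lra| | |].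
  - apply Rmult_le_pos; [assumption|]. apply Rmult_le_pos; lra.
  - apply Hin.
  - intros eps p v p' v' Hp Hp'. destruct (H _ _ _ _ _ Hp Hp') as (_ & _ & F3).
    unfold unit_weight in F3. rewrite Rmult_1_l in F3.
    pose proof (Hlow _ _ _ Hp) as L1. pose proof (Hlow _ _ _ Hp') as L2.
    assert (f eps p v <> 0) by (intro Z; rewrite Z, Rabs_R0 in L1; lra).
    assert (f eps p' v' <> 0) by (intro Z; rewrite Z, Rabs_R0 in L2; lra).
    replace (/ f eps p v - / f eps p' v')
      with ((- (f eps p v - f eps p' v')) * (/ f eps p v * / f eps p' v')) by (field; split; assumption).
    replace (C * (/ m * / m) * gap eps p v p' v') with ((C * gap eps p v p' v') * (/ m * / m)) by ring.
    apply Rabs_mult_le; [now rewrite Rabs_Ropp|]. apply Rabs_mult_le; apply Hin; assumption.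
Qed.

Lemma zone_weight_invdist (eps : R) (p : R5) : 0 < eps -> zone_weight eps p = (eps * invdist eps p) ^ 2.
Proof.
  intros He. unfold zone_weight, invdist. rewrite Rpow_mult_distr, pow_inv, pow2_sqrt.
  - assert (0 < eps ^ 2) by (apply pow2_gt_0; lra). pose proof (pow2_ge_0 (cU p)).
    field. repeat split; try lra; nra.
  - pose proof (pow2_ge_0 (cU p)). pose proof (pow2_ge_0 eps). lra.
Qed.

Lemma eps_invdist_le_1 (eps : R) (p : R5) : 0 < eps -> eps * invdist eps p <= 1.
Proof.
  intros He. unfold invdist. pose proof (sqrt_sqr_plus_sqr_pos eps (cU p) He).
  apply Rmult_le_reg_r with (sqrt (eps ^ 2 + cU p ^ 2)); [assumption|].
  rewrite Rmult_assoc, Rinv_l, Rmult_1_r, Rmult_1_l by lra.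
  rewrite <- (sqrt_Rsqr eps) at 1 by lra. apply sqrt_le_1_alt. unfold Rsqr.
  pose proof (pow2_ge_0 (cU p)). lra.
Qed.

(** The source of the rate [1 / mu]. The zone weight equals [(eps / mu) ^ 2], so [f(x) / eps] is
    bounded by [eps / mu ^ 2 <= 1 / mu]. Its variation is of order [|U - U'|] times the sum of the
    two [1 / mu ^ 2]; one factor [invdist2] is kept as rate, and the other is absorbed by the weight
    of [|U - U'|] in [gap]. *)
Lemma lip_cutoff_scaled eps1 K (f : R -> R) :
  cutoff f -> lip (admissible eps1 K) invdist2 (fun eps p _ => / eps * f (cU p / eps)).
Proof.
  intros Hf. destruct (cutoff_decay f Hf) as [C [HC Hd]].
  destruct (cutoff_lipschitz_decay f Hf) as [D [HD Hl]].
  exists (C + D). split; [lra|]. intros eps p v p' v' [He _] _. destruct He as [He _].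
  assert (Hie : 0 < / eps) by (apply Rinv_0_lt_compat; lra).
  pose proof (invdist_pos eps p He) as I1. pose proof (invdist_pos eps p' He) as I2.
  assert (HB : forall r, Rabs (/ eps * f (cU r / eps)) <= C * invdist eps r).
  { intro r. rewrite Rabs_mult, Rabs_right by lra.
    pose proof (invdist_pos eps r He). pose proof (eps_invdist_le_1 eps r He).
    specialize (Hd (cU r / eps)). change (Rabs (f (cU r / eps)) <= C * zone_weight eps r) in Hd.
    rewrite (zone_weight_invdist eps r He) in Hd.
    replace (C * invdist eps r) with (/ eps * (C * (eps * invdist eps r))) by (field; lra).
    apply Rmult_le_compat_l; [lra|]. eapply Rle_trans; [exact Hd|].
    apply Rmult_le_compat_l; [assumption|].
    assert (0 <= eps * invdist eps r) by (apply Rmult_le_pos; lra). nra. }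
  pose proof (HB p) as B1. pose proof (HB p') as B2. unfold invdist2 at 1 2.
  assert (0 <= C * invdist eps p) by (apply Rmult_le_pos; lra).
  assert (0 <= C * invdist eps p') by (apply Rmult_le_pos; lra).
  assert (0 <= D * invdist eps p) by (apply Rmult_le_pos; lra).
  assert (0 <= D * invdist eps p') by (apply Rmult_le_pos; lra).
  split; [lra|]. split; [lra|].
  rewrite <- Rmult_minus_distr_l, Rabs_mult, (Rabs_right (/ eps)) by lra.
  specialize (Hl (cU p / eps) (cU p' / eps)).
  change (/ (1 + (cU p / eps) ^ 2)) with (zone_weight eps p) in Hl.
  change (/ (1 + (cU p' / eps) ^ 2)) with (zone_weight eps p') in Hl.
  rewrite (zone_weight_invdist eps p He), (zone_weight_invdist eps p' He) in Hl.
  replace (cU p / eps - cU p' / eps) with ((cU p - cU p') * / eps) in Hl by (field; lra).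
  rewrite Rabs_mult, (Rabs_right (/ eps)) in Hl by lra.
  apply Rmult_le_compat_l with (r := / eps) in Hl; [|lra].
  eapply Rle_trans; [exact Hl|].
  pose proof (proj1 (gap_components eps p v p' v' He)) as G. pose proof (gap_nonneg eps p v p' v' He) as G0.
  replace (/ eps * (D * (Rabs (cU p - cU p') * / eps) * ((eps * invdist eps p) ^ 2 + (eps * invdist eps p') ^ 2)))
    with (D * ((invdist eps p ^ 2 + invdist eps p' ^ 2) * Rabs (cU p - cU p'))) by (field; lra).
  pose proof (Rabs_pos (cU p - cU p')) as U0.
  assert (S : (invdist eps p ^ 2 + invdist eps p' ^ 2) * Rabs (cU p - cU p')
              <= invdist2 eps p p' * gap eps p v p' v').
  { apply Rle_trans with (invdist2 eps p p' * (invdist2 eps p p' * Rabs (cU p - cU p'))).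
    - rewrite <- Rmult_assoc. apply Rmult_le_compat_r; [assumption|]. unfold invdist2. nra.
    - apply Rmult_le_compat_l; [unfold invdist2; lra|assumption]. }
  assert (0 <= invdist2 eps p p' * gap eps p v p' v') by (apply Rmult_le_pos; [unfold invdist2; lra|assumption]).
  apply Rle_trans with (D * (invdist2 eps p p' * gap eps p v p' v')); [apply Rmult_le_compat_l; assumption|].
  nra.
Qed.

(** Without the prefactor [1 / eps] one factor [eps / mu <= 1] is to spare, and the weighted
    difference of [U] in [gap] suffices. *)
Lemma lip_cutoff eps1 K (f : R -> R) :
  cutoff f -> lip (admissible eps1 K) unit_weight (fun eps p _ => f (cU p / eps)).
Proof.
  intros Hf. destruct (cutoff_lipschitz_decay f Hf) as [D [HD Hl]].
  destruct Hf as [_ [C [HC [Hb _]]]].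
  apply lip_of_gap with (C := C) (D := D); try assumption; [intros; apply Hb|].
  intros eps p v p' v' [He _] _. destruct He as [He _].
  assert (Hie : 0 < / eps) by (apply Rinv_0_lt_compat; lra).
  pose proof (invdist_pos eps p He) as I1. pose proof (invdist_pos eps p' He) as I2.
  specialize (Hl (cU p / eps) (cU p' / eps)).
  change (/ (1 + (cU p / eps) ^ 2)) with (zone_weight eps p) in Hl.
  change (/ (1 + (cU p' / eps) ^ 2)) with (zone_weight eps p') in Hl.
  rewrite (zone_weight_invdist eps p He), (zone_weight_invdist eps p' He) in Hl.
  replace (cU p / eps - cU p' / eps) with ((cU p - cU p') * / eps) in Hl by (field; lra).
  rewrite Rabs_mult, (Rabs_right (/ eps)) in Hl by lra.
  eapply Rle_trans; [exact Hl|].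
  replace (D * (Rabs (cU p - cU p') * / eps) * ((eps * invdist eps p) ^ 2 + (eps * invdist eps p') ^ 2))
    with (D * (((eps * invdist eps p) * invdist eps p + (eps * invdist eps p') * invdist eps p')
               * Rabs (cU p - cU p'))) by (field; lra).
  apply Rmult_le_compat_l; [assumption|].
  eapply Rle_trans; [|exact (proj1 (gap_components eps p v p' v' He))].
  apply Rmult_le_compat_r; [apply Rabs_pos|]. unfold invdist2.
  pose proof (eps_invdist_le_1 eps p He). pose proof (eps_invdist_le_1 eps p' He). nra.
Qed.

Lemma acc_lipschitz (sigma a e : R) (H : R -> R -> R -> R) (rho : R -> R) (K : R) :
  sigma = 1 \/ sigma = -1 -> 0 < a -> regular_profile H rho -> 0 <= K ->
  exists eps1 C, 0 < eps1 /\ 0 <= C /\ forall eps p v p' v',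
    admissible eps1 K eps p v -> admissible eps1 K eps p' v' ->
    let A := acc sigma a e H rho eps p v in
    let A' := acc sigma a e H rho eps p' v' in
    let X := C * (invdist2 eps p p' * gap eps p v p' v') in
    Rabs (cU A - cU A') <= X /\ eps * Rabs (cV A - cV A') <= X /\
    Rabs (cZ2 A - cZ2 A') <= X /\ Rabs (cZ3 A - cZ3 A') <= X /\ Rabs (cZ4 A - cZ4 A') <= X.
Proof.
  intros Hs Ha Hreg HK.
  destruct (normN_lower_bound sigma a H rho K Hs Ha Hreg) as [eps0 [He0 HN]].
  destruct Hreg as ((BH & B2 & B3 & B4) & (LH & L2 & L3 & L4) & Hr & Hr').
  set (eps1 := Rmin eps0 1).
  assert (He1 : 0 < eps1) by (apply Rmin_glb_lt; lra).
  assert (Hle1 : eps1 <= 1) by apply Rmin_r.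
  assert (Hle0 : eps1 <= eps0) by apply Rmin_l.
  assert (Ha2 : 0 < a ^ 2) by (apply pow2_gt_0; lra).
  set (P := admissible eps1 K).
  assert (OH : lip P unit_weight (fun _ p _ => evalZ H p)) by (apply lip_evalZ; assumption).
  assert (O2 : lip P unit_weight (fun _ p _ => evalZ (dH2 H) p)) by (apply lip_evalZ; assumption).
  assert (O3 : lip P unit_weight (fun _ p _ => evalZ (dH3 H) p)) by (apply lip_evalZ; assumption).
  assert (O4 : lip P unit_weight (fun _ p _ => evalZ (dH4 H) p)) by (apply lip_evalZ; assumption).
  destruct (lip_Z eps1 K HK) as ((OZ2 & OZ3 & OZ4) & (OW2 & OW3 & OW4) & OV).
  fold P in OZ2, OZ3, OZ4, OW2, OW3, OW4, OV.
  assert (OU : lip P unit_weight (fun _ p _ => cU p)) by (apply lip_U; assumption).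
  assert (Oe : lip P unit_weight (fun eps _ _ => eps)) by (apply lip_eps; assumption).
  assert (OeV : lip P unit_weight (fun eps p _ => eps * cV p)) by (apply lip_eps_V; assumption).
  assert (Oc : forall c, lip P unit_weight (fun _ _ _ => c)) by (intro; apply lip_const).
  assert (OV2 : lip P unit_weight (fun _ _ v => cU v ^ 2)).
  { eapply lip_ext; [apply (lip_mult P _ _ _ OV OV)|]. intros. cbv beta. ring. }
  assert (OS : lip P unit_weight (fun _ p _ => dHdot H p p)).
  { unfold dHdot. repeat apply lip_plus; apply lip_mult; assumption. }
  assert (Ow : lip P unit_weight (fun _ p v => dHdot H p v)).
  { unfold dHdot. repeat apply lip_plus; apply lip_mult; assumption. }
  pose proof (lip_cutoff eps1 K _ Hr) as R0.
  pose proof (lip_cutoff eps1 K _ (cutoff_mult_id _ Hr)) as R1.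
  pose proof (lip_cutoff eps1 K _ (cutoff_mult_id _ (cutoff_mult_id _ Hr))) as R2.
  pose proof (lip_cutoff_scaled eps1 K _ Hr) as S0.
  pose proof (lip_cutoff_scaled eps1 K _ Hr') as S0'.
  pose proof (lip_cutoff_scaled eps1 K _ (cutoff_mult_id _ Hr')) as S1'.
  cbv beta in R1, R2, S1'. fold P in R0, R1, R2, S0, S0', S1'.
  assert (ON : lip P unit_weight (fun eps p _ => / normN sigma a H rho eps p)).
  { apply (lip_inv eps1 K (fun eps p _ => normN sigma a H rho eps p) (a ^ 2 / 2)); [lra| |].
    - unfold normN. cbv zeta. apply lip_minus; [apply Oc|]. apply lip_mult; [|exact OH].
      apply lip_mult; [exact Oe|exact R2].
    - intros eps p v (He & Hp & _). apply HN; [lra|assumption]. }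
  assert (OP : lip P invdist2 (fun eps p v => Phi e H rho eps p v)).
  { eapply lip_ext with (f := fun eps p v => e
      + ((/ eps * rho (cU p / eps)) * (/ 2 * cU v ^ 2 * dHdot H p p)
         - ((/ eps * (cU p / eps * Derive rho (cU p / eps))) * (/ 2 * cU v ^ 2 * evalZ H p)
            + (/ eps * rho (cU p / eps)) * (cU v ^ 2 * evalZ H p)))
      - cU v * (cU p / eps * rho (cU p / eps)) * dHdot H p v).
    - apply lip_minus; [apply lip_plus|].
      + apply lip_unit_weight; [assumption|assumption|apply Oc].
      + apply lip_minus; [|apply lip_plus].
        * apply lip_mult_r; [exact S0|]. apply lip_mult; [|exact OS]. apply lip_mult; [apply Oc|exact OV2].
        * apply lip_mult_r; [exact S1'|]. apply lip_mult; [|exact OH]. apply lip_mult; [apply Oc|exact OV2].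
        * apply lip_mult_r; [exact S0|]. apply lip_mult; [exact OV2|exact OH].
      + apply lip_unit_weight; [assumption|assumption|].
        apply lip_mult; [|exact Ow]. apply lip_mult; [exact OV|exact R1].
    - intros eps p v (He & _). unfold Phi. cbv zeta. ring. }
  assert (OF : lip P invdist2 (fun eps p v => Phi e H rho eps p v * / normN sigma a H rho eps p)).
  { apply lip_mult_r; assumption. }
  assert (AU : lip P invdist2 (fun eps p v => cU (acc sigma a e H rho eps p v))).
  { unfold acc. cbn [cU]. apply lip_opp, lip_mult_r; assumption. }
  assert (AZ : forall c f (z : R5 -> R), lip P unit_weight (fun _ p _ => evalZ f p) ->
     lip P unit_weight (fun _ p _ => z p) ->
     lip P invdist2 (fun eps p v => c * evalZ f p * (/ eps * rho (cU p / eps)) * cU v ^ 2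
            - Phi e H rho eps p v * / normN sigma a H rho eps p * z p)).
  { intros c f z Of Oz. apply lip_minus; [|apply lip_mult_r; assumption].
    apply lip_mult_r; [|exact OV2]. apply lip_mult; [|exact S0]. apply lip_mult; [apply Oc|exact Of]. }
  (* Multiplication by [eps] turns [eps^-2 rho'(x)] into an admissible singular factor and makes
     [rho(x) / eps] regular; it also pairs [cV p] with the [eps] that it carries in [gap]. *)
  assert (AV : lip P invdist2 (fun eps p v => eps * cV (acc sigma a e H rho eps p v))).
  { eapply lip_ext with (f := fun eps p v =>
      / 2 * evalZ H p * (/ eps * Derive rho (cU p / eps)) * cU v ^ 2
      + rho (cU p / eps) * cU v * dHdot H p v
      - Phi e H rho eps p v * / normN sigma a H rho eps p
        * (eps * cV p + eps * evalZ H p * (cU p / eps * rho (cU p / eps)))).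
    - apply lip_minus; [apply lip_plus|].
      + apply lip_mult_r; [|exact OV2]. apply lip_mult; [|exact S0']. apply lip_mult; [apply Oc|exact OH].
      + apply lip_unit_weight; [assumption|assumption|].
        apply lip_mult; [|exact Ow]. apply lip_mult; [exact R0|exact OV].
      + apply lip_mult_r; [exact OF|]. apply lip_plus; [exact OeV|].
        apply lip_mult; [|exact R1]. apply lip_mult; [exact Oe|exact OH].
    - intros eps p v (He & Hp & _).
      assert (normN sigma a H rho eps p <> 0).
      { intro Z. specialize (HN eps p ltac:(lra) Hp). rewrite Z, Rabs_R0 in HN. lra. }
      unfold acc. cbn [cV]. cbv zeta. field. split; try assumption; lra. }
  destruct AU as [C1 [HC1 E1]]. destruct AV as [C5 [HC5 E5]].
  destruct (AZ (/ 2) (dH2 H) cZ2 O2 OZ2) as [C2 [HC2 E2]].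
  destruct (AZ (/ 2) (dH3 H) cZ3 O3 OZ3) as [C3 [HC3 E3]].
  destruct (AZ (sigma / 2) (dH4 H) cZ4 O4 OZ4) as [C4 [HC4 E4]].
  exists eps1, (C1 + C2 + C3 + C4 + C5). split; [assumption|]. split; [lra|].
  intros eps p v p' v' Hp Hp'. cbv zeta.
  destruct (E1 _ _ _ _ _ Hp Hp') as (_ & _ & D1). destruct (E2 _ _ _ _ _ Hp Hp') as (_ & _ & D2).
  destruct (E3 _ _ _ _ _ Hp Hp') as (_ & _ & D3). destruct (E4 _ _ _ _ _ Hp Hp') as (_ & _ & D4).
  destruct (E5 _ _ _ _ _ Hp Hp') as (_ & _ & D5).
  destruct Hp as (He & _).
  assert (HX : 0 <= invdist2 eps p p' * gap eps p v p' v').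
  { apply Rmult_le_pos; [|apply gap_nonneg; lra]. unfold invdist2.
    pose proof (invdist_pos eps p (proj1 He)). pose proof (invdist_pos eps p' (proj1 He)). lra. }
  set (X := invdist2 eps p p' * gap eps p v p' v') in *.
  split; [|split; [|split; [|split]]].
  - eapply Rle_trans; [exact D1|]. apply Rmult_le_compat_r; lra.
  - rewrite <- Rmult_minus_distr_l, Rabs_mult, (Rabs_right eps) in D5 by lra.
    eapply Rle_trans; [exact D5|]. apply Rmult_le_compat_r; lra.
  - eapply Rle_trans; [exact D2|]. apply Rmult_le_compat_r; lra.
  - eapply Rle_trans; [exact D3|]. apply Rmult_le_compat_r; lra.
  - eapply Rle_trans; [exact D4|]. apply Rmult_le_compat_r; lra.
Qed.

(** * Energy of the difference of two solutions *)

Definition invsq (eps : R) (p : R5) : R := / (eps ^ 2 + cU p ^ 2).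

(** A differentiable, quadratic counterpart of [gap], in which [invdist] becomes its square [invsq].
    The difference of the [V]-velocities is added because it drives the difference of the
    [V]-components. *)
Definition energy (eps : R) (p v p' v' : R5) : R :=
  (cU p - cU p') ^ 2 * (invsq eps p + invsq eps p') + (cU v - cU v') ^ 2
  + ((cZ2 p - cZ2 p') ^ 2 + (cZ3 p - cZ3 p') ^ 2 + (cZ4 p - cZ4 p') ^ 2)
  + ((cZ2 v - cZ2 v') ^ 2 + (cZ3 v - cZ3 v') ^ 2 + (cZ4 v - cZ4 v') ^ 2)
  + eps ^ 2 * ((cV p - cV p') ^ 2 + (cV v - cV v') ^ 2).

Definition energy_rate (eps : R) (p v A p' v' A' : R5) : R :=
  (2 * (cU p - cU p') * (cU v - cU v') * (invsq eps p + invsq eps p')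
   + (cU p - cU p') ^ 2 * (- (2 * cU p * cU v) * invsq eps p ^ 2 + - (2 * cU p' * cU v') * invsq eps p' ^ 2))
  + 2 * (cU v - cU v') * (cU A - cU A')
  + (2 * (cZ2 p - cZ2 p') * (cZ2 v - cZ2 v') + 2 * (cZ3 p - cZ3 p') * (cZ3 v - cZ3 v')
     + 2 * (cZ4 p - cZ4 p') * (cZ4 v - cZ4 v'))
  + (2 * (cZ2 v - cZ2 v') * (cZ2 A - cZ2 A') + 2 * (cZ3 v - cZ3 v') * (cZ3 A - cZ3 A')
     + 2 * (cZ4 v - cZ4 v') * (cZ4 A - cZ4 A'))
  + eps ^ 2 * (2 * (cV p - cV p') * (cV v - cV v') + 2 * (cV v - cV v') * (cV A - cV A')).

Definition is_derive5 (c : R -> R5) (t : R) (d : R5) : Prop :=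
  is_derive (fun s => cU (c s)) t (cU d) /\ is_derive (fun s => cV (c s)) t (cV d) /\
  is_derive (fun s => cZ2 (c s)) t (cZ2 d) /\ is_derive (fun s => cZ3 (c s)) t (cZ3 d) /\
  is_derive (fun s => cZ4 (c s)) t (cZ4 d).

Definition add5 (p q : R5) : R5 :=
  mk5 (cU p + cU q) (cV p + cV q) (cZ2 p + cZ2 q) (cZ3 p + cZ3 q) (cZ4 p + cZ4 q).

Lemma is_derive_sqr_diff (f g : R -> R) (t f' g' : R) :
  is_derive f t f' -> is_derive g t g' ->
  is_derive (fun s => (f s - g s) ^ 2) t (2 * (f t - g t) * (f' - g')).
Proof.
  intros Hf Hg.
  replace (2 * (f t - g t) * (f' - g')) with ((f' - g') * (f t - g t) + (f t - g t) * (f' - g')) by ring.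
  apply is_derive_ext with (f := fun s => (f s - g s) * (f s - g s)); [intro; cbn; ring|].
  assert (Hd : is_derive (fun s => f s - g s) t (f' - g')) by (apply (is_derive_minus f g); assumption).
  apply (is_derive_mult (fun s => f s - g s) (fun s => f s - g s)); [exact Hd|exact Hd|].
  intros; apply Rmult_comm.
Qed.

Lemma sqr_plus_sqr_pos (eps u : R) : 0 < eps -> 0 < eps ^ 2 + u ^ 2.
Proof.
  intros. pose proof (pow2_ge_0 u). assert (0 < eps ^ 2) by (apply pow2_gt_0; lra). lra.
Qed.

Lemma is_derive_invsq (eps : R) (p : R -> R5) (t u' : R) :
  0 < eps -> is_derive (fun s => cU (p s)) t u' ->
  is_derive (fun s => invsq eps (p s)) t (- (2 * cU (p t) * u') * invsq eps (p t) ^ 2).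
Proof.
  intros He Hu. pose proof (sqr_plus_sqr_pos eps (cU (p t)) He).
  replace (- (2 * cU (p t) * u') * invsq eps (p t) ^ 2)
    with (- (2 * cU (p t) * u') / (eps ^ 2 + cU (p t) ^ 2) ^ 2)
    by (unfold invsq; field; lra).
  apply (is_derive_inv (fun s => eps ^ 2 + cU (p s) ^ 2) t (2 * cU (p t) * u')); [|lra].
  replace (2 * cU (p t) * u') with (2 * (cU (p t) - 0) * (u' - 0)) by ring.
  apply is_derive_ext with (f := fun s => (cU (p s) - 0) ^ 2 + eps ^ 2).
  { intro s. cbn. ring. }
  replace (2 * (cU (p t) - 0) * (u' - 0)) with (2 * (cU (p t) - 0) * (u' - 0) + 0) by ring.
  apply (is_derive_plus (fun s => (cU (p s) - 0) ^ 2) (fun _ => eps ^ 2)).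
  - apply (is_derive_sqr_diff (fun s => cU (p s)) (fun _ => 0)); [exact Hu|apply @is_derive_const].
  - apply @is_derive_const.
Qed.

Lemma is_derive_Rplus (f g : R -> R) (t f' g' : R) :
  is_derive f t f' -> is_derive g t g' -> is_derive (fun s => f s + g s) t (f' + g').
Proof. apply (is_derive_plus f g). Qed.

Lemma is_derive_energy (eps : R) (p v p' v' : R -> R5) (A A' : R5) (t : R) :
  0 < eps -> is_derive5 p t (v t) -> is_derive5 v t A -> is_derive5 p' t (v' t) -> is_derive5 v' t A' ->
  is_derive (fun s => energy eps (p s) (v s) (p' s) (v' s)) t
    (energy_rate eps (p t) (v t) A (p' t) (v' t) A').
Proof.
  intros He (U1 & V1 & X1 & Y1 & Z1) (U2 & V2 & X2 & Y2 & Z2)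
    (U1' & V1' & X1' & Y1' & Z1') (U2' & V2' & X2' & Y2' & Z2').
  unfold energy, energy_rate.
  repeat match goal with
  | |- is_derive (fun s => (@?f s - @?g s) ^ 2) _ _ => apply (is_derive_sqr_diff f g); assumption
  | |- is_derive (fun s => _ + _) _ _ => apply is_derive_Rplus
  | |- is_derive (fun s => eps ^ 2 * _) _ _ => apply is_derive_scal
  end.
  apply (is_derive_mult (fun s => (cU (p s) - cU (p' s)) ^ 2) (fun s => invsq eps (p s) + invsq eps (p' s))).
  - apply (is_derive_sqr_diff (fun s => cU (p s)) (fun s => cU (p' s))); assumption.
  - apply is_derive_Rplus; apply is_derive_invsq; assumption.
  - intros; apply Rmult_comm.
Qed.

Lemma invsq_invdist (eps : R) (p : R5) : 0 < eps -> invsq eps p = invdist eps p ^ 2.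
Proof.
  intros He. unfold invsq, invdist. rewrite pow_inv, pow2_sqrt; [reflexivity|].
  left. apply sqr_plus_sqr_pos, He.
Qed.

Lemma Rabs_U_invdist_le_1 (eps : R) (p : R5) : 0 < eps -> Rabs (cU p) * invdist eps p <= 1.
Proof.
  intros He. unfold invdist. pose proof (sqrt_sqr_plus_sqr_pos eps (cU p) He).
  apply Rmult_le_reg_r with (sqrt (eps ^ 2 + cU p ^ 2)); [assumption|].
  rewrite Rmult_assoc, Rinv_l, Rmult_1_r, Rmult_1_l by lra.
  rewrite <- sqrt_Rsqr_abs. apply sqrt_le_1_alt. unfold Rsqr.
  pose proof (pow2_ge_0 eps). lra.
Qed.

Lemma energy_nonneg (eps : R) (p v p' v' : R5) : 0 < eps -> 0 <= energy eps p v p' v'.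
Proof.
  intros He. unfold energy.
  assert (0 < invsq eps p) by (apply Rinv_0_lt_compat, sqr_plus_sqr_pos, He).
  assert (0 < invsq eps p') by (apply Rinv_0_lt_compat, sqr_plus_sqr_pos, He).
  pose proof (pow2_ge_0 eps).
  repeat apply Rplus_le_le_0_compat; try apply pow2_ge_0;
    apply Rmult_le_pos; try apply pow2_ge_0; try lra.
  apply Rplus_le_le_0_compat; apply pow2_ge_0.
Qed.

(** The constant is 9 from Cauchy-Schwarz over nine summands, times 2 from
    [(i + j) ^ 2 <= 2 * (i ^ 2 + j ^ 2)] for the two inverse distances. *)
Lemma gap_sqr_le_energy (eps : R) (p v p' v' : R5) : 0 < eps ->
  gap eps p v p' v' ^ 2 <= 18 * energy eps p v p' v'.
Proof.
  intros He. unfold gap, energy. rewrite !invsq_invdist by assumption. unfold invdist2.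
  set (i := invdist eps p). set (j := invdist eps p').
  rewrite <- (pow2_abs (cU p - cU p')), <- (pow2_abs (cU v - cU v')), <- (pow2_abs (cZ2 p - cZ2 p')),
    <- (pow2_abs (cZ3 p - cZ3 p')), <- (pow2_abs (cZ4 p - cZ4 p')), <- (pow2_abs (cZ2 v - cZ2 v')),
    <- (pow2_abs (cZ3 v - cZ3 v')), <- (pow2_abs (cZ4 v - cZ4 v')), <- (pow2_abs (cV p - cV p')).
  set (u := Rabs (cU p - cU p')). set (b2 := Rabs (cU v - cU v')).
  set (b3 := Rabs (cZ2 p - cZ2 p')). set (b4 := Rabs (cZ3 p - cZ3 p')). set (b5 := Rabs (cZ4 p - cZ4 p')).
  set (b6 := Rabs (cZ2 v - cZ2 v')). set (b7 := Rabs (cZ3 v - cZ3 v')). set (b8 := Rabs (cZ4 v - cZ4 v')).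
  set (v0 := Rabs (cV p - cV p')).
  assert (CS : forall x1 x2 x3 x4 x5 x6 x7 x8 x9 : R,
    (x1 + x2 + (x3 + x4 + x5) + (x6 + x7 + x8) + x9) ^ 2
    <= 9 * (x1 ^ 2 + x2 ^ 2 + (x3 ^ 2 + x4 ^ 2 + x5 ^ 2) + (x6 ^ 2 + x7 ^ 2 + x8 ^ 2) + x9 ^ 2)).
  { clear. intros.
    assert (P : forall x y : R, 2 * x * y <= x ^ 2 + y ^ 2) by (intros; pose proof (pow2_ge_0 (x - y)); nra).
    pose proof (P x1 x2); pose proof (P x1 x3); pose proof (P x1 x4); pose proof (P x1 x5);
    pose proof (P x1 x6); pose proof (P x1 x7); pose proof (P x1 x8); pose proof (P x1 x9);
    pose proof (P x2 x3); pose proof (P x2 x4); pose proof (P x2 x5); pose proof (P x2 x6);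
    pose proof (P x2 x7); pose proof (P x2 x8); pose proof (P x2 x9);
    pose proof (P x3 x4); pose proof (P x3 x5); pose proof (P x3 x6); pose proof (P x3 x7);
    pose proof (P x3 x8); pose proof (P x3 x9); pose proof (P x4 x5); pose proof (P x4 x6);
    pose proof (P x4 x7); pose proof (P x4 x8); pose proof (P x4 x9); pose proof (P x5 x6);
    pose proof (P x5 x7); pose proof (P x5 x8); pose proof (P x5 x9); pose proof (P x6 x7);
    pose proof (P x6 x8); pose proof (P x6 x9); pose proof (P x7 x8); pose proof (P x7 x9);
    pose proof (P x8 x9). clear P. lra. }
  eapply Rle_trans; [apply CS|].
  assert (S1 : ((i + j) * u) ^ 2 <= 2 * (u ^ 2 * (i ^ 2 + j ^ 2))).
  { pose proof (pow2_ge_0 (i * u - j * u)). lra. }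
  assert (S2 : (eps * v0) ^ 2 = eps ^ 2 * v0 ^ 2) by ring.
  pose proof (pow2_ge_0 b2). pose proof (pow2_ge_0 b3). pose proof (pow2_ge_0 b4).
  pose proof (pow2_ge_0 b5). pose proof (pow2_ge_0 b6). pose proof (pow2_ge_0 b7).
  pose proof (pow2_ge_0 b8).
  assert (0 <= eps ^ 2 * v0 ^ 2) by (apply Rmult_le_pos; apply pow2_ge_0).
  assert (0 <= eps ^ 2 * (cV v - cV v') ^ 2) by (apply Rmult_le_pos; apply pow2_ge_0).
  lra.
Qed.

Lemma energy_components (eps : R) (p v p' v' : R5) : 0 < eps ->
  let Q := energy eps p v p' v' in
  (cU p - cU p') ^ 2 * (invsq eps p + invsq eps p') <= Q /\ (cU v - cU v') ^ 2 <= Q /\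
  (cZ2 p - cZ2 p') ^ 2 + (cZ3 p - cZ3 p') ^ 2 + (cZ4 p - cZ4 p') ^ 2
    + ((cZ2 v - cZ2 v') ^ 2 + (cZ3 v - cZ3 v') ^ 2 + (cZ4 v - cZ4 v') ^ 2) <= Q /\
  eps ^ 2 * ((cV p - cV p') ^ 2 + (cV v - cV v') ^ 2) <= Q /\
  (cU p - cU p') ^ 2 * (invsq eps p + invsq eps p') + (cU v - cU v') ^ 2 <= Q.
Proof.
  intros He Q. unfold Q, energy.
  assert (0 < invsq eps p) by (apply Rinv_0_lt_compat, sqr_plus_sqr_pos, He).
  assert (0 < invsq eps p') by (apply Rinv_0_lt_compat, sqr_plus_sqr_pos, He).
  assert (0 <= (cU p - cU p') ^ 2 * (invsq eps p + invsq eps p'))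
    by (apply Rmult_le_pos; [apply pow2_ge_0|lra]).
  assert (0 <= eps ^ 2 * ((cV p - cV p') ^ 2 + (cV v - cV v') ^ 2)).
  { apply Rmult_le_pos; [apply pow2_ge_0|apply Rplus_le_le_0_compat; apply pow2_ge_0]. }
  pose proof (pow2_ge_0 (cU v - cU v')).
  pose proof (pow2_ge_0 (cZ2 p - cZ2 p')). pose proof (pow2_ge_0 (cZ3 p - cZ3 p')).
  pose proof (pow2_ge_0 (cZ4 p - cZ4 p')). pose proof (pow2_ge_0 (cZ2 v - cZ2 v')).
  pose proof (pow2_ge_0 (cZ3 v - cZ3 v')). pose proof (pow2_ge_0 (cZ4 v - cZ4 v')).
  repeat split; lra.
Qed.

(** Differences of accelerations are handled by [acc_lipschitz]. The weight on [U - U'] moves with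
    the solutions, but its derivative [- 2 U U' / mu ^ 4] costs only a rate [2 * K / mu], because
    [|U| <= mu] and the velocity is bounded by [K]. The residuals [r], [r'] contribute the
    inhomogeneity [n ^ 2]. *)
Lemma energy_rate_bound (sigma a e : R) (H : R -> R -> R -> R) (rho : R -> R) (K : R) :
  sigma = 1 \/ sigma = -1 -> 0 < a -> regular_profile H rho -> 0 <= K ->
  exists eps1 C, 0 < eps1 /\ 0 <= C /\ forall eps p v p' v' r r' n,
    admissible eps1 K eps p v -> admissible eps1 K eps p' v' -> in_box n r -> in_box n r' ->
    energy_rate eps p v (add5 (acc sigma a e H rho eps p v) r)
                    p' v' (add5 (acc sigma a e H rho eps p' v') r')
    <= C * invdist2 eps p p' * (energy eps p v p' v' + n ^ 2).
Proof.
  intros Hs Ha Hreg HK.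
  destruct (acc_lipschitz sigma a e H rho K Hs Ha Hreg HK) as (eps0 & C & He0 & HC & HL).
  exists (Rmin eps0 1), (100 * C + 4 * K + 4 + 40 * (1 + K)).
  assert (Hm0 : Rmin eps0 1 <= eps0) by apply Rmin_l.
  assert (Hm1 : Rmin eps0 1 <= 1) by apply Rmin_r.
  split; [apply Rmin_glb_lt; lra|]. split; [lra|].
  intros eps p v p' v' r r' n Hp Hp' Hr Hr'.
  pose proof Hp as ((He & Hlt) & Hbox & Hvbox). pose proof Hp' as (_ & Hbox' & Hvbox').
  assert (Hq : admissible eps0 K eps p v) by (repeat split; try lra; apply Hbox || apply Hvbox).
  assert (Hq' : admissible eps0 K eps p' v') by (repeat split; try lra; apply Hbox' || apply Hvbox').
  destruct (HL _ _ _ _ _ Hq Hq') as (LU & LV & L2 & L3 & L4).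
  pose proof (energy_nonneg eps p v p' v' He) as HQ.
  pose proof (gap_sqr_le_energy eps p v p' v' He) as HG.
  pose proof (gap_nonneg eps p v p' v' He) as HG0.
  destruct (energy_components eps p v p' v' He) as (Q1 & Q2 & Q3 & Q4 & Q5).
  pose proof (invdist_pos eps p He) as I1. pose proof (invdist_pos eps p' He) as I2.
  pose proof (invdist_lower_bound eps K p ltac:(lra) (proj1 Hbox)) as Il.
  pose proof (Rabs_U_invdist_le_1 eps p He) as Ui. pose proof (Rabs_U_invdist_le_1 eps p' He) as Ui'.
  unfold energy_rate, add5. cbn [cU cV cZ2 cZ3 cZ4].
  set (A := acc sigma a e H rho eps p v) in *. set (A' := acc sigma a e H rho eps p' v') in *.
  set (Q := energy eps p v p' v') in *. set (g := gap eps p v p' v') in *.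
  assert (HL2 : invdist2 eps p p' = invdist eps p + invdist eps p') by reflexivity.
  set (L := invdist2 eps p p') in *.
  assert (HL0 : 0 < L) by lra.
  assert (HL1 : 1 <= (1 + K) * L).
  { assert ((1 + K) * / (1 + K) <= (1 + K) * L) by (apply Rmult_le_compat_l; lra).
    rewrite Rinv_r in H0; lra. }
  assert (Hn2 : 0 <= n ^ 2) by apply pow2_ge_0.
  assert (HCL : 0 <= C * L) by (apply Rmult_le_pos; lra).
  (* Here [19 = 1 + 18], from [2 |x| g <= x ^ 2 + g ^ 2] and [g ^ 2 <= 18 * Q]. Five components use
     this bound, which the [100 * C] of the final constant accommodates. *)
  assert (Hacc : forall x d s s', x ^ 2 <= Q -> Rabs d <= C * (L * g) -> Rabs s <= n -> Rabs s' <= n ->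
            2 * x * (d + (s - s')) <= 19 * (C * L) * Q + Q + 4 * n ^ 2).
  { intros x d s s' Hx Hd Hss Hss'.
    assert (T1 : 2 * (x * d) <= 19 * (C * L) * Q).
    { assert (Rabs (x * d) <= Rabs x * (C * (L * g))) by (apply Rabs_mult_le; lra).
      apply Rabs_le_between in H0.
      assert (2 * (Rabs x * g) <= 19 * Q).
      { pose proof (pow2_ge_0 (Rabs x - g)). pose proof (pow2_abs x). lra. }
      assert ((C * L) * (2 * (Rabs x * g)) <= (C * L) * (19 * Q)) by (apply Rmult_le_compat_l; lra).
      lra. }
    assert (T2 : 2 * (x * (s - s')) <= Q + 4 * n ^ 2).
    { assert (Rabs (s - s') <= 2 * n).
      { unfold Rminus. eapply Rle_trans; [apply Rabs_triang|]. rewrite Rabs_Ropp. lra. }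
      assert ((s - s') ^ 2 <= (2 * n) ^ 2).
      { rewrite <- pow2_abs. apply pow_incr. split; [apply Rabs_pos|assumption]. }
      pose proof (pow2_ge_0 (x - (s - s'))). lra. }
    lra. }
  destruct Hr as (r1 & r2 & r3 & r4 & r5). destruct Hr' as (r1' & r2' & r3' & r4' & r5').
  pose proof (pow2_ge_0 (cZ2 p - cZ2 p')) as sq2. pose proof (pow2_ge_0 (cZ3 p - cZ3 p')) as sq3.
  pose proof (pow2_ge_0 (cZ4 p - cZ4 p')) as sq4. pose proof (pow2_ge_0 (cZ2 v - cZ2 v')) as sw2.
  pose proof (pow2_ge_0 (cZ3 v - cZ3 v')) as sw3. pose proof (pow2_ge_0 (cZ4 v - cZ4 v')) as sw4.
  assert (BU : 2 * (cU v - cU v') * (cU A + cU r - (cU A' + cU r')) <= 19 * (C * L) * Q + Q + 4 * n ^ 2).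
  { replace (cU A + cU r - (cU A' + cU r')) with ((cU A - cU A') + (cU r - cU r')) by ring.
    apply Hacc; assumption. }
  assert (B2 : 2 * (cZ2 v - cZ2 v') * (cZ2 A + cZ2 r - (cZ2 A' + cZ2 r')) <= 19 * (C * L) * Q + Q + 4 * n ^ 2).
  { replace (cZ2 A + cZ2 r - (cZ2 A' + cZ2 r')) with ((cZ2 A - cZ2 A') + (cZ2 r - cZ2 r')) by ring.
    apply Hacc; try assumption. lra. }
  assert (B3 : 2 * (cZ3 v - cZ3 v') * (cZ3 A + cZ3 r - (cZ3 A' + cZ3 r')) <= 19 * (C * L) * Q + Q + 4 * n ^ 2).
  { replace (cZ3 A + cZ3 r - (cZ3 A' + cZ3 r')) with ((cZ3 A - cZ3 A') + (cZ3 r - cZ3 r')) by ring.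
    apply Hacc; try assumption. lra. }
  assert (B4 : 2 * (cZ4 v - cZ4 v') * (cZ4 A + cZ4 r - (cZ4 A' + cZ4 r')) <= 19 * (C * L) * Q + Q + 4 * n ^ 2).
  { replace (cZ4 A + cZ4 r - (cZ4 A' + cZ4 r')) with ((cZ4 A - cZ4 A') + (cZ4 r - cZ4 r')) by ring.
    apply Hacc; try assumption. lra. }
  assert (sV : 0 <= eps ^ 2 * (cV p - cV p') ^ 2) by (apply Rmult_le_pos; apply pow2_ge_0).
  assert (sV' : 0 <= eps ^ 2 * (cV v - cV v') ^ 2) by (apply Rmult_le_pos; apply pow2_ge_0).
  assert (Hsmall : forall s, Rabs s <= n -> Rabs (eps * s) <= n).
  { intros s Hss. rewrite Rabs_mult, Rabs_right by lra. pose proof (Rabs_pos s).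
    apply Rle_trans with (1 * Rabs s); [apply Rmult_le_compat_r|]; lra. }
  assert (BV : eps ^ 2 * (2 * (cV v - cV v') * (cV A + cV r - (cV A' + cV r')))
               <= 19 * (C * L) * Q + Q + 4 * n ^ 2).
  { replace (eps ^ 2 * (2 * (cV v - cV v') * (cV A + cV r - (cV A' + cV r'))))
      with (2 * (eps * (cV v - cV v')) * (eps * (cV A - cV A') + (eps * cV r - eps * cV r'))) by ring.
    apply Hacc; try (apply Hsmall; assumption).
    - rewrite Rpow_mult_distr. lra.
    - rewrite Rabs_mult, Rabs_right by lra. assumption. }
  assert (BVV : eps ^ 2 * (2 * (cV p - cV p') * (cV v - cV v')) <= Q).
  { assert (0 <= eps ^ 2 * ((cV p - cV p') - (cV v - cV v')) ^ 2) by (apply Rmult_le_pos; apply pow2_ge_0).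
    lra. }
  assert (BZ : 2 * (cZ2 p - cZ2 p') * (cZ2 v - cZ2 v') + 2 * (cZ3 p - cZ3 p') * (cZ3 v - cZ3 v')
     + 2 * (cZ4 p - cZ4 p') * (cZ4 v - cZ4 v') <= Q).
  { pose proof (pow2_ge_0 ((cZ2 p - cZ2 p') - (cZ2 v - cZ2 v'))).
    pose proof (pow2_ge_0 ((cZ3 p - cZ3 p') - (cZ3 v - cZ3 v'))).
    pose proof (pow2_ge_0 ((cZ4 p - cZ4 p') - (cZ4 v - cZ4 v'))). lra. }
  assert (BW : 2 * (cU p - cU p') * (cU v - cU v') * (invsq eps p + invsq eps p')
   + (cU p - cU p') ^ 2 * (- (2 * cU p * cU v) * invsq eps p ^ 2 + - (2 * cU p' * cU v') * invsq eps p' ^ 2)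
     <= (2 + 2 * K) * L * Q).
  { rewrite (invsq_invdist eps p He), (invsq_invdist eps p' He) in *.
    set (i := invdist eps p) in *. set (j := invdist eps p') in *.
    set (u := cU p - cU p') in *. set (w := cU v - cU v') in *.
    pose proof (pow2_ge_0 u) as u2. pose proof (pow2_ge_0 w) as w2.
    assert (HQi : forall k, 0 < k -> (k = i \/ k = j) -> u ^ 2 * k ^ 2 + w ^ 2 <= Q).
    { intros k Hk [-> | ->].
      - assert (0 <= u ^ 2 * j ^ 2) by (apply Rmult_le_pos; apply pow2_ge_0). lra.
      - assert (0 <= u ^ 2 * i ^ 2) by (apply Rmult_le_pos; apply pow2_ge_0). lra. }
    assert (P1 : forall k, 0 < k -> (k = i \/ k = j) -> 2 * u * w * k ^ 2 <= k * Q).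
    { intros k Hk Hij. specialize (HQi k Hk Hij).
      replace (2 * u * w * k ^ 2) with (k * (2 * (u * k) * w)) by ring.
      apply Rmult_le_compat_l; [lra|]. pose proof (pow2_ge_0 (u * k - w)). lra. }
    assert (P2 : forall k U V, 0 < k -> (k = i \/ k = j) -> Rabs U * k <= 1 -> Rabs V <= K ->
       u ^ 2 * (- (2 * U * V) * (k ^ 2) ^ 2) <= 2 * K * k * Q).
    { intros k U V Hk Hij HU HV. specialize (HQi k Hk Hij).
      assert (HUV : Rabs ((U * k) * V) <= 1 * K).
      { apply Rabs_mult_le; [|assumption]. rewrite Rabs_mult, (Rabs_right k); lra. }
      apply Rabs_le_between in HUV.
      replace (u ^ 2 * (- (2 * U * V) * (k ^ 2) ^ 2)) with ((2 * k) * ((u ^ 2 * k ^ 2) * (- (U * k * V)))) by ring.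
      replace (2 * K * k * Q) with ((2 * k) * (Q * K)) by ring.
      apply Rmult_le_compat_l; [lra|].
      assert (Hs2 : 0 <= u ^ 2 * k ^ 2) by (apply Rmult_le_pos; apply pow2_ge_0).
      apply Rle_trans with ((u ^ 2 * k ^ 2) * K); [apply Rmult_le_compat_l; lra|].
      apply Rmult_le_compat_r; lra. }
    pose proof (P1 i I1 (or_introl eq_refl)). pose proof (P1 j I2 (or_intror eq_refl)).
    pose proof (P2 i (cU p) (cU v) I1 (or_introl eq_refl) Ui (proj1 Hvbox)).
    pose proof (P2 j (cU p') (cU v') I2 (or_intror eq_refl) Ui' (proj1 Hvbox')).
    assert (0 <= L * Q) by (apply Rmult_le_pos; lra).
    assert (0 <= K * (L * Q)) by (apply Rmult_le_pos; lra).
    rewrite HL2 in *. lra. }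
  assert (F1 : Q + n ^ 2 <= (1 + K) * L * (Q + n ^ 2)).
  { rewrite <- (Rmult_1_l (Q + n ^ 2)) at 1. apply Rmult_le_compat_r; lra. }
  assert (F2 : C * L * Q <= C * L * (Q + n ^ 2)) by (apply Rmult_le_compat_l; lra).
  assert (F3 : (2 + 2 * K) * L * Q <= (2 + 2 * K) * L * (Q + n ^ 2)).
  { apply Rmult_le_compat_l; [apply Rmult_le_pos; lra|lra]. }
  assert (F4 : 0 <= (2 + 2 * K) * L * (Q + n ^ 2)).
  { repeat apply Rmult_le_pos; lra. }
  assert (F5 : 0 <= C * L * (Q + n ^ 2)) by (apply Rmult_le_pos; lra).
  lra.
Qed.

(** * Comparison of two trajectories in forward time *)

Definition small_box_net (T : R) (r : R -> R -> R5) : Prop :=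
  forall m : nat, exists C eps0, 0 <= C /\ 0 < eps0 /\ forall eps t, 0 < eps < eps0 -> 0 <= t <= T ->
    in_box (C * eps ^ m) (r eps t).

Definition small_box (r : R -> R5) : Prop :=
  forall m : nat, exists C eps0, 0 <= C /\ 0 < eps0 /\ forall eps, 0 < eps < eps0 ->
    in_box (C * eps ^ m) (r eps).

(* Positions [p], velocities [v], residuals [r]. *)
Definition trajectory (sigma a e : R) (H : R -> R -> R -> R) (rho : R -> R) (T : R)
    (p v r : R -> R -> R5) : Prop :=
  (exists K eps0, 0 <= K /\ 0 < eps0 /\ forall eps t, 0 < eps < eps0 -> 0 <= t <= T ->
     is_derive5 (p eps) t (v eps t) /\
     is_derive5 (v eps) t (add5 (acc sigma a e H rho eps (p eps t) (v eps t)) (r eps t)) /\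
     in_box K (p eps t)) /\
  small_box_net T r.

(** The number [c2] will be the squared speed [U'] of the background geodesic at the wave; the
    margin [c2 / 8] is the one that [a_priori_bounds] widens to [c2 / 4]. *)
Definition regular_start (kap c2 : R) (p v : R -> R -> R5) : Prop :=
  exists K eps0, 0 <= K /\ 0 < eps0 /\ forall eps, 0 < eps < eps0 ->
    Rabs (cU (v eps 0) ^ 2 + kap * cU (p eps 0) ^ 2 - c2) <= c2 / 8 /\
    in_vbox K (v eps 0).

Lemma in_box_le (K K' : R) (p : R5) : K <= K' -> in_box K p -> in_box K' p.
Proof. intros HK (? & ? & ? & ? & ?). unfold in_box. repeat split; lra. Qed.

Lemma in_vbox_le (K K' : R) (p : R5) : K <= K' -> in_vbox K p -> in_vbox K' p.
Proof. intros HK (? & ? & ? & ?). unfold in_vbox. repeat split; lra. Qed.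

Lemma trajectory_bounds (sigma a e : R) (H : R -> R -> R -> R) (rho : R -> R) (T c2 : R)
    (p v r : R -> R -> R5) :
  sigma = 1 \/ sigma = -1 -> 0 < a -> regular_profile H rho -> 0 <= T -> 0 < c2 ->
  trajectory sigma a e H rho T p v r -> regular_start (e / (sigma * a ^ 2)) c2 p v ->
  exists K eps1 C, 0 <= K /\ 0 < eps1 /\ 0 <= C /\ forall eps, 0 < eps < eps1 ->
    (forall t, 0 <= t <= T -> in_box K (p eps t) /\ in_vbox K (v eps t)) /\
    exists Lam dLam : R -> R, forall t, 0 <= t <= T ->
      is_derive Lam t (dLam t) /\ invdist eps (p eps t) <= dLam t /\
      Rabs (Lam t) <= C * (1 + ln (/ eps)).
Proof.
  intros Hs Ha Hreg HT Hc2 [(K0 & e0 & HK0 & He0 & Htr) Hr] (K1 & e1 & HK1 & He1 & Hst).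
  destruct (acc_growth sigma a e H rho K0 Hs Ha Hreg HK0) as (e2 & C2 & He2 & HC2 & Hgr).
  (* First order in [eps] is exactly the room left by the summand [eps] in the hypothesis on
     [A + kap * U] of [a_priori_bounds]. *)
  destruct (Hr 1%nat) as (C3 & e3 & HC3 & He3 & Hres).
  set (kap := e / (sigma * a ^ 2)) in *.
  assert (HK : 0 <= K0 + K1) by lra. assert (HC : 0 <= C2 + C3) by lra.
  destruct (a_priori_bounds kap c2 (K0 + K1) (C2 + C3) T Hc2 HK HC HT) as (e4 & B & He4 & HB & Hap).
  destruct (inv_distance_primitive kap c2 (K0 + K1) B T Hc2 HK HB HT) as (C5 & HC5 & Hprim).
  set (eps1 := Rmin (Rmin (Rmin e0 e1) (Rmin e2 e3)) (Rmin e4 1)).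
  assert (Hmin : eps1 <= e0 /\ eps1 <= e1 /\ eps1 <= e2 /\ eps1 <= e3 /\ eps1 <= e4 /\ eps1 <= 1).
  { unfold eps1. pose proof (Rmin_l (Rmin (Rmin e0 e1) (Rmin e2 e3)) (Rmin e4 1)).
    pose proof (Rmin_r (Rmin (Rmin e0 e1) (Rmin e2 e3)) (Rmin e4 1)).
    pose proof (Rmin_l (Rmin e0 e1) (Rmin e2 e3)). pose proof (Rmin_r (Rmin e0 e1) (Rmin e2 e3)).
    pose proof (Rmin_l e0 e1). pose proof (Rmin_r e0 e1). pose proof (Rmin_l e2 e3).
    pose proof (Rmin_r e2 e3). pose proof (Rmin_l e4 1). pose proof (Rmin_r e4 1).
    repeat split; lra. }
  exists (K0 + K1 + B), eps1, C5. split; [lra|].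
  split; [unfold eps1; repeat apply Rmin_glb_lt; lra|]. split; [assumption|].
  intros eps He.
  assert (Hb : forall t, 0 <= t <= T ->
     Rabs (cU (v eps t)) <= B /\ Rabs (cU (add5 (acc sigma a e H rho eps (p eps t) (v eps t)) (r eps t))) <= B /\
     Rabs (cZ2 (v eps t)) <= B /\ Rabs (cZ3 (v eps t)) <= B /\ Rabs (cZ4 (v eps t)) <= B /\
     Rabs (cU (v eps t) ^ 2 + kap * cU (p eps t) ^ 2 - c2) <= c2 / 4).
  { destruct (Hst eps ltac:(lra)) as (S1 & S2 & S3 & S4 & S5).
    set (AA := fun t => add5 (acc sigma a e H rho eps (p eps t) (v eps t)) (r eps t)).
    apply (Hap eps ltac:(lra) (fun t => cU (p eps t)) (fun t => cU (v eps t)) (fun t => cU (AA t))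
             (fun t => cZ2 (v eps t)) (fun t => cZ3 (v eps t)) (fun t => cZ4 (v eps t))
             (fun t => cZ2 (AA t)) (fun t => cZ3 (AA t)) (fun t => cZ4 (AA t))).
    - intros t Ht.
      destruct (Htr eps t ltac:(lra) Ht) as ((D1 & _) & (D2 & _ & D3 & D4 & D5) & (Bx & _)).
      do 5 (split; [assumption|]). lra.
    - intros t Ht.
      destruct (Htr eps t ltac:(lra) Ht) as (_ & _ & Bx).
      destruct (Hgr eps (p eps t) (v eps t) ltac:(lra) Bx) as (G1 & G2 & G3 & G4).
      destruct (Hres eps t ltac:(lra) Ht) as (R1 & _ & R2 & R3 & R4).
      fold kap in G1. rewrite pow_1 in R1, R2, R3, R4.
      cbv zeta. unfold AA, add5. cbn [cU cZ2 cZ3 cZ4].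
      change (/ (1 + (cU (p eps t) / eps) ^ 2)) with (zone_weight eps (p eps t)).
      change (1 + Rabs (cZ2 (v eps t)) + Rabs (cZ3 (v eps t)) + Rabs (cZ4 (v eps t))) with (speedZ (v eps t)).
      assert (Hq : 0 < zone_weight eps (p eps t) <= 1) by apply inv_1_plus_sqr_bounds.
      assert (HY : 1 <= speedZ (v eps t)).
      { unfold speedZ. pose proof (Rabs_pos (cZ2 (v eps t))). pose proof (Rabs_pos (cZ3 (v eps t))).
        pose proof (Rabs_pos (cZ4 (v eps t))). lra. }
      set (q := zone_weight eps (p eps t)) in *. set (Y := speedZ (v eps t)) in *.
      pose proof (Rabs_pos (cU (v eps t))) as Vp.
      assert (W0 : 0 <= q * Rabs (cU (v eps t)) * Y) by (repeat apply Rmult_le_pos; lra).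
      assert (W1 : 0 <= cU (v eps t) ^ 2 * (q / eps)).
      { apply Rmult_le_pos; [apply pow2_ge_0|]. left. apply Rdiv_lt_0_compat; lra. }
      assert (W2 : 0 <= q * (cU (v eps t) ^ 2 + eps * Rabs (cU (v eps t)) * Y + eps ^ 2)).
      { apply Rmult_le_pos; [lra|]. pose proof (pow2_ge_0 eps). pose proof (pow2_ge_0 (cU (v eps t))).
        assert (0 <= eps * Rabs (cU (v eps t)) * Y) by (repeat apply Rmult_le_pos; lra). lra. }
      set (X := 1 + cU (v eps t) ^ 2 * (q / eps) + q * Rabs (cU (v eps t)) * Y) in *.
      assert (HX : 1 <= X) by (unfold X; lra).
      assert (HZ : forall b s, Rabs b <= C2 * X -> Rabs s <= C3 * eps -> Rabs (b + s) <= (C2 + C3) * X).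
      { intros b s Hb Hs'. eapply Rle_trans; [apply Rabs_triang|].
        assert (C3 * eps <= C3 * X) by (apply Rmult_le_compat_l; lra). lra. }
      split; [|split; [|split]]; try (apply HZ; assumption).
      set (W := q * (cU (v eps t) ^ 2 + eps * Rabs (cU (v eps t)) * Y + eps ^ 2)) in *.
      match goal with |- Rabs (?x + ?y + ?z) <= _ => replace (x + y + z) with ((x + z) + y) by ring end.
      eapply Rle_trans; [apply Rabs_triang|].
      assert (0 <= C2 * eps) by (apply Rmult_le_pos; lra).
      assert (0 <= C3 * W) by (apply Rmult_le_pos; lra). lra.
    - exact S1.
    - lra.
    - lra.
    - lra. }
  split.
  - intros t Ht. destruct (Htr eps t ltac:(lra) Ht) as (_ & _ & Bx).
    destruct (Hb t Ht) as (B1 & _ & B2 & B3 & B4 & _).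
    split; [apply in_box_le with K0; [lra|assumption]|]. unfold in_vbox. repeat split; lra.
  - apply (Hprim eps ltac:(lra) (fun t => cU (p eps t)) (fun t => cU (v eps t))
      (fun t => cU (add5 (acc sigma a e H rho eps (p eps t) (v eps t)) (r eps t)))).
    intros t Ht. destruct (Htr eps t ltac:(lra) Ht) as ((D1 & _) & (D2 & _) & (Bx & _)).
    destruct (Hb t Ht) as (B1 & B2 & _ & _ & _ & B3).
    apply Rabs_le_between in B3.
    do 2 (split; [assumption|]). repeat split; lra.
Qed.

Lemma exp_mult_ln_inv_le (M eps : R) (N : nat) :
  0 < eps < 1 -> M <= INR N -> exp (M * ln (/ eps)) <= / eps ^ N.
Proof.
  intros He HM. pose proof (ln_inv_nonneg eps He).
  rewrite <- pow_inv, <- Rpower_pow by (apply Rinv_0_lt_compat; lra).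
  unfold Rpower. apply exp_le_compat. apply Rmult_le_compat_r; assumption.
Qed.

(** The loss [/ eps ^ 2] is the maximum of [invsq], attained on the wave. The count is
    [11 = 2 + 1 + 6 + 2]: two weights on [U], the velocity of [U], the [Z]-terms, the [V]-terms. *)
Lemma energy_le_of_box (eps n : R) (p v p' v' : R5) :
  0 < eps <= 1 -> in_box n (sub5 p p') -> in_box n (sub5 v v') ->
  energy eps p v p' v' <= 11 * n ^ 2 * / eps ^ 2.
Proof.
  intros He (P1 & P2 & P3 & P4 & P5) (V1 & V2 & V3 & V4 & V5).
  cbn [sub5 cU cV cZ2 cZ3 cZ4] in *.
  assert (S : forall x, Rabs x <= n -> x ^ 2 <= n ^ 2).
  { intros x Hx. rewrite <- pow2_abs. apply pow_incr. split; [apply Rabs_pos|assumption]. }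
  apply S in P1, P2, P3, P4, P5, V1, V2, V3, V4, V5.
  assert (He2 : 0 < eps ^ 2 <= 1) by (split; [apply pow2_gt_0; lra|nra]).
  assert (Hi : 1 <= / eps ^ 2) by (rewrite <- Rinv_1; apply Rinv_le_contravar; lra).
  assert (J : forall q, 0 <= invsq eps q <= / eps ^ 2).
  { intro q. pose proof (sqr_plus_sqr_pos eps (cU q) (proj1 He)). unfold invsq. split.
    - left. apply Rinv_0_lt_compat. assumption.
    - apply Rinv_le_contravar; [lra|]. pose proof (pow2_ge_0 (cU q)). lra. }
  pose proof (J p) as J1. pose proof (J p') as J2.
  unfold energy. pose proof (pow2_ge_0 n) as N2.
  assert (T1 : (cU p - cU p') ^ 2 * (invsq eps p + invsq eps p') <= n ^ 2 * (2 * / eps ^ 2)).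
  { apply Rmult_le_compat; try lra. apply pow2_ge_0. }
  assert (T2 : eps ^ 2 * ((cV p - cV p') ^ 2 + (cV v - cV v') ^ 2) <= 1 * (2 * n ^ 2)).
  { apply Rmult_le_compat; try lra. apply Rplus_le_le_0_compat; apply pow2_ge_0. }
  assert (T3 : n ^ 2 * 1 <= n ^ 2 * / eps ^ 2) by (apply Rmult_le_compat_l; lra).
  lra.
Qed.

(** The factor [eps] in the assumption compensates the weight [eps] of the [V]-component; the factor
    [1 + K] compensates the weight of the [U]-component, which is at least [/ (1 + K)]. *)
Lemma box_of_energy (eps K Q : R) (p v p' v' : R5) :
  0 < eps <= 1 -> 0 <= K -> in_box K p -> energy eps p v p' v' <= (eps * Q) ^ 2 -> 0 <= Q ->
  in_box ((1 + K) * Q) (sub5 p p').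
Proof.
  intros He HK HB HE HQ.
  destruct (energy_components eps p v p' v' (proj1 He)) as (Q1 & _ & Q3 & Q4 & _).
  assert (HeQ : 0 <= eps * Q <= Q) by (split; [apply Rmult_le_pos; lra|nra]).
  assert (HKQ : 0 <= K * Q) by (apply Rmult_le_pos; lra).
  pose proof (pow2_ge_0 (cZ2 p - cZ2 p')) as sq2. pose proof (pow2_ge_0 (cZ3 p - cZ3 p')) as sq3.
  pose proof (pow2_ge_0 (cZ4 p - cZ4 p')) as sq4. pose proof (pow2_ge_0 (cZ2 v - cZ2 v')) as sw2.
  pose proof (pow2_ge_0 (cZ3 v - cZ3 v')) as sw3. pose proof (pow2_ge_0 (cZ4 v - cZ4 v')) as sw4.
  assert (HZ : forall z, z ^ 2 <= energy eps p v p' v' -> Rabs z <= (1 + K) * Q).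
  { intros z Hz. apply Rle_trans with (eps * Q); [|lra]. apply Rabs_le_of_sqr_le; lra. }
  unfold in_box, sub5. cbn [cU cV cZ2 cZ3 cZ4]. repeat split.
  - assert (Hi := invdist_lower_bound eps K p He (proj1 HB)).
    assert (H1K : 0 < / (1 + K)) by (apply Rinv_0_lt_compat; lra).
    rewrite !invsq_invdist in Q1 by lra.
    apply Rabs_le_of_sqr_le; [lra|].
    assert ((/ (1 + K)) ^ 2 <= invdist eps p ^ 2) by (apply pow_incr; lra).
    assert ((cU p - cU p') ^ 2 * (/ (1 + K)) ^ 2 <= (eps * Q) ^ 2).
    { eapply Rle_trans; [|exact HE]. eapply Rle_trans; [|exact Q1].
      apply Rmult_le_compat_l; [apply pow2_ge_0|]. pose proof (pow2_ge_0 (invdist eps p')). lra. }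
    assert ((eps * Q) ^ 2 <= Q ^ 2) by (apply pow_incr; lra).
    replace ((cU p - cU p') ^ 2) with ((1 + K) ^ 2 * ((cU p - cU p') ^ 2 * (/ (1 + K)) ^ 2)) by (field; lra).
    rewrite Rpow_mult_distr. apply Rmult_le_compat_l; [apply pow2_ge_0|lra].
  - apply Rle_trans with Q; [|lra]. apply Rabs_le_of_sqr_le; [lra|].
    assert (He2 : 0 < eps ^ 2) by (apply pow2_gt_0; lra).
    apply Rmult_le_reg_l with (eps ^ 2); [assumption|].
    rewrite <- (Rpow_mult_distr eps Q). eapply Rle_trans; [|exact HE]. eapply Rle_trans; [|exact Q4].
    apply Rmult_le_compat_l; [lra|]. pose proof (pow2_ge_0 (cV v - cV v')). lra.
  - apply HZ. lra.
  - apply HZ. lra.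
  - apply HZ. lra.
Qed.

(** The exponent in Gronwall's inequality is [O(1 + ln (1 / eps))], so errors grow by a fixed power
    of [1 / eps]. Data and residuals are small to every order, and a high enough order is selected
    to beat this power. *)
Lemma trajectory_unique (sigma a e : R) (H : R -> R -> R -> R) (rho : R -> R) (T c2 : R)
    (p v r p' v' r' : R -> R -> R5) :
  sigma = 1 \/ sigma = -1 -> 0 < a -> regular_profile H rho -> 0 <= T -> 0 < c2 ->
  trajectory sigma a e H rho T p v r -> regular_start (e / (sigma * a ^ 2)) c2 p v ->
  trajectory sigma a e H rho T p' v' r' -> regular_start (e / (sigma * a ^ 2)) c2 p' v' ->
  small_box (fun eps => sub5 (p eps 0) (p' eps 0)) ->
  small_box (fun eps => sub5 (v eps 0) (v' eps 0)) ->
  small_box_net T (fun eps t => sub5 (p eps t) (p' eps t)).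
Proof.
  intros Hs Ha Hreg HT Hc2 Htr Hst Htr' Hst' Hp0 Hv0 m.
  destruct (trajectory_bounds sigma a e H rho T c2 p v r Hs Ha Hreg HT Hc2 Htr Hst)
    as (K1 & e1 & C1 & HK1 & He1 & HC1 & HB1).
  destruct (trajectory_bounds sigma a e H rho T c2 p' v' r' Hs Ha Hreg HT Hc2 Htr' Hst')
    as (K2 & e2 & C2 & HK2 & He2 & HC2 & HB2).
  destruct Htr as [(K3 & e3 & _ & He3 & Hd) Hr]. destruct Htr' as [(K4 & e4 & _ & He4 & Hd') Hr'].
  set (K := K1 + K2). assert (HK : 0 <= K) by (unfold K; lra).
  destruct (energy_rate_bound sigma a e H rho K Hs Ha Hreg HK) as (e5 & C & He5 & HC & Hrate).
  (* With [|Lam| <= C_i * (1 + l)] at both ends of the time interval, the exponent is at most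
     [M * (1 + l)], hence the growth factor at most [exp M * eps^-N] for any natural [N >= M]. *)
  set (M := 2 * C * (C1 + C2)).
  assert (HM : 0 <= M) by (unfold M; repeat apply Rmult_le_pos; lra).
  destruct (nfloor_ex M HM) as [N0 HN0].
  set (N := S N0). assert (HMN : M <= INR N) by (unfold N; rewrite S_INR; lra).
  (* Exponent count: [n ^ 2] contributes [2 * m + 4 + 2 * N], the initial energy loses 2 and
     Gronwall loses [N]. What is left exceeds by [N] the exponent [2 * m + 2] required by
     [box_of_energy]. *)
  set (mm := (m + 2 + N)%nat).
  destruct (Hr mm) as (D1 & f1 & HD1 & Hf1 & R1). destruct (Hr' mm) as (D2 & f2 & HD2 & Hf2 & R2).
  destruct (Hp0 mm) as (D3 & f3 & HD3 & Hf3 & R3). destruct (Hv0 mm) as (D4 & f4 & HD4 & Hf4 & R4).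
  set (D := D1 + D2 + D3 + D4).
  (* Adding 1 ensures that the square of [D'] dominates [12 * D ^ 2 * exp M], so no square root is
     needed. *)
  set (D' := 1 + 12 * D ^ 2 * exp M).
  set (eps1 := Rmin (Rmin (Rmin (Rmin e1 e2) (Rmin e3 e4)) (Rmin (Rmin f1 f2) (Rmin f3 f4))) (Rmin e5 1)).
  assert (Hmin : eps1 <= e1 /\ eps1 <= e2 /\ eps1 <= e3 /\ eps1 <= e4 /\ eps1 <= e5 /\ eps1 <= 1 /\
                 eps1 <= f1 /\ eps1 <= f2 /\ eps1 <= f3 /\ eps1 <= f4).
  { unfold eps1.
    pose proof (Rmin_l (Rmin (Rmin (Rmin e1 e2) (Rmin e3 e4)) (Rmin (Rmin f1 f2) (Rmin f3 f4))) (Rmin e5 1)).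
    pose proof (Rmin_r (Rmin (Rmin (Rmin e1 e2) (Rmin e3 e4)) (Rmin (Rmin f1 f2) (Rmin f3 f4))) (Rmin e5 1)).
    pose proof (Rmin_l (Rmin (Rmin e1 e2) (Rmin e3 e4)) (Rmin (Rmin f1 f2) (Rmin f3 f4))).
    pose proof (Rmin_r (Rmin (Rmin e1 e2) (Rmin e3 e4)) (Rmin (Rmin f1 f2) (Rmin f3 f4))).
    pose proof (Rmin_l (Rmin e1 e2) (Rmin e3 e4)). pose proof (Rmin_r (Rmin e1 e2) (Rmin e3 e4)).
    pose proof (Rmin_l (Rmin f1 f2) (Rmin f3 f4)). pose proof (Rmin_r (Rmin f1 f2) (Rmin f3 f4)).
    pose proof (Rmin_l e1 e2). pose proof (Rmin_r e1 e2). pose proof (Rmin_l e3 e4).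
    pose proof (Rmin_r e3 e4). pose proof (Rmin_l f1 f2). pose proof (Rmin_r f1 f2).
    pose proof (Rmin_l f3 f4). pose proof (Rmin_r f3 f4). pose proof (Rmin_l e5 1). pose proof (Rmin_r e5 1).
    repeat split; lra. }
  assert (HD' : 1 <= D').
  { unfold D'. assert (0 <= 12 * D ^ 2 * exp M); [|lra].
    apply Rmult_le_pos; [pose proof (pow2_ge_0 D); lra|left; apply exp_pos]. }
  exists ((1 + K) * D'), eps1. split; [apply Rmult_le_pos; lra|].
  split; [unfold eps1; repeat apply Rmin_glb_lt; lra|].
  intros eps t He Ht.
  set (n := D * eps ^ mm).
  assert (Hen : 0 < eps ^ mm) by (apply pow_lt; lra).
  assert (Hsub : forall d, d <= D -> d * eps ^ mm <= n).
  { intros d Hdle. unfold n. apply Rmult_le_compat_r; lra. }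
  destruct (HB1 eps ltac:(lra)) as (Bx1 & Lam1 & dLam1 & HL1).
  destruct (HB2 eps ltac:(lra)) as (Bx2 & Lam2 & dLam2 & HL2).
  set (y := fun s => energy eps (p eps s) (v eps s) (p' eps s) (v' eps s)).
  set (A := fun s => add5 (acc sigma a e H rho eps (p eps s) (v eps s)) (r eps s)).
  set (A' := fun s => add5 (acc sigma a e H rho eps (p' eps s) (v' eps s)) (r' eps s)).
  (* Adding the constant [n ^ 2] to the energy makes the differential inequality homogeneous, so the
     residuals count like initial errors. *)
  assert (Hgr : y t + n ^ 2 <= (y 0 + n ^ 2) * exp (C * (Lam1 t + Lam2 t) - C * (Lam1 0 + Lam2 0))).
  { apply (gronwall (fun s => y s + n ^ 2)
             (fun s => energy_rate eps (p eps s) (v eps s) (A s) (p' eps s) (v' eps s) (A' s))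
             (fun s => C * (Lam1 s + Lam2 s)) (fun s => C * (dLam1 s + dLam2 s))); [lra| | |].
    - intros s Hs0. destruct (Hd eps s ltac:(lra) ltac:(lra)) as (X1 & X2 & _).
      destruct (Hd' eps s ltac:(lra) ltac:(lra)) as (X3 & X4 & _).
      match goal with |- is_derive _ _ ?d => replace d with (d + 0) by ring end.
      apply is_derive_Rplus; [|apply @is_derive_const].
      apply is_derive_energy; try assumption. lra.
    - intros s Hs0. apply is_derive_scal. apply is_derive_Rplus; [apply HL1|apply HL2]; lra.
    - intros s Hs0.
      destruct (Bx1 s ltac:(lra)) as [P1 P2]. destruct (Bx2 s ltac:(lra)) as [P3 P4].
      eapply Rle_trans; [apply (Hrate eps _ _ _ _ _ _ n)|].
      + split; [lra|]. split; [apply in_box_le with K1; [unfold K; lra|assumption]|].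
        apply in_vbox_le with K1; [unfold K; lra|assumption].
      + split; [lra|]. split; [apply in_box_le with K2; [unfold K; lra|assumption]|].
        apply in_vbox_le with K2; [unfold K; lra|assumption].
      + apply in_box_le with (D1 * eps ^ mm); [apply Hsub; unfold D; lra|]. apply R1; lra.
      + apply in_box_le with (D2 * eps ^ mm); [apply Hsub; unfold D; lra|]. apply R2; lra.
      + fold (y s). apply Rmult_le_compat_r.
        * apply Rplus_le_le_0_compat; [apply energy_nonneg; lra|apply pow2_ge_0].
        * apply Rmult_le_compat_l; [assumption|]. unfold invdist2.
          destruct (HL1 s ltac:(lra)) as (_ & Y1 & _). destruct (HL2 s ltac:(lra)) as (_ & Y2 & _). lra. }
  set (l := ln (/ eps)) in *.
  assert (Hl : 0 <= l) by (apply ln_inv_nonneg; lra).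
  assert (Hexp : exp (C * (Lam1 t + Lam2 t) - C * (Lam1 0 + Lam2 0)) <= exp M * / eps ^ N).
  { apply Rle_trans with (exp (M + M * l)).
    - apply exp_le_compat.
      destruct (HL1 t Ht) as (_ & _ & Y1). destruct (HL2 t Ht) as (_ & _ & Y2).
      destruct (HL1 0 ltac:(lra)) as (_ & _ & Y3). destruct (HL2 0 ltac:(lra)) as (_ & _ & Y4).
      apply Rabs_le_between in Y1, Y2, Y3, Y4.
      replace (M + M * l) with (C * (2 * (C1 * (1 + l)) + 2 * (C2 * (1 + l)))) by (unfold M; ring).
      rewrite <- Rmult_minus_distr_l. apply Rmult_le_compat_l; [assumption|]. lra.
    - rewrite exp_plus. apply Rmult_le_compat_l; [left; apply exp_pos|].
      apply exp_mult_ln_inv_le; lra. }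
  assert (Hy0 : y 0 <= 11 * n ^ 2 * / eps ^ 2).
  { apply energy_le_of_box; [lra| |].
    - apply in_box_le with (D3 * eps ^ mm); [apply Hsub; unfold D; lra|]. apply R3; lra.
    - apply in_box_le with (D4 * eps ^ mm); [apply Hsub; unfold D; lra|]. apply R4; lra. }
  assert (Heps2 : 0 < eps ^ 2 <= 1).
  { split; [apply pow2_gt_0; lra|]. rewrite <- (pow1 2). apply pow_incr. lra. }
  assert (Hi2 : 1 <= / eps ^ 2) by (rewrite <- Rinv_1; apply Rinv_le_contravar; lra).
  pose proof (pow2_ge_0 n) as Hn2.
  assert (Hy0' : y 0 + n ^ 2 <= 12 * n ^ 2 * / eps ^ 2).
  { assert (n ^ 2 * 1 <= n ^ 2 * / eps ^ 2) by (apply Rmult_le_compat_l; lra). lra. }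
  assert (HyN : y t <= (12 * n ^ 2 * / eps ^ 2) * (exp M * / eps ^ N)).
  { apply Rle_trans with (y t + n ^ 2); [lra|]. eapply Rle_trans; [exact Hgr|].
    apply Rmult_le_compat; try assumption.
    - apply Rplus_le_le_0_compat; [apply energy_nonneg; lra|assumption].
    - left; apply exp_pos. }
  replace ((1 + K) * D' * eps ^ m) with ((1 + K) * (D' * eps ^ m)) by ring.
  destruct (Bx1 t Ht) as [P1 _].
  apply (box_of_energy eps K (D' * eps ^ m) (p eps t) (v eps t) (p' eps t) (v' eps t)).
  - lra.
  - assumption.
  - apply in_box_le with K1; [unfold K; lra|assumption].
  - fold (y t). eapply Rle_trans; [exact HyN|].
    assert (HeN : 0 < eps ^ N) by (apply pow_lt; lra).
    assert (HeN1 : eps ^ N <= 1).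
    { rewrite <- (pow1 N). apply pow_incr. lra. }
    assert (Hem : 0 < eps ^ m) by (apply pow_lt; lra).
    replace ((12 * n ^ 2 * / eps ^ 2) * (exp M * / eps ^ N))
      with ((12 * D ^ 2 * exp M) * ((eps * eps ^ m) ^ 2 * eps ^ N)).
    2:{ unfold n, mm. rewrite !pow_add. field. split; lra. }
    replace ((eps * (D' * eps ^ m)) ^ 2) with (D' ^ 2 * (eps * eps ^ m) ^ 2) by ring.
    pose proof (pow2_ge_0 (eps * eps ^ m)).
    apply Rmult_le_compat.
    + apply Rmult_le_pos; [pose proof (pow2_ge_0 D); lra|left; apply exp_pos].
    + apply Rmult_le_pos; lra.
    + set (W := 12 * D ^ 2 * exp M) in *. pose proof (pow2_ge_0 W). unfold D' in *. lra.
    + rewrite <- (Rmult_1_r ((eps * eps ^ m) ^ 2)) at 2. apply Rmult_le_compat_l; lra.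
  - apply Rmult_le_pos; [lra|]. left. apply pow_lt; lra.
Qed.

(** * From Colombeau solutions to trajectories *)

(** At fixed [eps], the time derivatives are the iterated partials along coordinate 1 alone. *)
Lemma smooth_net_comp_smooth1 (f : R -> R -> R) (eps : R) :
  smooth_net_comp f -> 0 < eps -> smooth1 (f eps).
Proof.
  intros Hf He.
  set (vec2 := fun (x y : R) (j : nat) => match j with 0%nat => x | 1%nat => y | _ => 0 end).
  set (F := fun x : nat -> R => f (x 0%nat) (x 1%nat)).
  assert (U1 : forall s t, upd (vec2 eps t) 1 s = vec2 eps s).
  { intros s t. apply functional_extensionality. intros [|[|j]]; reflexivity. }
  assert (E : forall k t, Derive_n (f eps) k t = iter_partial (repeat 1%nat k) F (vec2 eps t)).
  { induction k as [|k IH]; intro t; [reflexivity|].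
    cbn [Derive_n repeat iter_partial]. unfold partial. apply Derive_ext.
    intro s. rewrite U1. apply IH. }
  intros n t. destruct n as [|n]; [exact I|]. cbn.
  destruct (Hf (repeat 1%nat n)) with (x := vec2 eps t) as [_ Hd].
  - apply Forall_forall. intros i Hi. apply repeat_spec in Hi. lia.
  - exact He.
  - apply ex_derive_ext with (f := fun s => iter_partial (repeat 1%nat n) F (upd (vec2 eps t) 1 s)).
    + intro s. rewrite U1. symmetry. apply E.
    + apply (Hd 1%nat). lia.
Qed.

Lemma smooth_net_smooth_curve (g : R -> R -> R5) (eps : R) :
  smooth_net g -> 0 < eps -> smooth_curve (g eps).
Proof.
  intros (H1 & H2 & H3 & H4 & H5) He.
  split; [exact (smooth_net_comp_smooth1 _ eps H1 He)|].
  split; [exact (smooth_net_comp_smooth1 _ eps H2 He)|].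
  split; [exact (smooth_net_comp_smooth1 _ eps H3 He)|].
  split; [exact (smooth_net_comp_smooth1 _ eps H4 He)|exact (smooth_net_comp_smooth1 _ eps H5 He)].
Qed.

Lemma smooth1_is_derive_n (f : R -> R) (k : nat) (t : R) :
  smooth1 f -> is_derive (fun s => Derive_n f k s) t (Derive_n f (S k) t).
Proof. intros Hf. apply Derive_correct. exact (Hf (S k) t). Qed.

Lemma smooth_curve_is_derive5 (c : R -> R5) (k : nat) (t : R) :
  smooth_curve c -> is_derive5 (dern5 c k) t (dern5 c (S k) t).
Proof.
  intros (H1 & H2 & H3 & H4 & H5).
  split; [|split; [|split; [|split]]]; apply smooth1_is_derive_n; assumption.
Qed.

Lemma smooth3_has_partials (H : R -> R -> R -> R) :
  smooth3 H -> has_partials H (dH2 H) (dH3 H) (dH4 H).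
Proof. intros HH. apply (iter3_has_partials H nil HH). constructor. Qed.

Lemma is_derive_cutoff_arg (eps : R) (f : R -> R) (U : R -> R) (t f' U' : R) :
  is_derive f (U t / eps) f' -> is_derive U t U' ->
  is_derive (fun s => f (U s / eps)) t (U' / eps * f').
Proof.
  intros Hf HU. apply (is_derive_comp f (fun s => U s / eps) t f' (U' / eps) Hf).
  apply is_derive_ext with (f := fun s => / eps * U s); [intro; apply Rmult_comm|].
  unfold Rdiv. rewrite Rmult_comm. apply is_derive_scal. exact HU.
Qed.

Lemma ddelta_eq (rho : R -> R) (eps x : R) :
  smooth1 rho -> ddelta rho eps x = / eps * (/ eps * Derive rho (x / eps)).
Proof.
  intros Hr. apply is_derive_unique. unfold delta. apply is_derive_scal.
  replace (/ eps * Derive rho (x / eps)) with (1 / eps * Derive rho (x / eps)) by (unfold Rdiv; ring).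
  apply (is_derive_cutoff_arg eps rho (fun s => s) x); [|apply @is_derive_id].
  apply Derive_correct, smooth1_ex_derive, Hr.
Qed.

(** An exact identity: the residual is the second derivative minus the right-hand side. The work
    lies in carrying out the time derivative inside [Phi_eps] and in rescaling [U = eps * x]. *)
Lemma residual_eq (sigma a e : R) (H : R -> R -> R -> R) (rho : R -> R) (eps : R) (c : R -> R5) (t : R) :
  0 < eps -> smooth3 H -> smooth1 rho -> (forall x, 1 < Rabs x -> rho x = 0) -> smooth_curve c ->
  dern5 c 2 t = add5 (acc sigma a e H rho eps (c t) (dern5 c 1 t)) (residual sigma a e H rho eps c t).
Proof.
  intros He HH Hr Hsupp Hc.
  pose proof (smooth_regular_profile H rho HH Hr Hsupp) as (_ & (_ & L2 & L3 & L4) & _).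
  destruct (smooth_curve_is_derive5 c 0 t Hc) as (DU & DV & D2 & D3 & D4).
  cbn [dern5 Derive_n cU cV cZ2 cZ3 cZ4] in DU, DV, D2, D3, D4.
  set (U1 := Derive (fun s => cU (c s)) t).
  set (dot := dHdot H (c t) (dern5 c 1 t)).
  (* Since [delta_eps(U) * U = x * rho x], the differentiated function has no singular prefactor,
     and [1 / eps] appears only through the derivative of [x]. *)
  assert (HD : Derive (fun s => H (cZ2 (c s)) (cZ3 (c s)) (cZ4 (c s)) * delta rho eps (cU (c s)) * cU (c s)) t
     = dot * (cU (c t) / eps * rho (cU (c t) / eps))
       + evalZ H (c t) * (U1 / eps * (rho (cU (c t) / eps) + cU (c t) / eps * Derive rho (cU (c t) / eps)))).
  { apply is_derive_unique.
    apply is_derive_ext with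
      (f := fun s => H (cZ2 (c s)) (cZ3 (c s)) (cZ4 (c s)) * ((fun x => x * rho x) (cU (c s) / eps))).
    { intro s. unfold delta. cbn. field. lra. }
    apply (is_derive_mult (fun s => H (cZ2 (c s)) (cZ3 (c s)) (cZ4 (c s)))
             (fun s => (fun x => x * rho x) (cU (c s) / eps)) t dot
             (U1 / eps * (rho (cU (c t) / eps) + cU (c t) / eps * Derive rho (cU (c t) / eps))));
      [| |intros; apply Rmult_comm].
    - apply (is_derive_comp3 H (dH2 H) (dH3 H) (dH4 H)); try assumption.
      apply smooth3_has_partials, HH.
    - apply (is_derive_cutoff_arg eps (fun x => x * rho x)); [|exact DU].
      rewrite <- (Rmult_1_l (rho (cU (c t) / eps))).
      apply (is_derive_mult (fun x => x) rho (cU (c t) / eps) 1); [apply @is_derive_id| |intros; apply Rmult_comm].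
      apply Derive_correct, smooth1_ex_derive, Hr. }
  unfold residual. rewrite HD, (ddelta_eq rho eps _ Hr). clear HD.
  change (H (cZ2 (c t)) (cZ3 (c t)) (cZ4 (c t))) with (evalZ H (c t)).
  change (dH2 H (cZ2 (c t)) (cZ3 (c t)) (cZ4 (c t))) with (evalZ (dH2 H) (c t)).
  change (dH3 H (cZ2 (c t)) (cZ3 (c t)) (cZ4 (c t))) with (evalZ (dH3 H) (c t)).
  change (dH4 H (cZ2 (c t)) (cZ3 (c t)) (cZ4 (c t))) with (evalZ (dH4 H) (c t)).
  assert (EN : sigma * a ^ 2 - cU (c t) ^ 2 * evalZ H (c t) * delta rho eps (cU (c t))
               = normN sigma a H rho eps (c t)).
  { unfold normN, delta. cbv zeta. field. lra. }
  rewrite EN.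
  set (P := e + / 2 * cU (dern5 c 1 t) ^ 2 * _ - _).
  assert (EP : P = Phi e H rho eps (c t) (dern5 c 1 t)).
  { unfold P, Phi. cbv zeta. fold dot.
    change (cU (dern5 c 1 t)) with U1. unfold dHdot at 1, delta. field. lra. }
  rewrite EP. clearbody P. clear EP P.
  unfold acc, add5. cbv zeta. cbn [cU cV cZ2 cZ3 cZ4]. fold dot.
  unfold delta. unfold Rdiv at 1 3 5 7 9.
  assert (Ex : forall q q' : R5, cU q = cU q' -> cV q = cV q' -> cZ2 q = cZ2 q' -> cZ3 q = cZ3 q' ->
             cZ4 q = cZ4 q' -> q = q').
  { intros [] []. cbn. intros. subst. reflexivity. }
  apply Ex; cbn [cU cV cZ2 cZ3 cZ4]; unfold dot, dHdot, Rdiv; ring.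
Qed.

(** * Time reversal and shift of the initial instant to 0 *)

Definition scale5 (s : R) (p : R5) : R5 := mk5 (s * cU p) (s * cV p) (s * cZ2 p) (s * cZ3 p) (s * cZ4 p).

(* Velocities enter the acceleration only through quadratic terms: the system is invariant under
   time reversal, so the past of the initial instant needs no separate treatment. *)
Lemma acc_time_reversal (sigma a e : R) (H : R -> R -> R -> R) (rho : R -> R) (eps s : R) (p v : R5) :
  s * s = 1 -> acc sigma a e H rho eps p (scale5 s v) = acc sigma a e H rho eps p v.
Proof.
  intros Hs.
  assert (E2 : cU (scale5 s v) ^ 2 = cU v ^ 2).
  { cbn [scale5 cU]. replace ((s * cU v) ^ 2) with (s * s * cU v ^ 2) by ring. rewrite Hs. ring. }
  assert (Ed : dHdot H p (scale5 s v) = s * dHdot H p v) by (unfold dHdot, scale5; cbn [cZ2 cZ3 cZ4]; ring).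
  assert (EP : Phi e H rho eps p (scale5 s v) = Phi e H rho eps p v).
  { unfold Phi. cbv zeta. rewrite E2, Ed. cbn [scale5 cU].
    replace (s * cU v * (cU p / eps * rho (cU p / eps)) * (s * dHdot H p v))
      with ((s * s) * (cU v * (cU p / eps * rho (cU p / eps)) * dHdot H p v)) by ring.
    rewrite Hs. ring. }
  unfold acc. rewrite E2, Ed, EP. cbn [scale5 cU].
  replace (/ eps * rho (cU p / eps) * (s * cU v) * (s * dHdot H p v))
    with ((s * s) * (/ eps * rho (cU p / eps) * cU v * dHdot H p v)) by ring.
  rewrite Hs, Rmult_1_l. reflexivity.
Qed.

Lemma is_derive5_reparam (c : R -> R5) (d : R5) (al s t : R) :
  is_derive5 c (al + s * t) d -> is_derive5 (fun u => c (al + s * u)) t (scale5 s d).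
Proof.
  assert (P : forall (f : R -> R) l, is_derive f (al + s * t) l ->
            is_derive (fun u => f (al + s * u)) t (s * l)).
  { intros f l Hf. apply (is_derive_comp f (fun u => al + s * u) t l s Hf).
    auto_derive; [exact I|ring]. }
  intros (H1 & H2 & H3 & H4 & H5). unfold is_derive5, scale5. cbn [cU cV cZ2 cZ3 cZ4].
  split; [exact (P _ _ H1)|]. split; [exact (P _ _ H2)|]. split; [exact (P _ _ H3)|].
  split; [exact (P _ _ H4)|exact (P _ _ H5)].
Qed.

Lemma is_derive5_scale (c : R -> R5) (d : R5) (s t : R) :
  is_derive5 c t d -> is_derive5 (fun u => scale5 s (c u)) t (scale5 s d).
Proof.
  intros (H1 & H2 & H3 & H4 & H5). unfold is_derive5, scale5. cbn [cU cV cZ2 cZ3 cZ4].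
  split; [|split; [|split; [|split]]]; apply is_derive_scal; assumption.
Qed.

Lemma scale5_scale5 (s : R) (p : R5) : s * s = 1 -> scale5 s (scale5 s p) = p.
Proof.
  intros Hs. destruct p as [x0 x1 x2 x3 x4]. unfold scale5. cbn [cU cV cZ2 cZ3 cZ4].
  f_equal; rewrite <- Rmult_assoc, Hs; ring.
Qed.

(** * Componentwise negligibility and initial data *)

Lemma in_box_nrm5 (p : R5) : in_box (nrm5 p) p.
Proof.
  unfold nrm5.
  pose proof (pow2_ge_0 (cU p)). pose proof (pow2_ge_0 (cV p)). pose proof (pow2_ge_0 (cZ2 p)).
  pose proof (pow2_ge_0 (cZ3 p)). pose proof (pow2_ge_0 (cZ4 p)).
  unfold in_box. repeat split; (apply Rabs_le_of_sqr_le; [apply sqrt_pos|rewrite pow2_sqrt; lra]).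
Qed.

Lemma nrm5_le_of_box (n : R) (p : R5) : in_box n p -> nrm5 p <= 5 * n.
Proof.
  intros (H1 & H2 & H3 & H4 & H5).
  assert (Hn : 0 <= n) by (eapply Rle_trans; [apply Rabs_pos|exact H1]).
  assert (S : forall x, Rabs x <= n -> x ^ 2 <= n ^ 2).
  { intros x Hx. rewrite <- pow2_abs. apply pow_incr. split; [apply Rabs_pos|assumption]. }
  apply S in H1, H2, H3, H4, H5. unfold nrm5.
  rewrite <- (sqrt_Rsqr (5 * n)) by lra. apply sqrt_le_1_alt. unfold Rsqr.
  pose proof (pow2_ge_0 n). lra.
Qed.

Lemma in_box_triang (n n' : R) (p q c : R5) :
  in_box n (sub5 p c) -> in_box n' (sub5 q c) -> in_box (n + n') (sub5 p q).
Proof.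
  assert (T : forall x y z, Rabs (x - z) <= n -> Rabs (y - z) <= n' -> Rabs (x - y) <= n + n').
  { intros x y z Hx Hy. replace (x - y) with ((x - z) - (y - z)) by ring.
    unfold Rminus at 1. eapply Rle_trans; [apply Rabs_triang|]. rewrite Rabs_Ropp. lra. }
  intros (H1 & H2 & H3 & H4 & H5) (H1' & H2' & H3' & H4' & H5').
  unfold in_box, sub5 in *. cbn [cU cV cZ2 cZ3 cZ4] in *.
  repeat split; eapply T; eassumption.
Qed.

Lemma negligible_R5_small_box (r : R -> R5) : negligible_R5 r -> small_box r.
Proof.
  intros Hr m. destruct (Hr m) as (C & e0 & He0 & HC). exists (Rabs C), e0.
  split; [apply Rabs_pos|]. split; [assumption|]. intros eps He.
  apply in_box_le with (nrm5 (r eps)); [|apply in_box_nrm5].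
  eapply Rle_trans; [apply HC, He|]. apply Rmult_le_compat_r; [left; apply pow_lt; lra|apply RRle_abs].
Qed.

Lemma small_box_triang (p q c : R -> R5) :
  small_box (fun eps => sub5 (p eps) (c eps)) -> small_box (fun eps => sub5 (q eps) (c eps)) ->
  small_box (fun eps => sub5 (p eps) (q eps)).
Proof.
  intros Hp Hq m. destruct (Hp m) as (C & e0 & HC & He0 & H0). destruct (Hq m) as (D & e1 & HD & He1 & H1).
  exists (C + D), (Rmin e0 e1). split; [lra|]. split; [apply Rmin_glb_lt; assumption|].
  intros eps He. pose proof (Rmin_l e0 e1). pose proof (Rmin_r e0 e1).
  rewrite Rmult_plus_distr_r. eapply in_box_triang; [apply H0; lra|apply H1; lra].
Qed.

(** As [u' > 0] at 0, [u] is negative at some [h] in [[-eta, 0)]. The intermediate value theorem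
    finds every [- eps] with [eps < - u h] between [h] and 0, and [alpha eps] is no farther from 0
    than such a point. *)
Lemma entry_time_tends_to_0 (u alpha : R -> R) :
  smooth1 u -> u 0 = 0 -> 0 < Derive u 0 ->
  (exists eps0, 0 < eps0 /\ forall eps, 0 < eps < eps0 ->
     forall s, u s = - eps -> Rabs (alpha eps) <= Rabs s) ->
  forall eta, 0 < eta -> exists eps1, 0 < eps1 /\ forall eps, 0 < eps < eps1 -> Rabs (alpha eps) <= eta.
Proof.
  intros Hu H0 Hd (e0 & He0 & Hal) eta Heta.
  pose proof (Derive_correct u 0 (smooth1_ex_derive u 0 Hu)) as D. apply is_derive_Reals in D.
  destruct (D (Derive u 0) Hd) as [d Hdd].
  set (h := - Rmin eta (d / 2)).
  assert (Hd2 : 0 < d / 2) by (pose proof (cond_pos d); lra).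
  assert (Hh : - eta <= h < 0 /\ Rabs h < d).
  { unfold h. pose proof (Rmin_l eta (d / 2)). pose proof (Rmin_r eta (d / 2)).
    assert (0 < Rmin eta (d / 2)) by (apply Rmin_glb_lt; assumption).
    split; [lra|]. rewrite Rabs_left; lra. }
  specialize (Hdd h ltac:(lra) (proj2 Hh)). rewrite Rplus_0_l, H0, Rminus_0_r in Hdd.
  assert (Hneg : u h < 0).
  { apply Rabs_def2 in Hdd. assert (0 < u h / h) by lra.
    assert (u h = (u h / h) * h) by (field; lra). nra. }
  exists (Rmin e0 (- u h)). split; [apply Rmin_glb_lt; lra|].
  intros eps He. pose proof (Rmin_l e0 (- u h)). pose proof (Rmin_r e0 (- u h)).
  destruct (IVT_gen u h 0 (- eps)) as [s [Hs Es]].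
  - intro x. apply continuity_pt_filterlim. apply (smooth1_continuous u x Hu).
  - rewrite H0, Rmin_left, Rmax_right by lra. lra.
  - rewrite Rmin_left, Rmax_right in Hs by lra.
    eapply Rle_trans; [apply (Hal eps ltac:(lra) s Es)|]. apply Rabs_le. lra.
Qed.

Lemma smooth1_near_entry (f alpha : R -> R) (eta : R) :
  smooth1 f -> 0 < eta ->
  (forall eta, 0 < eta -> exists eps1, 0 < eps1 /\ forall eps, 0 < eps < eps1 -> Rabs (alpha eps) <= eta) ->
  exists eps1, 0 < eps1 /\ forall eps, 0 < eps < eps1 -> Rabs (f (alpha eps) - f 0) <= eta.
Proof.
  intros Hf Heta Hal.
  destruct (continuous_lt_locally (fun t => Rabs (f t - f 0)) 0 eta) as [d [Hd H]].
  - apply (continuous_comp (fun t => f t - f 0) Rabs); [|apply continuous_Rabs].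
    apply (continuous_minus f (fun _ => f 0)); [apply smooth1_continuous, Hf|apply continuous_const].
  - rewrite Rminus_diag, Rabs_R0. assumption.
  - destruct (Hal (d / 2) ltac:(lra)) as (e1 & He1 & Ha). exists e1. split; [assumption|].
    intros eps He. left. apply H. specialize (Ha eps He). rewrite Rminus_0_r. lra.
Qed.

Lemma small_box_le (r : R -> R5) (eta : R) : small_box r -> 0 < eta ->
  exists eps1, 0 < eps1 /\ forall eps, 0 < eps < eps1 -> in_box eta (r eps).
Proof.
  intros Hr Heta. destruct (Hr 1%nat) as (C & e0 & HC & He0 & H).
  exists (Rmin e0 (eta / (C + 1))). split; [apply Rmin_glb_lt; [assumption|apply Rdiv_lt_0_compat; lra]|].
  intros eps He. pose proof (Rmin_l e0 (eta / (C + 1))). pose proof (Rmin_r e0 (eta / (C + 1))).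
  apply in_box_le with (C * eps ^ 1); [|apply H; lra]. rewrite pow_1.
  assert (Hlt : eps <= eta / (C + 1)) by lra.
  apply Rmult_le_compat_r with (r := C + 1) in Hlt; [|lra].
  replace (eta / (C + 1) * (C + 1)) with eta in Hlt by (field; lra). lra.
Qed.

(** Two approximations are chained: the net is negligibly close to [gm] at [alpha eps], and [gm]
    there tends to its state at 0, where [U = 0] and [U' = c]. So [U' ^ 2 + kap * U ^ 2] starts near
    [c ^ 2]. *)
Lemma net_regular_start (kap s : R) (gm : R -> R5) (alpha : R -> R) (g : R -> R -> R5) :
  s * s = 1 -> smooth_curve gm -> cU (gm 0) = 0 -> 0 < Derive (fun t => cU (gm t)) 0 ->
  (forall eta, 0 < eta -> exists eps1, 0 < eps1 /\ forall eps, 0 < eps < eps1 -> Rabs (alpha eps) <= eta) ->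
  small_box (fun eps => sub5 (g eps (alpha eps)) (gm (alpha eps))) ->
  small_box (fun eps => sub5 (dern5 (g eps) 1 (alpha eps)) (dern5 gm 1 (alpha eps))) ->
  regular_start kap (Derive (fun t => cU (gm t)) 0 ^ 2)
    (fun eps t => g eps (alpha eps + s * t))
    (fun eps t => scale5 s (dern5 (g eps) 1 (alpha eps + s * t))).
Proof.
  intros Hs (G1 & G2 & G3 & G4 & G5) H0 Hd Hal Hp Hv.
  set (c := Derive (fun t => cU (gm t)) 0) in *.
  assert (Hc2 : 0 < c ^ 2) by (apply pow2_gt_0; lra).
  pose proof (Rabs_pos kap) as Hk.
  (* For an error [2 * eta <= 1] in [U] and in [U'], the energy changes by at most [2 * eta] times
     the bracket: [2 * c + 1] bounds [|x + c|], and [|kap|] comes from the potential term. *)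
  set (D := 2 * (2 * c + 1 + Rabs kap)).
  assert (HD : 0 < D) by (unfold D; lra).
  set (eta := Rmin 1 (c ^ 2 / 8 / D) / 2).
  assert (Heta0 : 0 < Rmin 1 (c ^ 2 / 8 / D)).
  { apply Rmin_glb_lt; [lra|]. apply Rdiv_lt_0_compat; lra. }
  assert (Heta : 0 < eta) by (unfold eta; lra).
  assert (Heta1 : 2 * eta <= 1).
  { unfold eta. pose proof (Rmin_l 1 (c ^ 2 / 8 / D)). lra. }
  assert (Heta2 : (2 * eta) * D <= c ^ 2 / 8).
  { assert (2 * eta <= c ^ 2 / 8 / D) by (unfold eta; pose proof (Rmin_r 1 (c ^ 2 / 8 / D)); lra).
    apply Rmult_le_compat_r with (r := D) in H; [|lra].
    replace (c ^ 2 / 8 / D * D) with (c ^ 2 / 8) in H by (field; lra). lra. }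
  destruct (small_box_le _ eta Hp Heta) as (e1 & He1 & B1).
  destruct (small_box_le _ eta Hv Heta) as (e2 & He2 & B2).
  destruct (smooth1_near_entry _ alpha eta G1 Heta Hal) as (e3 & He3 & B3).
  destruct (smooth1_near_entry _ alpha eta (smooth1_Derive _ G1) Heta Hal) as (e4 & He4 & B4).
  destruct (smooth1_near_entry _ alpha eta (smooth1_Derive _ G3) Heta Hal) as (e5 & He5 & B5).
  destruct (smooth1_near_entry _ alpha eta (smooth1_Derive _ G4) Heta Hal) as (e6 & He6 & B6).
  destruct (smooth1_near_entry _ alpha eta (smooth1_Derive _ G5) Heta Hal) as (e7 & He7 & B7).
  exists (Rabs c + Rabs (Derive (fun t => cZ2 (gm t)) 0) + Rabs (Derive (fun t => cZ3 (gm t)) 0)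
          + Rabs (Derive (fun t => cZ4 (gm t)) 0) + 1).
  exists (Rmin (Rmin (Rmin e1 e2) (Rmin e3 e4)) (Rmin (Rmin e5 e6) e7)).
  pose proof (Rabs_pos c). pose proof (Rabs_pos (Derive (fun t => cZ2 (gm t)) 0)).
  pose proof (Rabs_pos (Derive (fun t => cZ3 (gm t)) 0)). pose proof (Rabs_pos (Derive (fun t => cZ4 (gm t)) 0)).
  split; [lra|]. split; [repeat apply Rmin_glb_lt; assumption|].
  intros eps He.
  assert (Hm : eps < e1 /\ eps < e2 /\ eps < e3 /\ eps < e4 /\ eps < e5 /\ eps < e6 /\ eps < e7).
  { destruct He as [_ He]. clear - He.
    pose proof (Rmin_l (Rmin (Rmin e1 e2) (Rmin e3 e4)) (Rmin (Rmin e5 e6) e7)).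
    pose proof (Rmin_r (Rmin (Rmin e1 e2) (Rmin e3 e4)) (Rmin (Rmin e5 e6) e7)).
    pose proof (Rmin_l (Rmin e1 e2) (Rmin e3 e4)). pose proof (Rmin_r (Rmin e1 e2) (Rmin e3 e4)).
    pose proof (Rmin_l (Rmin e5 e6) e7). pose proof (Rmin_r (Rmin e5 e6) e7).
    pose proof (Rmin_l e1 e2). pose proof (Rmin_r e1 e2). pose proof (Rmin_l e3 e4).
    pose proof (Rmin_r e3 e4). pose proof (Rmin_l e5 e6). pose proof (Rmin_r e5 e6).
    repeat split; lra. }
  destruct (B1 eps ltac:(lra)) as (P1 & _). destruct (B2 eps ltac:(lra)) as (V1 & _ & V3 & V4 & V5).
  specialize (B3 eps ltac:(lra)). specialize (B4 eps ltac:(lra)). specialize (B5 eps ltac:(lra)).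
  specialize (B6 eps ltac:(lra)). specialize (B7 eps ltac:(lra)).
  cbv beta. rewrite Rmult_0_r, Rplus_0_r.
  unfold sub5 in P1, V1, V3, V4, V5. cbn [cU cV cZ2 cZ3 cZ4] in P1, V1, V3, V4, V5.
  set (q := dern5 (g eps) 1 (alpha eps)) in *.
  assert (Add : forall x y z, Rabs (x - y) <= eta -> Rabs (y - z) <= eta -> Rabs (x - z) <= 2 * eta).
  { intros x y z Hx Hy. replace (x - z) with ((x - y) + (y - z)) by ring.
    eapply Rle_trans; [apply Rabs_triang|]. lra. }
  pose proof (Add _ _ _ P1 B3) as E1. rewrite H0, Rminus_0_r in E1.
  pose proof (Add _ _ _ V1 B4) as E2. pose proof (Add _ _ _ V3 B5) as E3.
  pose proof (Add _ _ _ V4 B6) as E4. pose proof (Add _ _ _ V5 B7) as E5. fold c in E2.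
  assert (Hs1 : Rabs s = 1).
  { assert (Hf : (s - 1) * (s + 1) = 0) by lra. apply Rmult_integral in Hf.
    destruct Hf; [replace s with 1 by lra; apply Rabs_R1|replace s with (-1) by lra].
    rewrite Rabs_left; lra. }
  split.
  - cbn [scale5 cU].
    replace ((s * cU q) ^ 2) with ((s * s) * cU q ^ 2) by ring. rewrite Hs, Rmult_1_l.
    set (x := cU q) in *. set (u := cU (g eps (alpha eps))) in *.
    assert (T1 : Rabs ((x - c) * (x + c)) <= (2 * eta) * (2 * c + 1)).
    { apply Rabs_mult_le; [assumption|]. apply Rabs_le_between in E2. apply Rabs_le. lra. }
    assert (T2 : Rabs (kap * u ^ 2) <= Rabs kap * (2 * eta)).
    { apply Rabs_mult_le; [lra|]. rewrite <- RPow_abs. pose proof (Rabs_pos u).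
      apply Rle_trans with (1 * (2 * eta)); [|lra]. replace (Rabs u ^ 2) with (Rabs u * Rabs u) by ring.
      apply Rmult_le_compat; lra. }
    replace (x ^ 2 + kap * u ^ 2 - c ^ 2) with ((x - c) * (x + c) + kap * u ^ 2) by ring.
    eapply Rle_trans; [apply Rabs_triang|]. unfold D in Heta2.
    assert (0 <= (2 * eta) * (2 * c + 1 + Rabs kap)) by (apply Rmult_le_pos; lra). lra.
  - assert (HV : forall x y, Rabs (x - y) <= 2 * eta -> Rabs (s * x) <= Rabs y + 1).
    { intros x y Hxy. rewrite Rabs_mult, Hs1, Rmult_1_l. replace x with ((x - y) + y) by ring.
      eapply Rle_trans; [apply Rabs_triang|]. lra. }
    apply HV in E2, E3, E4, E5.
    unfold in_vbox, scale5. cbn [cU cZ2 cZ3 cZ4]. repeat split; lra.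
Qed.

(** The values [s = 1] and [s = -1] run the time forwards and backwards from [alpha eps]. Since
    [|alpha eps| <= 1], all instants lie in one compact interval independent of [eps], on which
    c-boundedness confines the positions and negligibility the residuals. *)
Lemma net_trajectory (sigma a e : R) (H : R -> R -> R -> R) (rho : R -> R) (T s : R)
    (alpha : R -> R) (g : R -> R -> R5) :
  s * s = 1 -> 0 <= T -> smooth3 H -> smooth1 rho -> (forall x, 1 < Rabs x -> rho x = 0) ->
  smooth_net g -> c_bounded g -> gen_solution sigma a e H rho g ->
  (exists eps1, 0 < eps1 /\ forall eps, 0 < eps < eps1 -> Rabs (alpha eps) <= 1) ->
  trajectory sigma a e H rho T
    (fun eps t => g eps (alpha eps + s * t))
    (fun eps t => scale5 s (dern5 (g eps) 1 (alpha eps + s * t)))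
    (fun eps t => residual sigma a e H rho eps (g eps) (alpha eps + s * t)).
Proof.
  intros Hs HT HH Hr Hsupp Hsm Hcb [_ Hsol] (e1 & He1 & Hal).
  assert (Hs1 : s = 1 \/ s = -1).
  { assert (Hf : (s - 1) * (s + 1) = 0) by lra. apply Rmult_integral in Hf. destruct Hf; lra. }
  set (K := fun c => - (T + 1) <= c <= T + 1).
  assert (HK : compact K) by apply compact_P3.
  assert (Hin : forall eps t, 0 < eps < e1 -> 0 <= t <= T -> K (alpha eps + s * t)).
  { intros eps t He Ht. specialize (Hal eps He). apply Rabs_le_between in Hal.
    unfold K. destruct Hs1 as [-> | ->]; lra. }
  split.
  - destruct (Hcb K HK) as (C & e0 & He0 & HC).
    exists (Rabs C), (Rmin e0 e1). split; [apply Rabs_pos|]. split; [apply Rmin_glb_lt; assumption|].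
    intros eps t He Ht. pose proof (Rmin_l e0 e1). pose proof (Rmin_r e0 e1).
    pose proof (smooth_net_smooth_curve g eps Hsm (proj1 He)) as Hc.
    split; [|split].
    + apply (is_derive5_reparam (g eps)). exact (smooth_curve_is_derive5 (g eps) 0 _ Hc).
    + rewrite acc_time_reversal by assumption.
      rewrite <- residual_eq by (assumption || lra).
      (* The second derivative acquires [s * s = 1]: one [s] from the scaled velocity, one from the
         reparametrisation. *)
      rewrite <- (scale5_scale5 s (dern5 (g eps) 2 (alpha eps + s * t)) Hs).
      apply (is_derive5_scale (fun u => dern5 (g eps) 1 (alpha eps + s * u))).
      apply (is_derive5_reparam (dern5 (g eps) 1)). apply smooth_curve_is_derive5, Hc.
    + apply in_box_le with (nrm5 (g eps (alpha eps + s * t))); [|apply in_box_nrm5].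
      eapply Rle_trans; [apply HC; [lra|apply Hin; lra]|apply RRle_abs].
  - intro m. destruct (Hsol K HK m) as (C & e0 & He0 & HC).
    exists (Rabs C), (Rmin e0 e1). split; [apply Rabs_pos|]. split; [apply Rmin_glb_lt; assumption|].
    intros eps t He Ht. pose proof (Rmin_l e0 e1). pose proof (Rmin_r e0 e1).
    eapply in_box_le; [|apply in_box_nrm5].
    eapply Rle_trans; [apply HC; [lra|apply Hin; lra]|].
    apply Rmult_le_compat_r; [left; apply pow_lt; lra|apply RRle_abs].
Qed.

Lemma moderate_net_sub (g g' : R -> R -> R5) :
  smooth_net g -> smooth_net g' -> moderate_net g -> moderate_net g' ->
  moderate_net (fun eps t => sub5 (g eps t) (g' eps t)).
Proof.
  intros Hs Hs' Hg Hg' K HK k.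
  destruct (Hg K HK k) as (N & C & e0 & He0 & HC). destruct (Hg' K HK k) as (N' & C' & e1 & He1 & HC').
  exists (N + N')%nat, (5 * (Rabs C + Rabs C')), (Rmin (Rmin e0 e1) 1).
  split; [repeat apply Rmin_glb_lt; lra|]. intros eps He t Ht.
  pose proof (Rmin_l (Rmin e0 e1) 1). pose proof (Rmin_r (Rmin e0 e1) 1).
  pose proof (Rmin_l e0 e1). pose proof (Rmin_r e0 e1).
  destruct (smooth_net_smooth_curve g eps Hs (proj1 He)) as (S1 & S2 & S3 & S4 & S5).
  destruct (smooth_net_smooth_curve g' eps Hs' (proj1 He)) as (S1' & S2' & S3' & S4' & S5').
  assert (E : dern5 (fun s => sub5 (g eps s) (g' eps s)) k t = sub5 (dern5 (g eps) k t) (dern5 (g' eps) k t)).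
  { unfold dern5, sub5. cbn [cU cV cZ2 cZ3 cZ4].
    f_equal; (apply Derive_n_minus; apply filter_forall; intros y j _;
      match goal with Hx : smooth1 ?f |- ex_derive_n ?f _ _ => exact (Hx j y) end). }
  rewrite E.
  assert (Hpow : forall n j, 0 <= j -> (n <= N + N')%nat -> j * / eps ^ n <= j * / eps ^ (N + N')).
  { intros n j Hj Hn. apply Rmult_le_compat_l; [assumption|].
    apply Rinv_le_contravar; [apply pow_lt; lra|].
    replace (N + N')%nat with (n + (N + N' - n))%nat by lia. rewrite pow_add.
    assert (0 < eps ^ n) by (apply pow_lt; lra).
    assert (eps ^ (N + N' - n) <= 1) by (rewrite <- (pow1 (N + N' - n)); apply pow_incr; lra).
    rewrite <- (Rmult_1_r (eps ^ n)) at 2. apply Rmult_le_compat_l; lra. }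
  assert (HB : forall c n p, nrm5 p <= c * / eps ^ n -> (n <= N + N')%nat ->
     in_box (Rabs c * / eps ^ (N + N')) (sub5 p (mk5 0 0 0 0 0))).
  { intros c n p Hp Hn. apply in_box_le with (nrm5 p).
    - eapply Rle_trans; [exact Hp|]. eapply Rle_trans; [|apply (Hpow n (Rabs c) (Rabs_pos c) Hn)].
      apply Rmult_le_compat_r; [left; apply Rinv_0_lt_compat, pow_lt; lra|apply RRle_abs].
    - replace (sub5 p (mk5 0 0 0 0 0)) with p; [apply in_box_nrm5|].
      destruct p as [x0 x1 x2 x3 x4]. unfold sub5. cbn [cU cV cZ2 cZ3 cZ4]. f_equal; ring. }
  rewrite Rmult_assoc, Rmult_plus_distr_r. apply nrm5_le_of_box.
  eapply in_box_triang.
  - apply (HB C N); [apply HC; [lra|assumption]|lia].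
  - apply (HB C' N'); [apply HC'; [lra|assumption]|lia].
Qed.

Theorem mainTheorem3
  (sigma a e : R) (H : R -> R -> R -> R) (rho : R -> R)
  (gm : R -> R5) (alpha : R -> R) (gam gamt : R -> R -> R5)
  (Hsigma : sigma = 1 \/ sigma = -1)
  (Ha : 0 < a)
  (He : e = -1 \/ e = 0 \/ e = 1)
  (HH : smooth3 H)
  (Hrho : smooth1 rho)
  (Hsupp : forall x, 1 < Rabs x -> rho x = 0)
  (Hint : is_RInt_gen rho (Rbar_locally m_infty) (Rbar_locally p_infty) 1)
  (Hgeo : bg_geodesic sigma a gm)
  (HU0 : cU (gm 0) = 0)
  (HUd0 : 0 < Derive (fun t => cU (gm t)) 0)
  (Hnorm : forall t, eta sigma (dern5 gm 1 t) (dern5 gm 1 t) = e)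
  (Halpha : exists eps0, 0 < eps0 /\ forall eps, 0 < eps < eps0 ->
      alpha eps < 0 /\ cU (gm (alpha eps)) = - eps /\
      forall s, cU (gm s) = - eps -> Rabs (alpha eps) <= Rabs s)
  (Hgam : rep_GM sigma a gam)
  (Hgamt : rep_GM sigma a gamt)
  (Hsol : gen_solution sigma a e H rho gam)
  (Hsolt : gen_solution sigma a e H rho gamt)
  (Hini0 : negligible_R5 (fun eps => sub5 (gam eps (alpha eps)) (gm (alpha eps))))
  (Hini1 : negligible_R5 (fun eps => sub5 (dern5 (gam eps) 1 (alpha eps)) (dern5 gm 1 (alpha eps))))
  (Hini0t : negligible_R5 (fun eps => sub5 (gamt eps (alpha eps)) (gm (alpha eps))))
  (Hini1t : negligible_R5 (fun eps => sub5 (dern5 (gamt eps) 1 (alpha eps)) (dern5 gm 1 (alpha eps)))) :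
  negligible_net (fun eps t => sub5 (gam eps t) (gamt eps t)).
Proof.
  destruct Hgam as (Sg & Mg & Cg & _). destruct Hgamt as (St & Mt & Ct & _).
  destruct Hgeo as (Sgm & _ & _).
  (* Negligibility asks for moderateness of all derivatives but for smallness in order zero only, so
     it remains to compare positions. *)
  split; [apply moderate_net_sub; assumption|].
  intros K HK m.
  apply negligible_R5_small_box in Hini0, Hini1, Hini0t, Hini1t.
  destruct (compact_P1 K HK) as (lo & hi & Hbd).
  (* The extra 1 allows for the shift by [alpha eps], which lies in [[-1,1]] for small [eps]. *)
  set (T := Rabs lo + Rabs hi + 1).
  assert (HT : 0 <= T) by (unfold T; pose proof (Rabs_pos lo); pose proof (Rabs_pos hi); lra).
  assert (Hal : forall eta, 0 < eta -> exists eps1, 0 < eps1 /\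
            forall eps, 0 < eps < eps1 -> Rabs (alpha eps) <= eta).
  { apply (entry_time_tends_to_0 (fun t => cU (gm t)) alpha (proj1 Sgm) HU0 HUd0).
    destruct Halpha as (e0 & He0 & Hal). exists e0. split; [assumption|]. intros eps Heps. apply Hal, Heps. }
  pose proof (smooth_regular_profile H rho HH Hrho Hsupp) as Hreg.
  assert (Hone : forall s, s * s = 1 ->
     small_box_net T (fun eps t => sub5 (gam eps (alpha eps + s * t)) (gamt eps (alpha eps + s * t)))).
  { intros s Hs.
    apply (trajectory_unique sigma a e H rho T (Derive (fun t => cU (gm t)) 0 ^ 2)
      (fun eps t => gam eps (alpha eps + s * t))
      (fun eps t => scale5 s (dern5 (gam eps) 1 (alpha eps + s * t)))
      (fun eps t => residual sigma a e H rho eps (gam eps) (alpha eps + s * t))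
      (fun eps t => gamt eps (alpha eps + s * t))
      (fun eps t => scale5 s (dern5 (gamt eps) 1 (alpha eps + s * t)))
      (fun eps t => residual sigma a e H rho eps (gamt eps) (alpha eps + s * t)));
      try assumption.
    (* Positivity of [c2] is the transversality of the background geodesic to the wave. *)
    - apply pow2_gt_0. lra.
    - apply net_trajectory; try assumption. apply Hal. lra.
    - apply net_regular_start; assumption.
    - apply net_trajectory; try assumption. apply Hal. lra.
    - apply net_regular_start; assumption.
    - cbv beta. rewrite Rmult_0_r.
      intros k. destruct (small_box_triang _ _ _ Hini0 Hini0t k) as (C & e0 & HC & He0 & HB).
      exists C, e0. split; [assumption|]. split; [assumption|]. intros eps Heps.
      rewrite Rplus_0_r. apply HB, Heps.
    - cbv beta. rewrite Rmult_0_r.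
      intros k. destruct (small_box_triang _ _ _ Hini1 Hini1t k) as (C & e0 & HC & He0 & HB).
      exists C, e0. split; [assumption|]. split; [assumption|]. intros eps Heps.
      rewrite Rplus_0_r. specialize (HB eps Heps).
      assert (Hs1 : Rabs s = 1).
      { assert (Hf : (s - 1) * (s + 1) = 0) by lra. apply Rmult_integral in Hf.
        destruct Hf; [replace s with 1 by lra; apply Rabs_R1|replace s with (-1) by lra].
        rewrite Rabs_left; lra. }
      destruct HB as (B1 & B2 & B3 & B4 & B5).
      unfold in_box, sub5, scale5 in *. cbn [cU cV cZ2 cZ3 cZ4] in *.
      rewrite <- !Rmult_minus_distr_l, !Rabs_mult, Hs1, !Rmult_1_l.
      repeat split; assumption. }
  destruct (Hone 1 ltac:(lra) m) as (C1 & e1 & HC1 & He1 & B1).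
  destruct (Hone (-1) ltac:(lra) m) as (C2 & e2 & HC2 & He2 & B2).
  destruct (Hal 1 Rlt_0_1) as (e3 & He3 & B3).
  exists (5 * (C1 + C2)), (Rmin (Rmin e1 e2) e3).
  split; [repeat apply Rmin_glb_lt; assumption|]. intros eps Heps t Ht.
  pose proof (Rmin_l (Rmin e1 e2) e3). pose proof (Rmin_r (Rmin e1 e2) e3).
  pose proof (Rmin_l e1 e2). pose proof (Rmin_r e1 e2).
  specialize (B3 eps ltac:(lra)). apply Rabs_le_between in B3.
  assert (HtT : - (T - 1) <= t <= T - 1).
  { specialize (Hbd t Ht). unfold T. pose proof (RRle_abs hi). pose proof (RRle_abs (- lo)) as Hlo.
    rewrite Rabs_Ropp in Hlo. pose proof (Rabs_pos lo). pose proof (Rabs_pos hi). lra. }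
  assert (Hem : 0 < eps ^ m) by (apply pow_lt; lra).
  assert (M1 : 0 <= C1 * eps ^ m) by (apply Rmult_le_pos; lra).
  assert (M2 : 0 <= C2 * eps ^ m) by (apply Rmult_le_pos; lra).
  rewrite Rmult_assoc. apply nrm5_le_of_box.
  destruct (Rle_dec (alpha eps) t) as [Hle|Hgt].
  - specialize (B1 eps (t - alpha eps) ltac:(lra) ltac:(lra)). cbv beta in B1.
    replace (alpha eps + 1 * (t - alpha eps)) with t in B1 by ring.
    apply in_box_le with (C1 * eps ^ m); [lra|assumption].
  - specialize (B2 eps (alpha eps - t) ltac:(lra) ltac:(lra)). cbv beta in B2.
    replace (alpha eps + -1 * (alpha eps - t)) with t in B2 by ring.
    apply in_box_le with (C2 * eps ^ m); [lra|assumption].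
Qed.
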